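(* Let $M$ be a von Neumann algebra and let $\phi$ be a faithful normal semifinite weight on $M$. Suppose $\theta$ is a unital normal endomorphism of $M$ which is $\phi$-preserving, i.e. $\phi(\theta(x))=\phi(x)$ for all $x\in M^+$. Then $\theta$ is equimodular if and only if there exists a faithful normal conditional expectation $E:M\to\theta(M)$ (onto $\theta(M)$) which is $\phi$-preserving, i.e. $\phi(E(x))=\phi(x)$ for all $x\in M^+$. Furthermore, such a conditional expectation is unique if it exists, since $E(x)e_\theta=e_\theta xe_\theta$ for all $x\in M$, where $e_\theta$ is the orthogonal projection onto the closure of $(\theta(M)\cap\mathfrak{N}_\phi)_\phi$, and moreover $e_\theta=u_\theta u_\theta^*$.
   Context: All Hilbert spaces are separable, all von Neumann algebras have separable predual, and all endomorphisms are $*$-preserving. For a faithful normal semifinite weight $\phi$ on $M$, let $\mathfrak{N}_\phi=\{x\in M:\phi(x^*x)<\infty\}$, let $\mathcal{H}_\phi$ be the GNS Hilbert space with canonical map $\mathfrak{N}_\phi\ni x\mapsto x_\phi\in\mathcal{H}_\phi$, and let $J_\phi$ be the modular conjugation. $M$ is identified with its image under the GNS representation on $\mathcal{H}_\phi$. If $\theta$ is a unital normal $\phi$-preserving endomorphism of $M$, $u_\theta\in\mathcal{B}(\mathcal{H}_\phi)$ denotes the unique isometry with $u_\theta(x_\phi)=(\theta(x))_\phi$ for $x\in\mathfrak{N}_\phi$. The endomorphism $\theta$ is called equimodular (with respect to $\phi$) if $\phi$ is $\theta$-invariant and $u_\theta J_\phi=J_\phi u_\theta$. *)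

(* Defs.v *)
From HB Require Import structures.
From mathcomp Require Import all_boot all_order all_algebra sesquilinear.
From mathcomp Require Import complex.
From mathcomp Require Import all_classical all_reals all_analysis.

Set Implicit Arguments.
Unset Strict Implicit.
Unset Printing Implicit Defensive.

Import Order.TTheory GRing.Theory Num.Theory.
Import numFieldNormedType.Exports.

Local Open Scope classical_set_scope.
Local Open Scope ring_scope.
Local Open Scope complex_scope.

(* Separable complex Hilbert spaces.  The inner product is linear in its first
   argument and conjugate-linear in the second one. *)
Record hilbert (R : realType) := Hilbert {
  hilbert_sort :> completeNormedModType R[i] ;
  dotp : {dot hilbert_sort for Num.conj} ;
  dotp_norm : forall xi : hilbert_sort, dotp xi xi = `|xi| ^+ 2 ;
  hilbert_separable : exists D : set hilbert_sort, countable D /\ dense D }.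

Notation "''[' u , v ]" := (dotp _ u v).

(* Operators are plain functions; sums and scalar multiples are pointwise, the
   product is composition. *)
Notation op H := (hilbert_sort H -> hilbert_sort H).

Section BoundedOperators.
Context {R : realType} {H : hilbert R}.

Definition bounded_op : set (op H) := [set x | linear x /\ continuous x].

Definition adj (x : op H) : op H :=
  xget 0 [set y : op H | bounded_op y /\ forall xi eta, '[x xi, eta] = '[xi, y eta]].

(* In the order of R[i], 0 <= z says that z is real and nonnegative. *)
Definition op_pos (x : op H) : Prop := forall xi, 0 <= '[x xi, xi].

Definition op_le (x y : op H) : Prop := op_pos (y - x).

Definition isometric_op (u : op H) : Prop :=
  linear u /\ forall xi, `|u xi| = `|xi|.

Definition orth_proj_on (V : set H) (e : op H) : Prop :=
  forall xi, V (e xi) /\ forall zeta, V zeta -> '[xi - e xi, zeta] = 0.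

Definition antiunitary (J : op H) : Prop :=
  [/\ forall xi eta, J (xi + eta) = J xi + J eta,
      forall (a : R[i]) xi, J (a *: xi) = a^* *: J xi,
      forall xi eta, '[J xi, J eta] = '[eta, xi] &
      forall eta, exists xi, J xi = eta].

(* An unbounded operator is given by its graph G; since its domain is dense,
   the last clause says that G is the graph of its own adjoint (in particular
   G is linear and functional). *)
Definition pos_selfadjoint_graph (G : set (H * H)) : Prop :=
  [/\ dense (fst @` G),
      forall p, G p -> 0 <= '[p.2, p.1] &
      forall p, G p <-> forall q, G q -> '[q.2, p.1] = '[q.1, p.2]].

Definition commutant (S : set (op H)) : set (op H) :=
  [set y | bounded_op y /\ forall x, S x -> x \o y = y \o x].

Definition von_neumann_algebra (M : set (op H)) : Prop :=
  [/\ M `<=` bounded_op,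
      forall x, M x -> M (adj x) &
      commutant (commutant M) = M].

Definition pos_part (M : set (op H)) : set (op H) := M `&` op_pos.

Definition upward_directed (D : set (op H)) : Prop :=
  D !=set0 /\
  forall x y, D x -> D y -> exists z, [/\ D z, op_le x z & op_le y z].

Definition is_op_sup (M D : set (op H)) (s : op H) : Prop :=
  [/\ pos_part M s,
      forall x, D x -> op_le x s &
      forall t, pos_part M t -> (forall x, D x -> op_le x t) -> op_le s t].

End BoundedOperators.

Definition linear_on {K : nzRingType} {U V : lmodType K} (A : set U)
    (f : U -> V) : Prop :=
  forall (a : K) (x y : U), A x -> A y -> f (a *: x + y) = a *: f x + f y.

Section MapsBetweenAlgebras.
Context {R : realType} {H : hilbert R}.

Definition normal_map (M N : set (op H)) (f : op H -> op H) : Prop :=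
  forall D s, D `<=` pos_part M -> upward_directed D -> is_op_sup M D s ->
    is_op_sup N (f @` D) (f s).

Definition unital_normal_endomorphism (M : set (op H)) (theta : op H -> op H)
    : Prop :=
  [/\ forall x, M x -> M (theta x),
      linear_on M theta,
      forall x y, M x -> M y -> theta (x \o y) = theta x \o theta y,
      forall x, M x -> theta (adj x) = adj (theta x) &
      theta idfun = idfun /\ normal_map M M theta].

Definition conditional_expectation (M N : set (op H)) (E : op H -> op H)
    : Prop :=
  [/\ forall x, M x -> N (E x),
      linear_on M E,
      forall x, pos_part M x -> op_pos (E x),
      forall y, N y -> E y = y &
      forall a x b, N a -> M x -> N b -> E (a \o x \o b) = a \o E x \o b].

Definition faithful_map (M : set (op H)) (E : op H -> op H) : Prop :=
  forall x, pos_part M x -> E x = 0 -> x = 0.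

End MapsBetweenAlgebras.

Section Weights.
Context {R : realType} {H : hilbert R}.
Implicit Types (M : set (op H)) (phi : op H -> \bar R).

(* Only the values of phi on the positive part of M matter. *)
Definition weight M phi : Prop :=
  [/\ forall x, pos_part M x -> (0 <= phi x)%E,
      forall x y, pos_part M x -> pos_part M y ->
        phi (x + y) = (phi x + phi y)%E &
      forall (a : R) x, 0 <= a -> pos_part M x ->
        phi (a%:C *: x) = (a%:E * phi x)%E].

Definition faithful_weight M phi : Prop :=
  forall x, pos_part M x -> phi x = 0%E -> x = 0.

Definition normal_weight M phi : Prop :=
  forall D s, D `<=` pos_part M -> upward_directed D -> is_op_sup M D s ->
    phi s = ereal_sup (phi @` D).

Definition nphi M phi : set (op H) :=
  [set x | M x /\ (phi (adj x \o x) < +oo)%E].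

(* Density for the strong operator topology, i.e. pointwise convergence; for
   the left ideal nphi M phi it is the same as sigma-weak density. *)
Definition semifinite_weight M phi : Prop :=
  M `<=` closure (nphi M phi : set {ptws H -> H}).

Definition fns_weight M phi : Prop :=
  [/\ weight M phi, faithful_weight M phi, normal_weight M phi &
      semifinite_weight M phi].

Definition preserves_weight M phi (f : op H -> op H) : Prop :=
  forall x, pos_part M x -> phi (f x) = phi x.

End Weights.

Section GNS.
Context {R : realType} {H K : hilbert R}.
Variables (M : set (op H)) (phi : op H -> \bar R).

(* (K, Lambda, pi) is the GNS construction of phi, x_phi being Lambda x; it is
   determined up to unitary equivalence.  By polarization the second clause
   gives '[x_phi, y_phi] = phi(y^* x), for the linear extension of phi. *)
Definition is_gns (Lambda : op H -> K) (pi : op H -> op K) : Prop :=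
  [/\ linear_on (nphi M phi) Lambda,
      forall x, nphi M phi x ->
        '[Lambda x, Lambda x] = (fine (phi (adj x \o x)))%:C,
      dense (Lambda @` nphi M phi) &
      forall x, M x -> bounded_op (pi x) /\
        forall y, nphi M phi y -> pi x (Lambda y) = Lambda (x \o y)].

Definition tomita_graph (Lambda : op H -> K) : set (K * K) :=
  closure [set (Lambda x, Lambda (adj x)) |
             x in [set x | nphi M phi x /\ nphi M phi (adj x)]].

(* J is the antiunitary part of the polar decomposition S = J Delta^(1/2) of
   the closed operator S with graph tomita_graph; G is the graph of
   Delta^(1/2).  Such J and G are unique. *)
Definition is_modular_conjugation (Lambda : op H -> K) (J : op K) : Prop :=
  antiunitary J /\
  exists2 G : set (K * K), pos_selfadjoint_graph G &
    tomita_graph Lambda = [set (p.1, J p.2) | p in G].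

Definition is_gns_isometry (Lambda : op H -> K) (theta : op H -> op H)
    (u : op K) : Prop :=
  isometric_op u /\ forall x, nphi M phi x -> u (Lambda x) = Lambda (theta x).

(* J and u stand for the modular conjugation and the isometry of theta. *)
Definition equimodular (J : op K) (theta : op H -> op H) (u : op K) : Prop :=
  preserves_weight M phi theta /\ u \o J = J \o u.

Definition fn_preserving_expectation (N : set (op H)) (E : op H -> op H)
    : Prop :=
  [/\ conditional_expectation M N E, faithful_map M E, normal_map M N E &
      preserves_weight M phi E].

End GNS.

(* Main.v *)
Require Import Defs.
From HB Require Import structures.
From mathcomp Require Import all_boot all_order all_algebra sesquilinear.
From mathcomp Require Import complex.
From mathcomp Require Import all_classical all_reals all_analysis.
From mathcomp Require Import ring lra.
Set Implicit Arguments.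
Unset Strict Implicit.
Unset Printing Implicit Defensive.
Import Order.TTheory GRing.Theory Num.Theory.
Import numFieldNormedType.Exports.
Local Open Scope classical_set_scope.
Local Open Scope ring_scope.
Local Open Scope complex_scope.

(** The Tomita operator [S] of [phi] is handled through its graph, without modular
automorphisms. Let [F] be the adjoint of [S] and [R = (1 + S F)^-1].

For [x = x^*] in [nphi] the vector [R Lambda x] is right bounded, with bound half the norm
of [x]. Conversely a bounded operator [A] on [K] that agrees with left multiplication by a
vector [chi = S chi] on all right bounded vectors comes from [M], and [chi] is then its GNS
vector. If [u] commutes with [J], then [u] and [u^*] commute with [S], hence with [R], so
[u^* pi(x) u] acts as left multiplication by [u^* Lambda x] and therefore is [pi (Phi x)] for
some [Phi x] in [M]; the expectation is [theta \o Phi]. For an approximate unit [e_n] in [nphi]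
the vectors [2 R Lambda e_n] recover [phi]: [phi x <= C] iff [4 <pi x eta_n, eta_n> <= C] for all
[n], where [eta_n = R Lambda e_n]; since [u eta_n] is the vector attached to [theta (e_n)],
[phi (Phi x) = phi x].

Conversely an expectation [E] satisfies [u u^* Lambda x = Lambda (E x)] by the
Kadison-Schwarz inequality, so [u^*] commutes with [S] as well; thus [u] commutes with
[C^2 = B (1 - B)], where [B = (1 + Delta)^-1] and [C = Delta^(1/2) B >= 0], hence with [C] and,
[J C] being [S B], with [J]. *)

(** The constants have one origin. As [S F] is the inverse of [Delta = F S], the operator [R] is
    [Delta (1 + Delta)^-1], which is [1/2] on whatever [Delta] fixes: on everything for a trace, and
    formally on the GNS vector of [1] in general. So right multiplication by [R Lambda x] costs half
    the norm of [x], [R Lambda e_n] behaves like half the vector of [1], and the factors [2] and [4]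
    undo this for linear and quadratic expressions.

    Self-adjoint [x] are singled out because [eta = R Lambda x] then satisfies [F eta = eta] and
    [S eta = Lambda x - eta]. Pairing these two real equations with each other is the source of the
    estimates on right multiplications.

    Two obstacles shape the rest. A strong limit of operators in [pi M] must be brought back to [M];
    this is done for bounded sequences by comparing the two faithful normal representations, on [H]
    and on [K]. And a vector fixed by [S] is approximated by vectors [Lambda z] with no control on
    the norm of [z], so that limits are taken on the resolvents of [z]. *)

Lemma eps_seq (R : realType) : exists eps : nat -> R, (forall n, 0 < eps n) /\
  forall e, 0 < e -> exists N, forall n, (N <= n)%N -> eps n <= e.
Proof.
exists (fun n => n.+1%:R^-1); split=> [n|e e0]; first by rewrite invr_gt0.
by have [N _ hN] := near_infty_natSinv_lt (PosNum e0); exists N => n /hN /ltW.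
Qed.

(** * Orthogonal projection and Riesz representation for real semidefinite forms *)

Section Projection.
Context {R : realType} (W : lmodType R[i]) (ip : W -> W -> R) (V : set W).
Hypothesis ipD : forall a b c, ip (a + b) c = ip a c + ip b c.
Hypothesis ipZ : forall (k : R) a b, ip (k%:C *: a) b = k * ip a b.
Hypothesis ipC : forall a b, ip a b = ip b a.
Hypothesis ip_ge0 : forall a, 0 <= ip a a.
Hypothesis VD : forall a b, V a -> V b -> V (a + b).
Hypothesis VZ : forall (k : R) a, V a -> V (k%:C *: a).
Hypothesis V0 : V 0.
Hypothesis Vcompl : forall u : nat -> W, (forall n, V (u n)) ->
  (forall e : R, 0 < e -> exists N, forall n m, (N <= n)%N -> (N <= m)%N ->
     ip (u n - u m) (u n - u m) <= e) ->
  exists2 l, V l & forall e : R, 0 < e -> exists N, forall n, (N <= n)%N ->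
     ip (u n - l) (u n - l) <= e.

Let ipDr a b c : ip c (a + b) = ip c a + ip c b.
Proof. by rewrite ipC ipD !(ipC c). Qed.
Let ip0 b : ip 0 b = 0.
Proof. by rewrite -(scale0r (0 : W)) -[0%R]/(0%:C) ipZ mul0r. Qed.
Let ipN a b : ip (- a) b = - ip a b.
Proof. by apply: (addIr (ip a b)); rewrite -ipD !addNr ip0. Qed.
Let ipNr a b : ip a (- b) = - ip a b.
Proof. by rewrite ipC ipN ipC. Qed.
Let ipZr (k : R) a b : ip a (k%:C *: b) = k * ip a b.
Proof. by rewrite ipC ipZ ipC. Qed.

Let ip_quad x v (t : R) :
  ip (x - t%:C *: v) (x - t%:C *: v) = ip x x - 2 * t * ip x v + t ^+ 2 * ip v v.
Proof. by rewrite !(ipD, ipDr, ipN, ipNr, ipZ, ipZr) (ipC v x); ring. Qed.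

(** The form lives on a bare module and is only semidefinite, so that one argument serves closed
    real subspaces of a Hilbert space, kernels of functionals for an energy form, and graphs in
    [K * K]. *)
Lemma proj_exists w : exists2 v, V v & forall v', V v' -> ip (w - v) v' = 0.
Proof.
pose D := [set ip (w - v) (w - v) | v in V].
have Dinf : has_inf D.
  split; first by exists (ip (w - 0) (w - 0)), 0.
  by exists 0 => _ [v _ <-].
pose d := inf D.
have dle v : V v -> d <= ip (w - v) (w - v).
  by move=> Vv; apply: ge_inf; [exact: Dinf.2 | exists v].
have [eps [eps_gt0 inv_small]] := eps_seq R.
have /choice[u uP] (n : nat) : exists v, V v /\ ip (w - v) (w - v) <= d + eps n.
  have [_ [v Vv <-] /ltW h] := @inf_adherent _ D (eps n) (eps_gt0 n) Dinf.
  by exists v.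
have VB a b : V a -> V b -> V (a - b).
  by move=> Va Vb; rewrite -scaleN1r -(rmorphN1 (real_complex R)); apply: VD => //; exact: VZ.
have [||l Vl lP] := Vcompl (u := u); first by move=> n; case: (uP n).
  move=> e e0; have [|N hN] := inv_small (e / 4); first lra.
  exists N => n m Nn Nm.
  have [Vn hn] := uP n; have [Vm hm] := uP m.
  have := dle _ (VZ 2^-1 (VD Vn Vm)).
  have -> : ip (w - 2^-1%:C *: (u n + u m)) (w - 2^-1%:C *: (u n + u m)) =
    2^-1 * ip (w - u n) (w - u n) + 2^-1 * ip (w - u m) (w - u m) - 4^-1 * ip (u n - u m) (u n - u m).
    rewrite !(ipD, ipDr, ipN, ipNr, ipZ, ipZr) (ipC (u n) w) (ipC (u m) w) (ipC (u m) (u n)).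
    by field.
  have := hN _ Nn; have := hN _ Nm; lra.
exists l => // v' Vv'.
set p := ip _ _; pose q := ip v' v'; have q0 : 0 <= q by exact: ip_ge0.
(* Minimality along [u n + t v'] bounds [2 t ip (w - u n) v'], positivity bounds
   [2 t ip (u n - l) v']. The sum passes to the limit by small errors [e] alone. *)
have key (t : R) : 2 * t * p <= 4 * (t ^+ 2 * q).
  apply/ler_addgt0Pr => e e0.
  have [|N1 hN1] := inv_small (e / 2); first lra.
  have [|N2 hN2] := lP (e / 2); first lra.
  pose n := maxn N1 N2.
  have h1 : eps n <= e / 2 by apply: hN1; exact: leq_maxl.
  have h2 : ip (u n - l) (u n - l) <= e / 2 by apply: hN2; exact: leq_maxr.
  have [Vn hn] := uP n.
  have := dle _ (VD Vn (VZ t Vv')).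
  rewrite opprD addrA ip_quad -/q.
  have : p = ip (w - u n) v' + ip (u n - l) v' by rewrite -ipD addrA subrK.
  have := ip_ge0 ((u n - l) - t%:C *: v'); rewrite ip_quad -/q.
  nra.
apply/eqP; rewrite eq_le; apply/andP; split.
  apply/ler_addgt0Pr => e e0; rewrite add0r.
  (* This [t] makes [2 t q] at most [e]; the [+ 1] keeps the denominator positive when [q = 0]. *)
  have t0 : 0 < e / (2 * (q + 1)) by rewrite divr_gt0 //; nra.
  have := key (e / (2 * (q + 1))).
  set t := e / _ in t0 *; have te : 2 * t * (q + 1) = e by rewrite /t; field; nra.
  move=> h; have : p <= 2 * (t * q) by nra.
  nra.
rewrite -oppr_le0; apply/ler_addgt0Pr => e e0; rewrite add0r.
have t0 : 0 < e / (2 * (q + 1)) by rewrite divr_gt0 //; nra.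
have := key (- (e / (2 * (q + 1)))).
set t := e / _ in t0 *; have te : 2 * t * (q + 1) = e by rewrite /t; field; nra.
move=> h; have : - p <= 2 * (t * q) by nra.
nra.
Qed.

End Projection.

Section Riesz.
Context {R : realType} (W : lmodType R[i]) (ip : W -> W -> R).
Hypothesis ipD : forall a b c, ip (a + b) c = ip a c + ip b c.
Hypothesis ipZ : forall (k : R) a b, ip (k%:C *: a) b = k * ip a b.
Hypothesis ipC : forall a b, ip a b = ip b a.
Hypothesis ip_ge0 : forall a, 0 <= ip a a.
Hypothesis compl : forall u : nat -> W,
  (forall e : R, 0 < e -> exists N, forall n m, (N <= n)%N -> (N <= m)%N ->
     ip (u n - u m) (u n - u m) <= e) ->
  exists l, forall e : R, 0 < e -> exists N, forall n, (N <= n)%N ->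
     ip (u n - l) (u n - l) <= e.

(** The representing vector is normal to the kernel of [f]. Completeness is asked for [ip] itself,
    because [pos_inv] applies this to the form [<x a, b>]. *)
Lemma riesz (f : W -> R) (C : R) : (forall a b, f (a + b) = f a + f b) ->
  (forall k a, f (k%:C *: a) = k * f a) -> (forall a, f a ^+ 2 <= C * ip a a) ->
  exists v, forall w, f w = ip w v.
Proof.
move=> fD fZ fC.
have f0 : f 0 = 0 by rewrite -(scale0r (0 : W)) -[0%R]/(0%:C) fZ mul0r.
have fN a : f (- a) = - f a by apply: (addIr (f a)); rewrite -fD !addNr f0.
have ip0 b : ip 0 b = 0.
  by rewrite -(scale0r (0 : W)) -[0%R]/(0%:C) ipZ mul0r.
have ipN a b : ip (- a) b = - ip a b.
  by apply: (addIr (ip a b)); rewrite -ipD !addNr ip0.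
have [[w fw]|h] := pselect (exists w, f w <> 0); last first.
  exists 0 => w; rewrite ipC ip0; apply: contra_notP h => fw; by exists w.
have [|||v /= fv vP] := @proj_exists R W ip [set x | f x = 0] ipD ipZ ipC ip_ge0 _ _ f0 _ w.
- by move=> a b /= fa fb; rewrite fD fa fb addr0.
- by move=> k a /= fa; rewrite fZ fa mulr0.
- move=> u uV /compl[l lP]; exists l => //=.
  apply/eqP; rewrite -sqrf_eq0 eq_le sqr_ge0 andbT.
  apply/ler_addgt0Pr => e e0; rewrite add0r.
  have C0 : 0 < `|C| + 1 by rewrite ltr_wpDl.
  have [|N hN] := lP (e / (`|C| + 1)); first by rewrite divr_gt0.
  have := fC (u N - l); rewrite fD fN uV add0r sqrrN => /le_trans; apply.
  apply: (@le_trans _ _ ((`|C| + 1) * ip (u N - l) (u N - l))).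
    by apply: ler_wpM2r; rewrite ?ip_ge0 // ler_wpDr // ler_norm.
  by rewrite -ler_pdivlMl // mulrC hN.
pose n := w - v.
have fn : f n = f w by rewrite /n fD fN fv subr0.
have nn : ip n n <> 0.
  by move=> n0; have := fC n; rewrite n0 mulr0 fn => h; apply: fw; nra.
exists ((f n / ip n n)%:C *: n) => x.
have := vP (x - (f x / f n)%:C *: n); rewrite /= fD fN fZ -/n ipC ipD ipN ipZ.
move=> h; rewrite ipC ipZ.
have fn0 : f n != 0 by rewrite fn; apply/eqP.
have -> : ip n x = f x / f n * ip n n.
  by rewrite ipC; apply: subr0_eq; apply: h; rewrite divfK // subrr.
have nn' : ip n n != 0 by apply/eqP.
by field; rewrite fn0 nn'.
Qed.
End Riesz.

Lemma discr (R : realType) (A P Q : R) :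
  (forall t, 0 <= A - 2 * t * P + t ^+ 2 * Q) -> P ^+ 2 <= A * Q.
Proof.
move=> h; have A0 : 0 <= A by have := h 0; nra.
have [Q0|Q0|Q0] := ltgtP Q 0.
- pose t := (A + 1) / - Q + 1.
  have t1 : 1 <= t by rewrite /t lerDr divr_ge0 //; lra.
  have tQ : t * - Q = A + 1 - Q by rewrite /t; field; lra.
  have := h t; have := h (- t); rewrite sqrrN; nra.
- have := h (P / Q); set t := P / Q; have tQ : t * Q = P by rewrite /t divfK // gt_eqF.
  by nra.
- have [P0|/eqP P0] := eqVneq P 0; first by rewrite P0 Q0; nra.
  have := h ((A + 1) / P); set t := _ / _; have tP : t * P = A + 1.
    by rewrite /t divfK //; apply/eqP.
  by nra.
Qed.

Lemma limR_uniq {R : realType} {T} (F : set_system T) {FF : ProperFilter F} (f : T -> R) (l l' : R) :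
  f @ F --> l -> f @ F --> l' -> l = l'.
Proof. by move=> h h'; apply: (cvg_unique _ h h'); exact: Rhausdorff. Qed.

Lemma cvg0_le {R : realType} {T : Type} {F : set_system T} {FF : Filter F} (a b : T -> R) :
  (forall n, 0 <= a n <= b n) -> b @ F --> (0 : R) -> a @ F --> (0 : R).
Proof. by move=> h hb; apply: (squeeze_cvgr _ (cvg_cst 0) hb); near=> n; apply: h.
Unshelve. all: by end_near. Qed.

(** * Real calculus in a complex Hilbert space *)

Section HilbertBasics.
Context {R : realType} {H : hilbert R}.
Implicit Types a b c : H.

(** Estimates are made on real parts: for them the conjugate-linear [S] and [F] are adjoint in the
    ordinary real-linear sense. [dotE] gives the complex product back. *)
Definition rd a b : R := complex.Re '[a, b].

Lemma dotC a b : '[a, b] = ('[b, a])^*.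
Proof. by rewrite (hermC (dotp H) a b) expr0 mul1r. Qed.
Lemma rdDl a b c : rd (a + b) c = rd a c + rd b c.
Proof. by rewrite /rd linearDl raddfD. Qed.
Lemma rdC a b : rd a b = rd b a.
Proof. by rewrite /rd dotC; case: '[_,_]. Qed.
Lemma dotZl (k : R[i]) a b : '[k *: a, b] = k * '[a, b].
Proof. by rewrite linearZl_LR. Qed.
Lemma dotZr (k : R[i]) a b : '[a, k *: b] = k^* * '[a, b].
Proof. by rewrite linearZr_LR. Qed.
Lemma rdZl (k : R) a b : rd (k%:C *: a) b = k * rd a b.
Proof. by rewrite /rd dotZl; case: '[_,_] => x y /=; rewrite mul0r subr0. Qed.
Lemma rdDr a b c : rd c (a + b) = rd c a + rd c b.
Proof. by rewrite rdC rdDl !(rdC c). Qed.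
Lemma rdZr (k : R) a b : rd a (k%:C *: b) = k * rd a b.
Proof. by rewrite rdC rdZl rdC. Qed.
Lemma rd0l b : rd 0 b = 0.
Proof. by rewrite -(scale0r (0 : H)) -[0%R]/(0%:C) rdZl mul0r. Qed.
Lemma rd0r b : rd b 0 = 0. Proof. by rewrite rdC rd0l. Qed.
Lemma rdNl a b : rd (- a) b = - rd a b.
Proof. by apply: (addIr (rd a b)); rewrite -rdDl !addNr rd0l. Qed.
Lemma rdNr a b : rd a (- b) = - rd a b.
Proof. by rewrite rdC rdNl rdC. Qed.
Lemma rdBl a b c : rd (a - b) c = rd a c - rd b c.
Proof. by rewrite rdDl rdNl. Qed.
Lemma rdBr a b c : rd c (a - b) = rd c a - rd c b.
Proof. by rewrite rdDr rdNr. Qed.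
Definition rdE := (rdDl, rdDr, rdNl, rdNr, rdZl, rdZr).

Lemma rdiL a b : rd ('i%C *: a) b = - complex.Im '[a, b].
Proof. by rewrite /rd dotZl; case: '[_,_] => x y /=; rewrite mul0r mul1r sub0r. Qed.
Lemma rdiR a b : rd a ('i%C *: b) = complex.Im '[a, b].
Proof. by rewrite rdC rdiL dotC; case: '[_,_] => x y /=; rewrite opprK. Qed.
Lemma rdi a b : rd ('i%C *: a) ('i%C *: b) = rd a b.
Proof. by rewrite rdiL dotC dotZl (rdC a) /rd; case: '[_,_] => x y /=; rewrite mul0r mul1r add0r opprK. Qed.
Lemma rdiC a b : rd ('i%C *: a) b = - rd a ('i%C *: b).
Proof. by rewrite rdiL rdiR. Qed.
Lemma dotE a b : '[a, b] = (rd a b +i* rd a ('i%C *: b))%C.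
Proof. by rewrite rdiR /rd; case: '[_,_]. Qed.
Lemma dot_eq a b c d : rd a b = rd c d -> rd a ('i%C *: b) = rd c ('i%C *: d) ->
  '[a, b] = '[c, d].
Proof. by rewrite !dotE => -> ->. Qed.

Lemma dot_aa a : '[a, a] = (rd a a)%:C /\ 0 <= rd a a.
Proof.
have h : 0 <= '[a, a] by rewrite dotp_norm exprn_ge0.
move: h; rewrite /rd lecE; case: '[a,a] => x y /= /andP[/eqP -> ->].
by split.
Qed.
Lemma rd_ge0 a : 0 <= rd a a. Proof. exact: (dot_aa a).2. Qed.
Lemma rd_eq0 a : rd a a = 0 -> a = 0.
Proof.
move=> h; have := (dot_aa a).1; rewrite h dotp_norm => /eqP.
by rewrite sqrf_eq0 normr_eq0 => /eqP.
Qed.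
Definition nr a : R := Num.sqrt (rd a a).
Lemma nr_ge0 a : 0 <= nr a. Proof. exact: sqrtr_ge0. Qed.
Lemma nr2 a : nr a ^+ 2 = rd a a. Proof. by rewrite sqr_sqrtr // rd_ge0. Qed.
Lemma norm_nr a : `|a| = (nr a)%:C.
Proof.
apply/eqP; rewrite -(@eqrXn2 _ 2) // ?ler0c ?nr_ge0 //.
by rewrite -dotp_norm (dot_aa a).1 -rmorphXn /= nr2.
Qed.
Lemma nr_eq0 a : nr a = 0 -> a = 0.
Proof. by move=> h; apply: rd_eq0; rewrite -nr2 h expr0n. Qed.
Lemma nr0 : nr (0 : H) = 0. Proof. by rewrite /nr rd0l sqrtr0. Qed.
Lemma nrD a b : nr (a + b) <= nr a + nr b.
Proof. by rewrite -lecR rmorphD /= -!norm_nr ler_normD. Qed.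
Lemma nrN a : nr (- a) = nr a.
Proof. by apply: complexI; rewrite -!norm_nr normrN. Qed.
Lemma nrB a b : nr (a - b) = nr (b - a).
Proof. by rewrite -nrN opprB. Qed.
Lemma nrZ (k : R) a : nr (k%:C *: a) = `|k| * nr a.
Proof. by apply: complexI; rewrite rmorphM /= -!norm_nr normrZ normc_def /= expr0n addr0 sqrtr_sqr. Qed.
Lemma nri a : nr ('i%C *: a) = nr a.
Proof. by rewrite /nr rdi. Qed.
Lemma psd_cs (f : H -> H -> R) : (forall a b c, f (a + b) c = f a c + f b c) ->
  (forall (k : R) a b, f (k%:C *: a) b = k * f a b) -> (forall a b, f a b = f b a) ->
  (forall a, 0 <= f a a) -> forall a b, f a b ^+ 2 <= f a a * f b b.
Proof.
move=> fD fZ fC f0 a b; apply: discr => t.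
have := f0 (a + (- t)%:C *: b); rewrite fD fZ !(fC _ (_ + _)) !fD !fZ (fC b a).
by move=> h; apply: le_trans h _; rewrite le_eqVlt; apply/orP; left; apply/eqP; ring.
Qed.
Lemma rd_cs2 a b : rd a b ^+ 2 <= rd a a * rd b b.
Proof. by apply: psd_cs => *; rewrite ?rdDl ?rdZl ?rd_ge0 // rdC. Qed.
Lemma rd_cs a b : `|rd a b| <= nr a * nr b.
Proof. by rewrite -ler_sqr ?nnegrE ?mulr_ge0 ?nr_ge0 // real_normK ?num_real // exprMn !nr2 rd_cs2. Qed.
Lemma rd_le a b : rd a b <= nr a * nr b.
Proof. exact: le_trans (ler_norm _) (rd_cs a b). Qed.
Lemma nr_le a (k : R) : 0 <= k -> rd a a <= k ^+ 2 -> nr a <= k.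
Proof. by move=> k0 h; rewrite -ler_sqr ?nnegrE ?nr_ge0 // nr2. Qed.
Lemma rd_inj a b : (forall c, rd a c = rd b c) -> a = b.
Proof.
move=> h; apply: subr0_eq; apply: rd_eq0.
by rewrite rdBl h subrr.
Qed.

Lemma hcomplete (u : nat -> H) :
  (forall e : R, 0 < e -> exists N, forall n m, (N <= n)%N -> (N <= m)%N ->
     nr (u n - u m) <= e) ->
  exists l, forall e : R, 0 < e -> exists N, forall n, (N <= n)%N ->
     nr (u n - l) <= e.
Proof.
move=> h.
have posc (e : R[i]) : 0 < e -> exists2 r : R, 0 < r & e = r%:C.
  by case: e => x y; rewrite ltcE /= => /andP[/eqP -> x0]; exists x.
have /cauchy_cvgP hl : cauchy (u @ \oo).
  apply/cauchyP => e /posc[r r0 ->].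
  have [|N hN] := h (r / 2); first lra.
  exists (u N); exists N => // n /= Nn.
  rewrite -ball_normE /= norm_nr ltcR.
  have := hN N n (leqnn N) Nn; lra.
exists (lim (u @ \oo)) => e e0.
have /cvgrPdist_le /(_ (e%:C)) := hl.
rewrite ltcR => /(_ e0)[N _ hN]; exists N => n Nn.
by have := hN n Nn; rewrite /= norm_nr lecR nrB.
Qed.

Definition scvg {T} (F : set_system T) (u : T -> H) l :=
  nr (u n - l) @[n --> F] --> (0 : R).

Section Scvg.
Context {T : Type} {F : set_system T} {FF : Filter F}.
Implicit Types u v : T -> H.

Lemma scvg_cst a : scvg F (fun=> a) a.
Proof. by rewrite /scvg subrr nr0; exact: cvg_cst. Qed.
Lemma scvg_le u a (v : T -> R) : (forall n, nr (u n - a) <= v n) -> v @ F --> (0 : R) -> scvg F u a.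
Proof. by move=> h; apply: cvg0_le => n; rewrite nr_ge0 h. Qed.
Lemma cvg0D (p q : T -> R) : p @ F --> (0 : R) -> q @ F --> (0 : R) ->
  (fun n => p n + q n) @ F --> (0 : R).
Proof. by move=> hp hq; rewrite -[0%R](addr0 (0 : R)); apply: cvgD. Qed.
Lemma cvg0M (p : T -> R) k : p @ F --> (0 : R) -> (fun n => k * p n) @ F --> (0 : R).
Proof. by move=> hp; rewrite -[0%R](mulr0 k); apply: cvgMr. Qed.
Lemma scvgD u v a b : scvg F u a -> scvg F v b -> scvg F (fun n => u n + v n) (a + b).
Proof.
move=> ua vb; apply: (scvg_le _ (cvg0D ua vb)) => n.
by rewrite opprD addrACA nrD.
Qed.
Lemma scvgN u a : scvg F u a -> scvg F (fun n => - u n) (- a).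
Proof. by move=> ua; apply: (scvg_le _ ua) => n; rewrite -opprD nrN. Qed.
Lemma scvgB u v a b : scvg F u a -> scvg F v b -> scvg F (fun n => u n - v n) (a - b).
Proof. by move=> ua vb; apply: scvgD => //; exact: scvgN. Qed.
Lemma scvgi u a : scvg F u a -> scvg F (fun n => 'i%C *: u n) ('i%C *: a).
Proof. by move=> ua; apply: (scvg_le _ ua) => n; rewrite -scalerBr nri. Qed.
Lemma scvgZ (k : R) u a : scvg F u a -> scvg F (fun n => k%:C *: u n) (k%:C *: a).
Proof. by move=> ua; apply: (scvg_le _ (cvg0M `|k| ua)) => n; rewrite -scalerBr nrZ. Qed.
Lemma cvg_le_dist (p q : T -> R) l : (forall n, `|p n - l| <= q n) ->
  q @ F --> (0 : R) -> p @ F --> l.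
Proof.
move=> h hq; apply/subr_cvg0; apply: (squeeze_cvgr _ (_ : - q n @[n --> F] --> (0 : R)) hq).
  by near=> n; rewrite -ler_norml.
by rewrite -oppr0; exact: cvgN.
Unshelve. all: by end_near. Qed.
Lemma rd_cvg u v a b : scvg F u a -> scvg F v b -> rd (u n) (v n) @[n --> F] --> rd a b.
Proof.
move=> ua vb; apply: (@cvg_le_dist _ (fun n => nr (u n - a) * nr (v n - b) +
   (nr b * nr (u n - a) + nr a * nr (v n - b)))).
  move=> n; have -> : rd (u n) (v n) - rd a b = rd (u n - a) (v n - b) + (rd (u n - a) b + rd a (v n - b)).
    by rewrite !rdE; ring.
  apply: le_trans (ler_normD _ _) _; apply: lerD; first exact: rd_cs.
  apply: le_trans (ler_normD _ _) _; apply: lerD; last exact: rd_cs.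
  by rewrite mulrC rd_cs.
apply: cvg0D; last by apply: cvg0D; apply: cvg0M.
by rewrite -[0%R](mulr0 (0 : R)); apply: cvgM.
Qed.
Lemma scvgP u a : scvg F u a <-> forall e : R, 0 < e -> \forall n \near F, nr (u n - a) <= e.
Proof.
split=> [/cvgrPdist_le h e e0|h].
  by apply: filterS (h e e0) => n; rewrite sub0r normrN ger0_norm ?nr_ge0.
apply/cvgrPdist_le => e e0.
by apply: filterS (h e e0) => n; rewrite sub0r normrN ger0_norm ?nr_ge0.
Qed.
End Scvg.

Lemma scvg_uniq {T} {F : set_system T} {FF : ProperFilter F} (u : T -> H) a b :
  scvg F u a -> scvg F u b -> a = b.
Proof.
move=> ua ub; have h := @scvgB _ F _ u u a b ua ub; apply: subr0_eq; apply: nr_eq0.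
have : (fun=> nr (b - a)) @ F --> (0 : R).
  have -> : (fun=> nr (b - a)) = (fun n => nr (u n - u n - (a - b))); last exact: h.
  by apply: funext => n; rewrite subrr sub0r opprB.
by move/(cvg_unique _ (cvg_cst _)) => <- //; rewrite nrB.
Qed.

Lemma scvg_sub {T} (F G : set_system T) (u : T -> H) a : G `<=` F -> scvg G u a -> scvg F u a.
Proof. by move=> GF ua; apply: cvg_trans ua => A /= h; exact: GF. Qed.

Lemma scvg_complete (u : nat -> H) :
  (forall e : R, 0 < e -> exists N, forall n m, (N <= n)%N -> (N <= m)%N ->
     nr (u n - u m) <= e) -> exists l, scvg \oo u l.
Proof.
move=> /hcomplete[l lP]; exists l; apply/scvgP => e /lP[N hN]; exists N => //.
Qed.

(** Metric density of [D] itself, not of its span; for real subspaces [orth_tot] reduces it to a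
    trivial orthogonal complement. *)
Definition tot (D : set H) := forall a (e : R), 0 < e -> exists2 d, D d & nr (a - d) <= e.

Lemma complexr_pos (e : R[i]) : 0 < e -> exists2 r : R, 0 < r & e = r%:C.
Proof. by case: e => x y; rewrite ltcE /= => /andP[/eqP -> x0]; exists x. Qed.

Lemma closure_nr (D : set H) a : closure D a <-> forall e : R, 0 < e -> exists2 d, D d & nr (a - d) <= e.
Proof.
split=> [h e e0|h B].
  have [|d [Dd]] := h (ball a e%:C); first by apply: nbhsx_ballx; rewrite ltcR.
  by rewrite -ball_normE /= norm_nr ltcR => /ltW ?; exists d.
rewrite -nbhs_ballE => -[e /= /complexr_pos[r r0 ->] rB].
have [|d Dd dr] := h (r / 2); first lra.
exists d; split=> //; apply: rB; rewrite -ball_normE /= norm_nr ltcR; lra.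
Qed.

Lemma dense_tot (D : set H) : dense D <-> tot D.
Proof.
split=> [dD a|tD O [a Oa] oO].
  apply/closure_nr => B /nbhs_interior.
  have oB : open B° by exact: open_interior.
  move=> Ba; have [||d [Bd Dd]] := dD B°; [by exists a; exact: nbhs_singleton|exact: oB|].
  by exists d; split=> //; exact: interior_subset.
have : closure D a by apply/closure_nr; exact: tD.
have nO : nbhs a O by exact: open_nbhs_nbhs.
by move=> /(_ _ nO)[d [? ?]]; exists d.
Qed.

Lemma tot_seq (D : set H) a : tot D -> exists2 u : nat -> H, (forall n, D (u n)) & scvg \oo u a.
Proof.
move=> tD; have [eps [e0 eN]] := eps_seq R.
have /choice[u uP] (n : nat) : exists d, D d /\ nr (a - d) <= eps n.
  by have [d ? ?] := tD a _ (e0 n); exists d.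
exists u; first by move=> n; case: (uP n).
apply/scvgP => e /eN[N hN]; exists N => // n /= Nn.
by rewrite nrB; apply: le_trans (uP n).2 (hN _ Nn).
Qed.

Lemma complete_rd (u : nat -> H) :
  (forall e : R, 0 < e -> exists N, forall n m, (N <= n)%N -> (N <= m)%N ->
     rd (u n - u m) (u n - u m) <= e) ->
  exists2 l, scvg \oo u l &
    forall e : R, 0 < e -> exists N, forall n, (N <= n)%N -> rd (u n - l) (u n - l) <= e.
Proof.
move=> hu; have [|l ul] := @scvg_complete u.
  move=> e e0; have [|N hN] := hu (e ^+ 2); first by rewrite exprn_gt0.
  by exists N => n m Nn Nm; apply: nr_le; [exact: ltW|exact: hN].
exists l => // e e0; have s0 : 0 < Num.sqrt e by rewrite sqrtr_gt0.
have /scvgP/(_ _ s0)[N _ hN] := ul; exists N => n Nn.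
by rewrite -nr2 -(sqr_sqrtr (ltW e0)) lerXn2r ?nnegrE ?nr_ge0 ?sqrtr_ge0 //; exact: hN.
Qed.

Lemma riesz_rd (f : H -> R) (C : R) :
  (forall a b, f (a + b) = f a + f b) -> (forall k a, f (k%:C *: a) = k * f a) ->
  (forall a, f a ^+ 2 <= C * rd a a) -> exists v, forall w, f w = rd w v.
Proof.
apply: (@riesz R H rd rdDl rdZl rdC rd_ge0) => u /complete_rd[l _ hl].
by exists l.
Qed.

Lemma closure_lim (V : set H) (u : nat -> H) w :
  (forall n, closure V (u n)) -> scvg \oo u w -> closure V w.
Proof.
move=> Vu uw; apply/closure_nr => e e0; have e2 : 0 < e / 2 by lra.
have /scvgP/(_ _ e2)[N _ hN] := uw; have /closure_nr/(_ _ e2)[p Vp h1] := Vu N.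
exists p => //; rewrite (_ : w - p = (u N - p) - (u N - w)); last first.
  by rewrite opprB [RHS]addrC addrA subrK.
by apply: le_trans (nrD _ _) _; rewrite nrN; have := hN N (leqnn N) => /= ?; lra.
Qed.

Lemma proj_closure (V : set H) : V 0 -> (forall a b, V a -> V b -> V (a + b)) ->
  (forall (k : R) a, V a -> V (k%:C *: a)) ->
  forall w, exists2 p, closure V p & forall v, V v -> rd (w - p) v = 0.
Proof.
move=> V0 VD VZ w.
have [||||v cVv vP] := @proj_exists R H rd (closure V) rdDl rdZl rdC rd_ge0 _ _ _ _ w.
- move=> a b /closure_nr ca /closure_nr cb; apply/closure_nr => e e0.
  have [|d Vd hd] := ca (e / 2); first lra.
  have [|d' Vd' hd'] := cb (e / 2); first lra.
  exists (d + d'); first exact: VD.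
  rewrite opprD addrACA; apply: le_trans (nrD _ _) _; lra.
- move=> k a /closure_nr ca; apply/closure_nr => e e0; have k0 : 0 < `|k| + 1 by rewrite ltr_wpDl.
  have [|d Vd hd] := ca (e / (`|k| + 1)); first by rewrite divr_gt0.
  exists (k%:C *: d); first exact: VZ.
  rewrite -scalerBr nrZ; apply: (@le_trans _ _ ((`|k| + 1) * nr (a - d))).
    by rewrite ler_wpM2r ?nr_ge0 // lerDl.
  by rewrite mulrC -ler_pdivlMr.
- exact: subset_closure.
- by move=> u cu /complete_rd[l ul hl]; exists l => //; exact: closure_lim ul.
by exists v => // x Vx; apply: vP; exact: subset_closure.
Qed.

Lemma orth_tot (V : set H) : V 0 -> (forall a b, V a -> V b -> V (a + b)) ->
  (forall (k : R) a, V a -> V (k%:C *: a)) ->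
  (forall w, (forall v, V v -> rd w v = 0) -> w = 0) -> tot V.
Proof.
move=> V0 VD VZ Vo w; apply/closure_nr; have [v cv vP] := proj_closure V0 VD VZ w.
by rewrite (subr0_eq (Vo _ vP)).
Qed.

End HilbertBasics.

Ltac hring := apply: rd_inj => ?; rewrite !rdE; ring.

(** * Bounded operators, adjoints and positivity *)

Section Operators.
Context {R : realType} {H : hilbert R}.
Implicit Types (x y z : H -> H) (a b c : H).

Definition bnd (C : R) x := forall a, nr (x a) <= C * nr a.
Definition bo x := linear x /\ exists2 C, 0 <= C & bnd C x.

Lemma opDE x y a : (x + y) a = x a + y a. Proof. by []. Qed.
Lemma opNE x a : (- x) a = - x a. Proof. by []. Qed.
Lemma opZE (k : R[i]) x a : (k *: x) a = k *: x a. Proof. by []. Qed.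
Definition opE := (opDE, opNE, opZE).

Lemma linD x : linear x -> forall a b, x (a + b) = x a + x b.
Proof. by move=> h a b; have := h 1 a b; rewrite !scale1r. Qed.
Lemma lin0 x : linear x -> x 0 = 0.
Proof. by move=> h; apply: (addIr (x 0)); rewrite -linD // !add0r. Qed.
Lemma linZ x : linear x -> forall k a, x (k *: a) = k *: x a.
Proof. by move=> h k a; have := h k a 0; rewrite !addr0 lin0 // addr0. Qed.
Lemma linN x : linear x -> forall a, x (- a) = - x a.
Proof. by move=> h a; rewrite -scaleN1r linZ // scaleN1r. Qed.
Lemma linB x : linear x -> forall a b, x (a - b) = x a - x b.
Proof. by move=> h a b; rewrite linD // linN. Qed.

Lemma bo_lin x : bo x -> linear x. Proof. by case. Qed.
Lemma boD x : bo x -> forall a b, x (a + b) = x a + x b. Proof. by case=> /linD. Qed.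
Lemma bo0 x : bo x -> x 0 = 0. Proof. by case=> /lin0. Qed.
Lemma boZ x : bo x -> forall k a, x (k *: a) = k *: x a. Proof. by case=> /linZ. Qed.
Lemma boN x : bo x -> forall a, x (- a) = - x a. Proof. by case=> /linN. Qed.
Lemma boB x : bo x -> forall a b, x (a - b) = x a - x b. Proof. by case=> /linB. Qed.
Lemma bo_bnd x : bo x -> exists2 C, 0 <= C & bnd C x. Proof. by case. Qed.

Lemma bo_scvg {T} {F : set_system T} {FF : Filter F} x (u : T -> H) a :
  bo x -> scvg F u a -> scvg F (x \o u) (x a).
Proof.
move=> hx ua; have [C C0 hC] := bo_bnd hx.
by apply: (scvg_le _ (cvg0M C ua)) => n /=; rewrite -boB.
Qed.

Lemma boP x : bounded_op x <-> bo x.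
Proof.
split=> [[lx cx]|hx].
  pose f : {linear H -> H} := HB.pack x (GRing.isLinear.Build _ _ _ _ x lx).
  have /linear_boundedP : bounded_near f (nbhs (0 : H)) by apply/linear_bounded_continuous.
  move=> /pinfty_ex_gt0[r /complexr_pos[s s0 ->] hs].
  split=> //; exists s; first exact: ltW.
  by move=> a; have := hs a; rewrite /= !norm_nr -rmorphM /= lecR.
split; first exact: bo_lin.
have [C C0 hC] := bo_bnd hx.
pose f : {linear H -> H} := HB.pack x (GRing.isLinear.Build _ _ _ _ x (bo_lin hx)).
suff : continuous f by [].
apply/linear_bounded_continuous/linear_boundedP; near=> r => a.
apply: (@le_trans _ _ (C%:C * `|a|)).
  by rewrite !norm_nr -rmorphM /= lecR; exact: hC.
apply: ler_wpM2r => //; near: r; apply: nbhs_pinfty_ge.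
by apply/complex_realP; exists C.
Unshelve. all: by end_near. Qed.

Lemma bo_mk C x : linear x -> 0 <= C -> bnd C x -> bo x.
Proof. by move=> ? ? ?; split=> //; exists C. Qed.

Lemma bo_id : bo idfun.
Proof. by split=> //; exists 1 => // a; rewrite mul1r. Qed.
Lemma bo_zero : bo 0.
Proof. by split=> [k a b|]; [rewrite /= scaler0 addr0|exists 0 => // a; rewrite nr0 mul0r]. Qed.
Lemma bo_comp x y : bo x -> bo y -> bo (x \o y).
Proof.
move=> hx hy; have [C C0 hC] := bo_bnd hx; have [D D0 hD] := bo_bnd hy.
split; first by move=> k a b /=; rewrite boD // boZ // boD // boZ.
exists (C * D); first exact: mulr_ge0.
by move=> a /=; apply: le_trans (hC _) _; rewrite -mulrA ler_wpM2l.
Qed.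
Lemma bo_add x y : bo x -> bo y -> bo (x + y).
Proof.
move=> hx hy; have [C C0 hC] := bo_bnd hx; have [D D0 hD] := bo_bnd hy.
split.
  by move=> k a b; rewrite !opE (boD hx) (boZ hx) (boD hy) (boZ hy) scalerDr addrACA.
exists (C + D); first exact: addr_ge0.
by move=> a /=; rewrite mulrDl; apply: le_trans (nrD _ _) _; rewrite lerD.
Qed.
Lemma nrZc (k : R[i]) a : nr (k *: a) = complex.Re `|k| * nr a.
Proof. apply: complexI; rewrite -norm_nr normrZ norm_nr rmorphM normc_def.
by case: k. Qed.
Lemma bo_scale (k : R[i]) x : bo x -> bo (k *: x).
Proof.
move=> hx; have [C C0 hC] := bo_bnd hx; split.
  by move=> l a b; rewrite !opE (boD hx) (boZ hx) scalerDr !scalerA mulrC.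
have k0 : 0 <= complex.Re `|k| by rewrite normc_def /= sqrtr_ge0.
exists (complex.Re `|k| * C); first exact: mulr_ge0.
by move=> a; rewrite -mulrA opE nrZc ler_wpM2l.
Qed.
Lemma bo_opp x : bo x -> bo (- x).
Proof. by move=> hx; rewrite -scaleN1r; exact: bo_scale. Qed.
Lemma bo_sub x y : bo x -> bo y -> bo (x - y).
Proof. by move=> hx hy; apply: bo_add => //; exact: bo_opp. Qed.

Lemma bo_eq_tot (D : set H) x y : tot D -> bo x -> bo y -> (forall d, D d -> x d = y d) -> x = y.
Proof.
move=> tD hx hy xy; apply: funext => a.
have [u uD ua] := tot_seq a tD.
apply: (scvg_uniq (bo_scvg hx ua)).
have -> : x \o u = y \o u by apply: funext => n /=; exact: xy.
exact: bo_scvg.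
Qed.

Lemma bnd_tot (D : set H) x C : tot D -> bo x -> 0 <= C -> (forall d, D d -> nr (x d) <= C * nr d) -> bnd C x.
Proof.
move=> tD hx C0 h a; have [B B0 hB] := bo_bnd hx.
apply/ler_addgt0Pr => e e0.
have BC0 : 0 < B + C + 1 by rewrite ltr_wpDl // addr_ge0.
have [|d Dd hd] := tD a (e / (B + C + 1)); first by rewrite divr_gt0.
have h1 : nr (x a) <= B * nr (a - d) + C * nr d.
  rewrite -{1}(subrK d a) boD //; apply: le_trans (nrD _ _) _.
  by apply: lerD; [exact: hB | exact: h].
have h2 : nr d <= nr (a - d) + nr a.
  by rewrite -{1}(subKr a d) addrC; apply: le_trans (nrD _ _) _; rewrite nrN.
have : (B + C + 1) * nr (a - d) <= e by rewrite mulrC -ler_pdivlMr.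
have := nr_ge0 (a - d); nra.
Qed.

Lemma scvg_tot {T} {F : set_system T} {FF : Filter F} (D : set H) (x : T -> H -> H) y C :
  tot D -> 0 <= C -> (forall n, linear (x n)) -> (forall n, bnd C (x n)) -> bo y ->
  (forall d, D d -> scvg F (fun n => x n d) (y d)) -> forall a, scvg F (fun n => x n a) (y a).
Proof.
move=> tD C0 lx hx hy h a; have [B B0 hB] := bo_bnd hy.
apply/scvgP => e e0; have BC0 : 0 < B + C + 1 by rewrite ltr_wpDl // addr_ge0.
have [|d Dd hd] := tD a (e / 2 / (B + C + 1)); first by rewrite !divr_gt0.
have /scvgP/(_ (e / 2)) := h d Dd; rewrite divr_gt0 // => /(_ isT).
apply: filterS => n hn.
have -> : x n a - y a = x n (a - d) + (x n d - y d) - y (a - d).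
  by rewrite (linB (lx n)) (boB hy); hring.
have : (B + C + 1) * nr (a - d) <= e / 2 by rewrite mulrC -ler_pdivlMr.
have := nrD (x n (a - d) + (x n d - y d)) (- y (a - d)).
have := nrD (x n (a - d)) (x n d - y d).
have := hx n (a - d); have := hB (a - d); rewrite nrN; have := nr_ge0 (a - d).
nra.
Qed.

(** Riesz for the real product gives a real-linear [y]; it commutes with [i] because [x] does. *)
Lemma adj_exists x : bo x -> exists2 y, bo y & forall a b, '[x a, b] = '[a, y b].
Proof.
move=> hx; have [C C0 hC] := bo_bnd hx.
have ex b : exists v, forall a, rd (x a) b = rd a v.
  apply: (@riesz_rd _ _ (fun a => rd (x a) b) (C ^+ 2 * rd b b)).
  - by move=> a c; rewrite boD // rdDl.
  - by move=> k a; rewrite boZ // rdZl.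
  - move=> a; apply: le_trans (rd_cs2 _ _) _; rewrite -!nr2 (mulrAC (C ^+ 2)).
    by rewrite ler_wpM2r ?sqr_ge0 // -exprMn lerXn2r ?nnegrE ?mulr_ge0 ?nr_ge0.
have /choice[y yP] := ex.
have yi b : y ('i%C *: b) = 'i%C *: y b.
  by apply: rd_inj => a; rewrite rdC -yP [RHS]rdC -[LHS]opprK -rdiC -(boZ hx) yP rdiC opprK.
have yD b c : y (b + c) = y b + y c.
  by apply: rd_inj => a; rewrite rdC -yP rdDr rdDl !yP !(rdC a).
have yZ (k : R) b : y (k%:C *: b) = k%:C *: y b.
  by apply: rd_inj => a; rewrite rdC -yP rdZl rdZr yP (rdC a).
have ly : linear y.
  move=> k b c; rewrite yD; congr (_ + _).
  by rewrite (complexE k) !scalerDl yD yZ -!scalerA yi yZ.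
exists y; last first.
  by move=> a b; apply: dot_eq; rewrite ?yP ?yi.
apply: (bo_mk ly C0) => b.
have h : nr (y b) ^+ 2 <= C * nr b * nr (y b).
  by rewrite nr2 -yP; apply: le_trans (rd_le _ _) _; rewrite mulrAC ler_wpM2r ?nr_ge0.
have [->|y0] := eqVneq (nr (y b)) 0; first by rewrite mulr_ge0 ?nr_ge0.
by rewrite -(ler_pM2r (_ : 0 < nr (y b))) ?lt0r ?y0 ?nr_ge0.
Qed.

Lemma adjP x : bo x -> bo (adj x) /\ forall a b, '[x a, b] = '[a, adj x b].
Proof.
move=> hx; have [y hy yP] := adj_exists hx; rewrite /adj.
case: xgetP => [z _ [/boP ? ?] //|/(_ y)].
by move=> h; exfalso; apply: h; split=> //; apply/boP.
Qed.
Lemma bo_adj x : bo x -> bo (adj x). Proof. by case/adjP. Qed.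
Lemma rd_adj x : bo x -> forall a b, rd (x a) b = rd a (adj x b).
Proof. by move=> /adjP[_ h] a b; rewrite /rd h. Qed.
Lemma rd_adjr x : bo x -> forall a b, rd a (x b) = rd (adj x a) b.
Proof. by move=> hx a b; rewrite rdC rd_adj // rdC. Qed.
Lemma adj_uniq x y : bo x -> (forall a b, rd (x a) b = rd a (y b)) -> adj x = y.
Proof.
move=> hx h; apply: funext => b; apply: rd_inj => a.
by rewrite rdC -rd_adj // h rdC.
Qed.
Lemma adjK x : bo x -> adj (adj x) = x.
Proof. by move=> hx; apply: adj_uniq; [exact: bo_adj|move=> a b; rewrite rdC -rd_adj // rdC]. Qed.
Lemma adjM x y : bo x -> bo y -> adj (x \o y) = adj y \o adj x.
Proof. by move=> hx hy; apply: adj_uniq => [|a b /=]; [exact: bo_comp|rewrite !rd_adj]. Qed.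
Lemma adjD x y : bo x -> bo y -> adj (x + y) = adj x + adj y.
Proof. by move=> hx hy; apply: adj_uniq => [|a b /=]; [exact: bo_add|rewrite !opE rdDl rdDr !rd_adj]. Qed.
Lemma adjZ (k : R) x : bo x -> adj (k%:C *: x) = k%:C *: adj x.
Proof. by move=> hx; apply: adj_uniq => [|a b /=]; [exact: bo_scale|rewrite !opE rdZl rdZr !rd_adj]. Qed.
Lemma adji x : bo x -> adj ('i%C *: x) = - 'i%C *: adj x.
Proof.
move=> hx; apply: adj_uniq => [|a b /=]; first exact: bo_scale.
by rewrite !opE scaleNr rdNr rdiC (rd_adj hx) (boZ (bo_adj hx)).
Qed.
Lemma bnd_adj C x : bo x -> 0 <= C -> bnd C x -> bnd C (adj x).
Proof.
move=> hx C0 hC b.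
have h : nr (adj x b) ^+ 2 <= C * nr b * nr (adj x b).
  by rewrite nr2 -rd_adj //; apply: le_trans (rd_le _ _) _; rewrite mulrAC ler_wpM2r ?nr_ge0.
have [->|y0] := eqVneq (nr (adj x b)) 0; first by rewrite mulr_ge0 ?nr_ge0.
by rewrite -(ler_pM2r (_ : 0 < nr (adj x b))) ?lt0r ?y0 ?nr_ge0.
Qed.

Definition sa x := forall a b, rd (x a) b = rd a (x b).
Definition pos x := forall a, 0 <= rd (x a) a.

Lemma sa_adj x : bo x -> sa x -> adj x = x. Proof. by move=> hx hs; exact: adj_uniq. Qed.
Lemma adj_sa x : bo x -> adj x = x -> sa x. Proof. by move=> hx h a b; rewrite rd_adj // h. Qed.

(** A form with vanishing imaginary part is symmetric: insert [a + b], then replace [b] by [i b]. *)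
Lemma op_posP x : linear x -> op_pos x <-> sa x /\ pos x.
Proof.
move=> lx; split=> [h|[hs hp] a]; last first.
  rewrite dotE lecE /= hp andbT; apply/eqP.
  have := hs a ('i%C *: a); rewrite (linZ lx) (rdC a) rdiC (rdC (x a)); lra.
have him a : rd (x a) ('i%C *: a) = 0.
  by have := h a; rewrite dotE lecE /= => /andP[/eqP].
split; last by move=> a; have := h a; rewrite dotE lecE /= => /andP[_].
have hs a b : rd (x a) ('i%C *: b) = - rd (x b) ('i%C *: a).
  have := him (a + b); rewrite (linD lx) scalerDr !rdDl !rdDr !him; lra.
move=> a b; have := hs a ('i%C *: b); rewrite (linZ lx) rdi scalerA.
rewrite -expr2 sqr_i scaleN1r rdNr (rdC a); lra.
Qed.

Lemma pos_cs x : bo x -> sa x -> pos x -> forall a b, rd (x a) b ^+ 2 <= rd (x a) a * rd (x b) b.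
Proof.
move=> hx sx px; apply: (@psd_cs R H (fun a b => rd (x a) b)) => //.
- by move=> a b c; rewrite (boD hx) rdDl.
- by move=> k a b; rewrite (boZ hx) rdZl.
- by move=> a b; rewrite sx rdC.
Qed.

(** Cauchy-Schwarz for the form of [x] at the vectors [a] and [x a]. *)
Lemma pos_le x C : bo x -> sa x -> pos x -> (forall a, rd (x a) a <= C * rd a a) ->
  forall a, rd (x a) (x a) <= C * rd (x a) a.
Proof.
move=> hx sx px hC a; have h1 := pos_cs hx sx px a (x a); have h2 := hC (x a).
have := px a; have := rd_ge0 (x a); set p := rd (x a) (x a) in h1 h2 *.
have [->|p0] := eqVneq p 0.
  move=> _ h3; have := hC a; have := rd_ge0 a.
  have [C0|C0] := lerP 0 C; first by move=> *; exact: mulr_ge0.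
  nra.
rewrite le0r (negPf p0) /= => pp h3; nra.
Qed.

Lemma pos_eq0 x : bo x -> sa x -> pos x -> (forall a, rd (x a) a = 0) -> x = 0.
Proof.
move=> hx sx px h; apply: funext => a; apply: rd_eq0.
have := pos_cs hx sx px a (x a); rewrite h mul0r; have := rd_ge0 (x a); nra.
Qed.

End Operators.

(** * Strong limits, monotone sequences, and the cut-off [x (1 + x)^-1] *)

Section Limits.
Context {R : realType} {H : hilbert R}.
Implicit Types (x y z : H -> H) (a b c : H).

Lemma scvg_nr_le {T} {F : set_system T} {FF : ProperFilter F} (u : T -> H) a (k : R) :
  (\forall n \near F, nr (u n) <= k) -> scvg F u a -> nr a <= k.
Proof.
move=> uk /scvgP ua; apply/ler_addgt0Pr => e e0.
have [n [h1 h2]] := filter_ex (filterI uk (ua e e0)).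
rewrite -(subKr (u n) a); apply: le_trans (nrD _ _) _; rewrite nrN.
exact: lerD.
Qed.

Lemma bo_lim {T} {F : set_system T} {FF : ProperFilter F} (x : T -> H -> H) (C : R) : 0 <= C ->
  (forall n, linear (x n)) -> (forall n, bnd C (x n)) ->
  (forall a, exists l, scvg F (fun n => x n a) l) ->
  exists y, [/\ bo y, bnd C y & forall a, scvg F (fun n => x n a) (y a)].
Proof.
move=> C0 lx bx /choice[y yP].
have by_ : bnd C y.
  by move=> a; apply: (scvg_nr_le _ (yP a)); near=> n; exact: bx.
have yD a b : y (a + b) = y a + y b.
  apply: (scvg_uniq (yP (a + b))).
  have -> : (fun n => x n (a + b)) = (fun n => x n a + x n b).
    by apply: funext => n; rewrite (linD (lx n)).
  exact: scvgD.
have yZ (k : R) a : y (k%:C *: a) = k%:C *: y a.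
  apply: (scvg_uniq (yP _)).
  have -> : (fun n => x n (k%:C *: a)) = (fun n => k%:C *: x n a).
    by apply: funext => n; rewrite (linZ (lx n)).
  exact: scvgZ.
have yi a : y ('i%C *: a) = 'i%C *: y a.
  apply: (scvg_uniq (yP _)).
  have -> : (fun n => x n ('i%C *: a)) = (fun n => 'i%C *: x n a).
    by apply: funext => n; rewrite (linZ (lx n)).
  exact: scvgi.
exists y; split=> //; apply: (bo_mk _ C0 by_) => k a b.
by rewrite yD (complexE k) !scalerDl yD yZ -!scalerA yi yZ.
Unshelve. all: by end_near. Qed.

Lemma scvg_bnd {T} {F : set_system T} {FF : Filter F} (x : T -> H -> H) y (u : T -> H) a (C : R) : 0 <= C ->
  (forall n, linear (x n)) -> (forall n, bnd C (x n)) ->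
  scvg F (fun n => x n a) (y a) -> scvg F u a -> scvg F (fun n => x n (u n)) (y a).
Proof.
move=> C0 lx bx xa ua; apply: (scvg_le _ (cvg0D (cvg0M C ua) xa)) => n.
have -> : x n (u n) - y a = x n (u n - a) + (x n a - y a) by rewrite (linB (lx n)); hring.
by apply: le_trans (nrD _ _) _; apply: lerD => //; exact: bx.
Qed.

Lemma cvg_ub {T} {F : set_system T} {FF : ProperFilter F} (f : T -> R) l k :
  (forall n, f n <= k) -> f @ F --> l -> l <= k.
Proof.
move=> fk fl; rewrite -(cvg_lim _ fl) //; apply: limr_le; first by apply/cvg_ex; exists l.
by near=> n; exact: fk.
Unshelve. all: by end_near. Qed.
Lemma cvg_lb {T} {F : set_system T} {FF : ProperFilter F} (f : T -> R) l k :
  (forall n, k <= f n) -> f @ F --> l -> k <= l.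
Proof.
move=> fk fl; rewrite -lerN2; apply: (@cvg_ub T F _ (fun n => - f n)); last exact: cvgN.
by move=> n; rewrite lerN2.
Qed.

Definition ole x y := forall a, rd (x a) a <= rd (y a) a.
Lemma ole_trans x y z : ole x y -> ole y z -> ole x z.
Proof. by move=> h1 h2 a; apply: le_trans (h1 a) (h2 a). Qed.
Lemma ole_refl x : ole x x. Proof. by move=> a. Qed.

Lemma saD x y : sa x -> sa y -> sa (x + y).
Proof. by move=> sx sy a b; rewrite !opE rdDl rdDr sx sy. Qed.
Lemma saN x : sa x -> sa (- x).
Proof. by move=> sx a b; rewrite !opE rdNl rdNr sx. Qed.
Lemma saB x y : sa x -> sa y -> sa (x - y).
Proof. by move=> sx sy; apply: saD => //; exact: saN. Qed.
Lemma saZ (k : R) x : sa x -> sa (k%:C *: x).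
Proof. by move=> sx a b; rewrite !opE rdZl rdZr sx. Qed.
Lemma sa_id : sa (idfun : H -> H). Proof. by []. Qed.
Lemma sa0 : sa (0 : H -> H). Proof. by move=> a b; rewrite rd0l rd0r. Qed.

Lemma op_leP x y : bo x -> bo y -> sa x -> sa y -> op_le x y <-> ole x y.
Proof.
move=> hx hy sx sy; rewrite /op_le op_posP; last by apply: bo_lin; exact: bo_sub.
split=> [[_ h] a|h].
  by have := h a; rewrite opE rdDl rdNl subr_ge0.
by split; [exact: saB|move=> a; rewrite opE rdDl rdNl subr_ge0].
Qed.

Lemma posB x y : pos (y - x) <-> ole x y.
Proof. by split=> h a; have := h a; rewrite opE rdDl rdNl subr_ge0. Qed.

Lemma ole_bnd x C : bo x -> sa x -> pos x -> 0 <= C -> (forall a, rd (x a) a <= C * rd a a) -> bnd C x.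
Proof.
move=> hx sx px C0 h a; apply: nr_le; first by rewrite mulr_ge0 ?nr_ge0.
apply: le_trans (pos_le hx sx px h a) _; rewrite exprMn nr2 expr2 -mulrA.
exact: ler_wpM2l.
Qed.

(** Vigier's theorem for sequences. By [pos_le] the square norm of [(x m - x n) a] is at most [C]
    times the increment of the form at [a], and the forms converge because they are monotone and
    bounded. *)
Lemma mono_lim (x : nat -> H -> H) (C : R) : 0 <= C ->
  (forall n, [/\ bo (x n), sa (x n) & pos (x n)]) ->
  (forall n, ole (x n) (x n.+1)) -> (forall n a, rd (x n a) a <= C * rd a a) ->
  exists y, [/\ bo y, sa y, pos y, forall a, scvg \oo (fun n => x n a) (y a) &
    forall n, ole (x n) y].
Proof.
move=> C0 hx mx bx.
have mono n m : (n <= m)%N -> ole (x n) (x m).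
  move=> nm; rewrite -(subnK nm); elim: (m - n)%N => [|k IH]; first exact: ole_refl.
  by rewrite addSn; apply: ole_trans IH (mx _).
have [a|y [hy by_ yP]] := @bo_lim nat \oo _ x C C0 (fun n => bo_lin (let: And3 h _ _ := hx n in h))
    (fun n => let: And3 h1 h2 h3 := hx n in ole_bnd h1 h2 h3 C0 (bx n)).
  have /cvg_ex[L hL] : cvgn (fun n => rd (x n a) a).
    apply: nondecreasing_is_cvgn; first by move=> n m nm; exact: mono.
    by exists (C * rd a a) => _ [n _ <-]; exact: bx.
  apply: scvg_complete => e e0.
  have C1 : 0 < C + 1 by rewrite ltr_wpDl.
  have /cvgrPdist_le/(_ (e ^+ 2 / (2 * (C + 1)))) := hL.
  rewrite divr_gt0 ?exprn_gt0 // ?mulr_gt0 // => /(_ isT)[N _ hN]; exists N => n m.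
  wlog nm : n m / (n <= m)%N => [hw|Nn Nm].
    by case/orP: (leq_total n m) => h Nn Nm; [|rewrite nrB]; exact: hw.
  rewrite nrB; apply: nr_le; first exact: ltW.
  have [hn sn pn] := hx n; have [hm sm pm] := hx m.
  have hd : bo (x m - x n) by exact: bo_sub.
  have sd : sa (x m - x n) by exact: saB.
  have pd : pos (x m - x n) by apply/posB; exact: mono.
  have := @pos_le R H (x m - x n) C hd sd pd _ a; rewrite !opE => h.
  apply: (le_trans (h _)).
    by move=> b; rewrite !opE rdDl rdNl; have := pn b; have := bx m b; lra.
  have := hN n Nn; have := hN m Nm; rewrite /= !ler_norml rdDl rdNl => /andP[h1 h2] /andP[h3 h4].
  set q := e ^+ 2 / _ in h1 h2 h3 h4; have : 2 * (C + 1) * q = e ^+ 2 by rewrite /q mulrC divfK // gt_eqF // mulr_gt0.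
  nra.
have lim_rd a : rd (x n a) a @[n --> \oo] --> rd (y a) a.
  by apply: rd_cvg; [exact: yP|exact: scvg_cst].
have le_y n : ole (x n) y.
  move=> a; have /cvgP/nondecreasing_cvgn_le := lim_rd a.
  by rewrite (cvg_lim _ (lim_rd a)) //; apply=> k m km; exact: mono.
exists y; split=> //.
  move=> a b; have h1 : rd (x n a) b @[n --> \oo] --> rd (y a) b by apply: rd_cvg; [exact: yP|exact: scvg_cst].
  have h2 : rd a (x n b) @[n --> \oo] --> rd a (y b) by apply: rd_cvg; [exact: scvg_cst|exact: yP].
  apply: (cvg_unique _ h1) => //.
  by have -> : (fun n => rd (x n a) b) = (fun n => rd a (x n b)); [apply: funext => n; have [_ -> _] := hx n|].
by move=> a; apply: le_trans (le_y 0%N a); have [_ _ ->] := hx 0%N.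
Qed.

(** The Lax-Milgram argument: [x v = b] is solved by Riesz in the form [<x a, b>], which is complete
    since it is equivalent to the inner product. *)
Lemma pos_inv x (d : R) : bo x -> sa x -> 0 < d -> (forall a, d * rd a a <= rd (x a) a) ->
  exists y, [/\ bo y, sa y, forall a, x (y a) = a & forall a, y (x a) = a].
Proof.
move=> hx sx d0 hd; have [C C0 hC] := bo_bnd hx.
have ge a : 0 <= rd (x a) a by apply: le_trans (hd a); rewrite mulr_ge0 ?rd_ge0 // ltW.
have le a : rd (x a) a <= C * rd a a.
  by apply: le_trans (rd_le _ _) _; rewrite -nr2 expr2 mulrA ler_wpM2r ?nr_ge0.
have /choice[y yP] b : exists v, x v = b.
  have cmpl (u : nat -> H) :
    (forall e : R, 0 < e -> exists N, forall n m, (N <= n)%N -> (N <= m)%N ->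
       rd (x (u n - u m)) (u n - u m) <= e) ->
    exists l, forall e : R, 0 < e -> exists N, forall n, (N <= n)%N ->
       rd (x (u n - l)) (u n - l) <= e.
    move=> hu; have [e e0|l lP] := @hcomplete R H u.
      have [|N hN] := hu (d * e ^+ 2); first by rewrite mulr_gt0 ?exprn_gt0.
      exists N => n m Nn Nm; apply: nr_le; first exact: ltW.
      by rewrite -(ler_pM2l d0); apply: le_trans (hd _) (hN _ _ Nn Nm).
    exists l => e e0; have s0 : 0 < Num.sqrt (e / (C + 1)) by rewrite sqrtr_gt0 divr_gt0 // ltr_wpDl.
    have [N hN] := lP _ s0; exists N => n /hN h.
    apply: le_trans (le _) _; apply: (@le_trans _ _ ((C + 1) * rd (u n - l) (u n - l))).
      by rewrite ler_wpM2r ?rd_ge0 // lerDl.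
    rewrite mulrC -ler_pdivlMr ?ltr_wpDl // -nr2.
    have eC : 0 <= e / (C + 1) by rewrite divr_ge0 ?ltW // ltr_wpDl.
    by rewrite -(sqr_sqrtr eC) lerXn2r ?nnegrE ?nr_ge0 ?sqrtr_ge0.
  have [||||||v vP] := @riesz R H (fun a c => rd (x a) c) _ _ _ ge cmpl (fun w => rd w b) (rd b b / d).
  - by move=> p q r; rewrite (boD hx) rdDl.
  - by move=> k p q; rewrite (boZ hx) rdZl.
  - by move=> p q; rewrite sx rdC.
  - by move=> p q; exact: rdDl.
  - by move=> p q; exact: rdZl.
  - move=> p; apply: le_trans (rd_cs2 _ _) _.
    rewrite mulrC -mulrA ler_wpM2l ?rd_ge0 // mulrC ler_pdivlMr // mulrC; exact: hd.
  by exists v; apply: rd_inj => w; rewrite rdC -sx -vP rdC.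
have inj a b : x a = x b -> a = b.
  move=> ab; apply: subr0_eq; apply: rd_eq0.
  have := hd (a - b); rewrite (boB hx) ab subrr rd0l.
  have := rd_ge0 (a - b); nra.
have yx a : y (x a) = a by apply: inj; rewrite yP.
have ly : linear y by move=> k a b; apply: inj; rewrite yP (boD hx) (boZ hx) !yP.
exists y; split=> //; last by move=> a b; rewrite -{1}(yP b) -sx yP.
apply: (bo_mk ly (_ : 0 <= d^-1)); first by rewrite invr_ge0 ltW.
move=> a; rewrite mulrC ler_pdivlMr // mulrC.
have := hd (y a); rewrite yP => h; have := le_trans h (rd_le _ _).
rewrite -nr2; have [->|y0] := eqVneq (nr (y a)) 0; first by move=> _; rewrite mulr0 nr_ge0.
have y1 : 0 < nr (y a) by rewrite lt0r y0 nr_ge0.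
by rewrite expr2 mulrA ler_pM2r.
Qed.

(* [res x = (1 + x)^-1] for a positive [x], junk otherwise *)
Definition res x : H -> H := xget (0 : H -> H) [set y : H -> H | [/\ bo y, sa y,
  forall a, y a + x (y a) = a & forall a, y (a + x a) = a]].

Definition psa x := [/\ bo x, sa x & pos x].

Lemma resP x : psa x -> [/\ bo (res x), sa (res x),
  forall a, res x a + x (res x a) = a & forall a, res x (a + x a) = a].
Proof.
move=> [hx sx px]; rewrite /res; case: xgetP => [y _ //|].
have [||||y [hy sy xy yx]] := @pos_inv (idfun + x) 1.
- exact: bo_add bo_id hx.
- exact: saD.
- exact: ltr01.
- by move=> a; rewrite mul1r opE rdDl lerDl.
by move=> /(_ y); elim; split.
Qed.

Lemma res_comm x z : psa x -> bo z -> (forall a, z (x a) = x (z a)) ->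
  forall a, z (res x a) = res x (z a).
Proof.
move=> hx hz zx a; have [hr sr rx xr] := resP hx.
by rewrite -{2}(rx a) (boD hz) zx xr.
Qed.

Lemma res_pos x : psa x -> pos (res x).
Proof.
move=> hx a; have [hr sr rx xr] := resP hx; have [_ _ px] := hx.
by rewrite -{2}(rx a) rdDr addr_ge0 ?rd_ge0 // rdC.
Qed.
Lemma res_psa x : psa x -> psa (res x).
Proof. by move=> hx; have [hr sr _ _] := resP hx; split=> //; exact: res_pos. Qed.

(** This is [x (1 + x)^-1], the parallel sum of [x] and [1]: it depends monotonically on [x] and
    stays below both [x] and [1]. *)
Definition cutf x := idfun - res x.

Lemma cutE x a : cutf x a = a - res x a. Proof. by []. Qed.
Lemma cut_x x : psa x -> forall a, cutf x a = x (res x a).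
Proof. by move=> hx a; have [_ _ h _] := resP hx; rewrite cutE -{1}(h a) addrAC subrr add0r. Qed.
Lemma bo_cut x : psa x -> bo (cutf x).
Proof. by move=> /resP[hr _ _ _]; apply: bo_sub => //; exact: bo_id. Qed.
Lemma sa_cut x : psa x -> sa (cutf x).
Proof. by move=> /resP[_ sr _ _]; exact: saB. Qed.

Lemma cut_eq x : psa x -> forall a, rd (cutf x a) a =
  rd (x (res x a)) (res x a) + rd (a - res x a) (a - res x a).
Proof.
move=> hx a; have [_ _ h _] := resP hx.
rewrite -cutE cut_x // -{2}(h a) rdDr; congr (_ + _).
Qed.

(** Variational description of the parallel sum: over all splittings [a = b + (a - b)] the
    right-hand side is least at [b = res x a], where [cut_eq] gives equality. Monotonicity of [cutf]
    and the later semicontinuity arguments are instances of it. *)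
Lemma cut_var x : psa x -> forall a b, rd (cutf x a) a <= rd (x b) b + rd (a - b) (a - b).
Proof.
move=> hx a b; rewrite cut_eq //; have [hb sx px] := hx; have [_ _ h _] := resP hx.
have ar : a - res x a = x (res x a) by rewrite -{1}(h a) addrAC subrr add0r.
have [d ->] : exists d, b = res x a + d by exists (b - res x a); rewrite addrC subrK.
rewrite opprD addrA ar; move: (res x a) => r; rewrite (boD hb) !rdE.
have e1 : rd (x d) r = rd (x r) d by rewrite sx rdC.
have := rdC d (x r); have := px d; have := rd_ge0 d; lra.
Qed.

Lemma cut_le x : psa x -> ole (cutf x) x.
Proof. by move=> hx a; apply: le_trans (cut_var hx a a) _; rewrite subrr rd0l addr0. Qed.
Lemma cut_le1 x : psa x -> ole (cutf x) idfun.
Proof. by move=> hx a; apply: le_trans (cut_var hx a 0) _; have [/bo0 -> _ _] := hx; rewrite rd0l add0r subr0. Qed.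
Lemma cut_pos x : psa x -> pos (cutf x).
Proof. by move=> hx a; rewrite cut_eq // addr_ge0 ?rd_ge0 //; case: hx. Qed.
Lemma cut_psa x : psa x -> psa (cutf x).
Proof. by move=> hx; split; [exact: bo_cut|exact: sa_cut|exact: cut_pos]. Qed.
Lemma cut_mono x y : psa x -> psa y -> ole x y -> ole (cutf x) (cutf y).
Proof.
move=> hx hy xy a; rewrite (cut_eq hy); apply: le_trans (cut_var hx a (res y a)) _.
by rewrite lerD2r.
Qed.
Lemma res_le1 x : psa x -> ole (res x) idfun.
Proof. by move=> hx a; have := cut_pos hx a; rewrite cutE rdBl subr_ge0. Qed.
Lemma cut_bnd x : psa x -> bnd 1 (cutf x).
Proof.
move=> hx; have [? ? ?] := cut_psa hx; apply: ole_bnd => // a.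
by rewrite mul1r; exact: cut_le1.
Qed.
Lemma res_bnd x : psa x -> bnd 1 (res x).
Proof.
move=> hx; have [? ? ?] := res_psa hx; apply: ole_bnd => // a.
by rewrite mul1r; exact: res_le1.
Qed.
(** The parallel sum of [d] with itself is [d / 2], and the parallel sum of [x] and [1] lies above
    it. *)
Lemma cut_half x d : psa x -> psa d -> ole d x -> ole d idfun ->
  forall a, rd (d a) a <= 2 * rd (cutf x a) a.
Proof.
move=> hx [hd sd pd] dx d1 a; rewrite cut_eq //.
have -> : rd (d a) a = rd (d (res x a + (a - res x a))) (res x a + (a - res x a)).
  by rewrite [in RHS](addrC (res x a)) subrK.
move: (res x a) (a - res x a) => r q.
have h1 := dx r; have h2 : rd (d q) q <= rd q q := d1 q.
have := pd (r - q); rewrite (boB hd) (boD hd) !rdE; lra.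
Qed.

End Limits.

(** * Closure properties of a von Neumann algebra and suprema of directed families *)

Section VonNeumann.
Context {R : realType} {H : hilbert R} (M : set (op H)).
Hypothesis hM : von_neumann_algebra M.
Implicit Types (x y z : H -> H) (a b c : H).

Lemma M_bo x : M x -> bo x.
Proof. by have [h _ _] := hM => /h/boP. Qed.

(** The bicommutant property as a membership test: it is enough to commute with every bounded
    operator that commutes with [M]. *)
Lemma M_of_comm x : bo x -> (forall z, bo z -> (forall y, M y -> forall a, y (z a) = z (y a)) ->
  forall a, z (x a) = x (z a)) -> M x.
Proof.
move=> hx h; have [_ _ <-] := hM; split; first exact/boP.
move=> z [/boP hz zP]; apply: funext => a /=; apply: h => // y My b.
by have := zP y My => /(congr1 (fun f => f b)).
Qed.

Lemma M_adj x : M x -> M (adj x). Proof. by have [_ h _] := hM => /h. Qed.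
Lemma M_id : M idfun.
Proof. by apply: M_of_comm => //; exact: bo_id. Qed.
Lemma M_0 : M 0.
Proof. by apply: M_of_comm => [|z hz _ a]; [exact: bo_zero|rewrite bo0]. Qed.
Lemma M_comp x y : M x -> M y -> M (x \o y).
Proof.
move=> Mx My; apply: M_of_comm => [|z hz zP a /=]; first by apply: bo_comp; exact: M_bo.
by rewrite -zP // -zP.
Qed.
Lemma M_add x y : M x -> M y -> M (x + y).
Proof.
move=> Mx My; apply: M_of_comm => [|z hz zP a]; first by apply: bo_add; exact: M_bo.
by rewrite !opE (boD hz) (zP _ Mx) (zP _ My).
Qed.
Lemma M_scale (k : R[i]) x : M x -> M (k *: x).
Proof.
move=> Mx; apply: M_of_comm => [|z hz zP a]; first by apply: bo_scale; exact: M_bo.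
by rewrite !opE (boZ hz) (zP _ Mx).
Qed.
Lemma M_opp x : M x -> M (- x).
Proof. by move=> Mx; rewrite -scaleN1r; exact: M_scale. Qed.
Lemma M_sub x y : M x -> M y -> M (x - y).
Proof. by move=> Mx My; apply: M_add => //; exact: M_opp. Qed.
Lemma M_inv x y : M x -> bo y -> (forall a, x (y a) = a) -> (forall a, y (x a) = a) -> M y.
Proof.
move=> Mx hy xy yx; apply: M_of_comm => // z hz zP a.
by rewrite -[LHS]yx zP // xy.
Qed.
Lemma M_lim {T} {F : set_system T} {FF : ProperFilter F} (x : T -> H -> H) y :
  (forall n, M (x n)) -> bo y -> (forall a, scvg F (fun n => x n a) (y a)) -> M y.
Proof.
move=> Mx hy xy; apply: M_of_comm => // z hz zP a.
apply: (scvg_uniq (bo_scvg hz (xy a))).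
have -> : z \o (fun n => x n a) = fun n => x n (z a) by apply: funext => n /=; rewrite zP.
exact: xy.
Qed.
Lemma M_res x : M x -> psa x -> M (res x).
Proof.
move=> Mx px; have [hr _ xr rx] := resP px.
by apply: (@M_inv (idfun + x)) => //; apply: M_add => //; exact: M_id.
Qed.
Lemma M_cut x : M x -> psa x -> M (cutf x).
Proof. by move=> Mx px; apply: M_sub; [exact: M_id|exact: M_res]. Qed.

Lemma psa_sq x : bo x -> psa (adj x \o x).
Proof.
move=> hx; split; first by apply: bo_comp => //; exact: bo_adj.
  by move=> a b /=; rewrite -(rd_adjr hx) -(rd_adj hx).
by move=> a /=; rewrite -(rd_adjr hx) rd_ge0.
Qed.
Lemma rd_sq x : bo x -> forall a, rd ((adj x \o x) a) a = rd (x a) (x a).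
Proof. by move=> hx a /=; rewrite -(rd_adjr hx). Qed.
Lemma psaD x y : psa x -> psa y -> psa (x + y).
Proof.
move=> [hx sx px] [hy sy py]; split; [exact: bo_add|exact: saD|].
by move=> a; rewrite opE rdDl addr_ge0.
Qed.
Lemma psaZ (k : R) x : 0 <= k -> psa x -> psa (k%:C *: x).
Proof.
move=> k0 [hx sx px]; split; [exact: bo_scale|exact: saZ|].
by move=> a; rewrite opE rdZl mulr_ge0.
Qed.
Lemma psa0 : psa (0 : H -> H).
Proof. by split; [exact: bo_zero|exact: sa0|move=> a; rewrite rd0l]. Qed.
Lemma psa_id : psa (idfun : H -> H).
Proof. by split; [exact: bo_id|exact: sa_id|move=> a; rewrite rd_ge0]. Qed.
Lemma psaB x y : psa x -> psa y -> ole x y -> psa (y - x).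
Proof. by move=> [hx sx px] [hy sy py] xy; split; [exact: bo_sub|exact: saB|exact/posB]. Qed.
Lemma psa_sqs x : bo x -> sa x -> psa (x \o x).
Proof. by move=> hx sx; rewrite -{1}(sa_adj hx sx); exact: psa_sq. Qed.

Lemma pos_partP x : pos_part M x <-> M x /\ psa x.
Proof.
split=> [[Mx /(op_posP (bo_lin (M_bo Mx)))[sx px]]|[Mx [hx sx px]]].
  by split=> //; split=> //; exact: M_bo.
by split=> //; apply/op_posP => //; exact: bo_lin.
Qed.

Lemma M_re x : M x -> exists x1 x2, [/\ M x1, M x2, sa x1, sa x2 & x = x1 + 'i%C *: x2].
Proof.
move=> Mx; have hx := M_bo Mx; have Max := M_adj Mx; have hax := M_bo Max.
exists (2^-1%:C *: (x + adj x)), (2^-1%:C *: (- 'i%C *: (x - adj x))).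
have ii a b : rd (- 'i%C *: a) b = rd a ('i%C *: b) by rewrite scaleNr rdNl rdiC opprK.
have ii2 a b : rd ('i%C *: a) b = rd a (- 'i%C *: b) by rewrite scaleNr rdNr rdiC.
split.
- by apply: M_scale; apply: M_add.
- by apply: M_scale; apply: M_scale; apply: M_sub.
- move=> a b; rewrite !opE !rdE !(rd_adj hx) (rd_adjr hx); lra.
- move=> a b; rewrite !opE rdZl rdZr; congr (_ * _); rewrite ii -ii2 rdBl rdBr.
  rewrite (rd_adj hx) -(rd_adjr hx) (boZ hax) (boZ hx) !rdiC; lra.
- apply: funext => a; rewrite !opE; apply: rd_inj => c; rewrite !(rdDl, rdZl, rdiC, rdNl, scaleNr, rdNr, rdZr).
  rewrite !scalerA -expr2 sqr_i !scaleN1r !rdE; lra.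
Qed.

(** Translates strong limits of increasing sequences into the order-theoretic suprema in which
    normality is stated; [sup_seq] goes the other way. *)
Lemma range_sup (x : nat -> H -> H) y : (forall n, M (x n) /\ psa (x n)) -> bo y ->
  (forall n, ole (x n) (x n.+1)) -> (forall a, scvg \oo (fun n => x n a) (y a)) ->
  [/\ M y, psa y, range x `<=` pos_part M, upward_directed (range x) & is_op_sup M (range x) y].
Proof.
move=> hx hy mx xy; have My : M y by apply: M_lim (xy) => // n; case: (hx n).
have mono n m : (n <= m)%N -> ole (x n) (x m).
  move=> nm; rewrite -(subnK nm); elim: (m - n)%N => [|k IH]; first exact: ole_refl.
  by rewrite addSn; apply: ole_trans IH (mx _).
have lim_rd a b : rd (x n a) b @[n --> \oo] --> rd (y a) b.
  by apply: rd_cvg; [exact: xy|exact: scvg_cst].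
have le_y n : ole (x n) y.
  move=> a; have /cvgP/nondecreasing_cvgn_le := lim_rd a a.
  by rewrite (cvg_lim _ (lim_rd a a)) //; apply=> k m km; exact: mono.
have sy : sa y.
  move=> a b; apply: (cvg_unique _ (lim_rd a b)) => //.
  have -> : (fun n => rd (x n a) b) = (fun n => rd (x n b) a).
    by apply: funext => n; have [_ [_ -> _]] := hx n; rewrite rdC.
  by rewrite (rdC a); exact: lim_rd.
have py : psa y by split=> // a; apply: le_trans (le_y 0%N a); have [_ [_ _ ->]] := hx 0%N.
have xM : range x `<=` pos_part M by move=> _ [n _ <-]; exact/pos_partP.
split=> //.
  split; first by exists (x 0%N), 0%N.
  move=> _ _ [n _ <-] [m _ <-]; exists (x (maxn n m)).
  have [_ [h1 s1 _]] := hx n; have [_ [h2 s2 _]] := hx m; have [_ [h3 s3 _]] := hx (maxn n m).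
  by split; [exists (maxn n m)|apply/op_leP => //; apply: mono; exact: leq_maxl|apply/op_leP => //; apply: mono; exact: leq_maxr].
split; first exact/pos_partP.
  by move=> _ [n _ <-]; have [_ [h1 s1 _]] := hx n; apply/op_leP.
move=> t /pos_partP[Mt [ht st pt]] hle; apply/op_leP => // a.
apply: (cvg_ub _ (lim_rd a a)) => n.
have [_ [h1 s1 _]] := hx n; have /(op_leP h1 ht s1 st) := hle (x n) (ex_intro2 _ _ n I erefl); exact.
Qed.

Lemma tot_setT : exists2 xi : nat -> H, tot (range xi) & True.
Proof.
have [D [cD dD]] := hilbert_separable H; have tD : tot D by exact/dense_tot.
have [d0 Dd0 _] := tD 0 1 ltr01.
have /countable_injP[f finj] := cD.
exists (fun n => xget d0 [set d | D d /\ f d = n]) => //.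
move=> a e e0; have [d Dd hd] := tD a e e0; exists d => //; exists (f d) => //.
case: xgetP => [d' _ [Dd' fd]|/(_ d)[]//].
by apply: finj => //; exact: mem_set.
Qed.

Lemma ole_tot (D : set H) x y : tot D -> bo x -> bo y ->
  (forall d, D d -> rd (x d) d <= rd (y d) d) -> ole x y.
Proof.
move=> tD hx hy h a; have [u uD ua] := tot_seq a tD.
rewrite -subr_ge0; apply: (@cvg_lb _ _ \oo _ (fun n => rd (y (u n)) (u n) - rd (x (u n)) (u n))).
  by move=> n; rewrite subr_ge0; exact: h.
by apply: cvgB; apply: rd_cvg => //; apply: bo_scvg.
Qed.

(** Separability reduces directed families to sequences. For a dense sequence [xi], an element
    [p (j, m)] comes within the [m]-th error of the largest value at [xi j]; an increasing sequence
    in [D] that dominates all [p (j, m)] has the same supremum. *)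
Lemma sup_seq (D : set (H -> H)) s : D `<=` pos_part M -> upward_directed D -> is_op_sup M D s ->
  exists d : nat -> H -> H, [/\ forall n, D (d n), forall n, ole (d n) (d n.+1) &
    forall a, scvg \oo (fun n => d n a) (s a)].
Proof.
move=> DM [[d0 Dd0] dirD] [/pos_partP[Ms [hs ss ps]] ubs lubs].
have Dpsa d : D d -> psa d by move=> /DM/pos_partP[].
have [xi txi _] := tot_setT.
have Dle d : D d -> ole d s by move=> Dd; have [hd sd _] := Dpsa _ Dd; apply/op_leP => //; exact: ubs.
have dir x y : D x -> D y -> exists z, [/\ D z, ole x z & ole y z].
  move=> Dx Dy; have [z [Dz xz yz]] := dirD x y Dx Dy; exists z.
  have [hx sx _] := Dpsa _ Dx; have [hy sy _] := Dpsa _ Dy; have [hz sz _] := Dpsa _ Dz.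
  by split=> //; apply/op_leP.
have [eps [e0 eN]] := eps_seq R.
have /choice[p pP] (jm : nat * nat) : exists d, D d /\
    forall d', D d' -> rd (d' (xi jm.1)) (xi jm.1) <= rd (d (xi jm.1)) (xi jm.1) + eps jm.2.
  pose A := [set rd (d (xi jm.1)) (xi jm.1) | d in D].
  have supA : has_sup A.
    split; first by exists (rd (d0 (xi jm.1)) (xi jm.1)), d0.
    by exists (rd (s (xi jm.1)) (xi jm.1)) => _ [d Dd <-]; exact: Dle.
  have [_ [d Dd <-] hd] := sup_adherent (e0 jm.2) supA.
  exists d; split=> // d' Dd'; rewrite -lerBlDr; apply: le_trans (ltW hd).
  by rewrite lerD2r; apply: ub_le_sup; [exact: supA.2|exists d'].
(* The pairs [(j, m)] are enumerated through [pickle]; codes of no pair get the default [d0]. *)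
have /choice[q qP] (n : nat) : exists d, D d /\ forall jm, unpickle n = Some jm -> d = p jm.
  case: (unpickle n) => [jm|]; last by exists d0.
  by exists (p jm); split; [case: (pP jm)|move=> _ [<-]].
have /choice[up upP] (xy : (H -> H) * (H -> H)) : exists z, D xy.1 -> D xy.2 ->
    [/\ D z, ole xy.1 z & ole xy.2 z].
  have [[D1 D2]|h] := pselect (D xy.1 /\ D xy.2).
    by have [z hz] := dir _ _ D1 D2; exists z.
  by exists d0 => D1 D2; exfalso; exact: h.
pose d := fix d n := if n is m.+1 then up (d m, q m) else q 0%N.
have Dq n : D (q n) by case: (qP n).
have Ddn n : D (d n).
  by elim: n => [|n IH] //=; have [] := upP (d n, q n) IH (Dq n).
have mono n : ole (d n) (d n.+1) by have [] := upP (d n, q n) (Ddn n) (Dq n).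
have qd n : ole (q n) (d n.+1) by have [] := upP (d n, q n) (Ddn n) (Dq n).
have [C C0 hC] := bo_bnd hs.
have bC n a : rd (d n a) a <= C * rd a a.
  apply: le_trans (Dle _ (Ddn n) a) _; apply: le_trans (rd_le _ _) _.
  by rewrite -nr2 expr2 mulrA ler_wpM2r ?nr_ge0.
have [t [ht st pt dt let_]] := mono_lim C0 (fun n => Dpsa _ (Ddn n)) mono bC.
have Mt : M t by apply: M_lim (dt) => // n; have /DM/pos_partP[] := Ddn n.
exists d; split=> // a.
suff -> : s = t by exact: dt.
have ts : ole t s.
  move=> b; apply: (@cvg_ub _ nat \oo _ (fun n => rd (d n b) b)); first by move=> n; exact: Dle.
  by apply: rd_cvg; [exact: dt|exact: scvg_cst].
have st' : ole s t.
  apply/(op_leP hs ht ss st); apply: lubs; first exact/pos_partP.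
  move=> x Dx; have [hx sx px] := Dpsa _ Dx; apply/(op_leP hx ht sx st).
  apply: (ole_tot txi) => // _ [j _ <-]; apply/ler_addgt0Pr => e /eN[m /(_ m (leqnn m)) hm].
  have [_ /(_ x Dx) h1] := pP (j, m).
  have [_ /(_ (j, m)) h2] := qP (pickle (j, m)).
  have := qd (pickle (j, m)) (xi j); rewrite h2 ?pickleK // => h3.
  have := let_ (pickle (j, m)).+1 (xi j); move: h1 => /= h1; lra.
have h0 : s - t = 0.
  have [hd sd pd] := psaB (And3 ht st pt) (And3 hs ss ps) ts.
  apply: pos_eq0 => // b; apply/eqP; rewrite eq_le pd andbT opE rdDl rdNl subr_le0; exact: st'.
by apply/eqP; rewrite -subr_eq0 h0.
Qed.

End VonNeumann.

(** * Weights, the left ideal of square-finite elements, and an approximate unit *)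

Section Weight.
Context {R : realType} {H : hilbert R} (M : set (op H)) (phi : op H -> \bar R).
Hypothesis hM : von_neumann_algebra M.
Hypothesis hphi : fns_weight M phi.
Implicit Types (x y z : H -> H) (a b c : H).

Lemma phi_ge0 x : M x -> psa x -> (0 <= phi x)%E.
Proof. by have [[h _ _] _ _ _] := hphi => Mx px; apply: h; exact/(pos_partP hM). Qed.
Lemma phiD x y : M x -> psa x -> M y -> psa y -> phi (x + y) = (phi x + phi y)%E.
Proof. by have [[_ h _] _ _ _] := hphi => Mx px My py; apply: h; exact/(pos_partP hM). Qed.
Lemma phiZ (k : R) x : 0 <= k -> M x -> psa x -> phi (k%:C *: x) = (k%:E * phi x)%E.
Proof. by have [[_ _ h] _ _ _] := hphi => k0 Mx px; apply: h => //; exact/(pos_partP hM). Qed.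
Lemma phi_0 : phi 0 = 0%E.
Proof.
rewrite -(scale0r (0 : H -> H)) -[X in X *: _]/(0%:C) phiZ //; last exact: psa0.
  by rewrite mul0e.
exact: M_0.
Qed.
Lemma phi_mono x y : M x -> psa x -> M y -> psa y -> ole x y -> (phi x <= phi y)%E.
Proof.
move=> Mx px My py xy; have pd := psaB px py xy; have Md : M (y - x) by exact: M_sub.
by rewrite -(subrK x y) (phiD Md pd Mx px) leeDr // phi_ge0.
Qed.
Lemma phi_eq0 x : M x -> psa x -> phi x = 0%E -> x = 0.
Proof. by have [_ h _ _] := hphi => Mx px; apply: h; exact/(pos_partP hM). Qed.

Lemma phi_lim (x : nat -> H -> H) y : (forall n, M (x n) /\ psa (x n)) -> bo y ->
  (forall n, ole (x n) (x n.+1)) -> (forall a, scvg \oo (fun n => x n a) (y a)) ->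
  forall k, (forall n, phi (x n) <= k)%E -> (phi y <= k)%E.
Proof.
move=> hx hy mx xy k hk; have [My py r d s] := range_sup hM hx hy mx xy.
have [_ _ h _] := hphi; rewrite (h _ _ r d s).
by apply: ub_ereal_sup => _ [_ [n _ <-] <-].
Qed.

Definition sq x := adj x \o x.
Lemma M_sq x : M x -> M (sq x).
Proof. by move=> Mx; apply: (M_comp hM) => //; exact: (M_adj hM). Qed.
Lemma sq_psa x : M x -> psa (sq x).
Proof. by move=> /(M_bo hM); exact: psa_sq. Qed.
Lemma sqE x : M x -> forall a, rd (sq x a) a = rd (x a) (x a).
Proof. by move=> /(M_bo hM) hx a; exact: rd_sq. Qed.
Lemma phi_sq_ge0 x : M x -> (0 <= phi (sq x))%E.
Proof. by move=> Mx; apply: phi_ge0; [exact: M_sq|exact: sq_psa]. Qed.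

Lemma psa_eq x y : psa x -> psa y -> (forall a, rd (x a) a = rd (y a) a) -> x = y.
Proof.
move=> px py h; apply/eqP; rewrite -subr_eq0; apply/eqP.
have [h1 h2 h3] : psa (x - y) by apply: psaB => // a; rewrite h.
by apply: pos_eq0 => // a; rewrite opE rdDl rdNl h subrr.
Qed.

Lemma sq_scale (k : R[i]) x : M x -> sq (k *: x) = ((complex.Re `|k|) ^+ 2)%:C *: sq x.
Proof.
move=> Mx; have Mk : M (k *: x) by exact: M_scale.
have h0 : 0 <= complex.Re `|k| ^+ 2 by exact: sqr_ge0.
apply: psa_eq; [exact: sq_psa|apply: psaZ => //; exact: sq_psa|move=> a].
by rewrite [in RHS]opE rdZl !sqE // opE -!nr2 nrZc exprMn.
Qed.

Local Notation nphi := (nphi M phi).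

Lemma n_M x : nphi x -> M x. Proof. by case. Qed.
Lemma n_fin x : nphi x -> (phi (sq x) < +oo)%E. Proof. by case. Qed.
Lemma n_intro x (k : \bar R) : M x -> (phi (sq x) <= k)%E -> (k < +oo)%E -> nphi x.
Proof. by move=> Mx h1 h2; split=> //; exact: le_lt_trans h1 h2. Qed.

Lemma phi_sq_comp x y (C : R) : M x -> M y -> 0 <= C -> bnd C x ->
  (phi (sq (x \o y)) <= (C ^+ 2)%:E * phi (sq y))%E.
Proof.
move=> Mx My C0 hC; rewrite -phiZ ?sqr_ge0 //; [|exact: M_sq|exact: sq_psa].
apply: phi_mono.
- by apply: M_sq; exact: M_comp.
- by apply: sq_psa; exact: M_comp.
- by apply: M_scale => //; exact: M_sq.
- by apply: psaZ; [exact: sqr_ge0|exact: sq_psa].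
move=> a; rewrite sqE ?opE ?rdZl ?sqE //=; last exact: M_comp.
by rewrite -!nr2 -exprMn lerXn2r ?nnegrE ?mulr_ge0 ?nr_ge0.
Qed.

Lemma n_comp x y : M x -> nphi y -> nphi (x \o y).
Proof.
move=> Mx ny; have [C C0 hC] := bo_bnd (M_bo hM Mx); have My := n_M ny.
apply: (n_intro (M_comp hM Mx My) (phi_sq_comp Mx My C0 hC)).
by rewrite lte_mul_pinfty ?sqr_ge0 ?lee_fin ?sqr_ge0 ?n_fin.
Qed.
Lemma n_scale (k : R[i]) x : nphi x -> nphi (k *: x).
Proof.
move=> nx; have Mx := n_M nx; split; first exact: M_scale.
rewrite -/(sq _) sq_scale // phiZ ?sqr_ge0 //; [|exact: M_sq|exact: sq_psa].
by rewrite lte_mul_pinfty ?lee_fin ?sqr_ge0 ?n_fin.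
Qed.
Lemma n_add x y : nphi x -> nphi y -> nphi (x + y).
Proof.
move=> nx ny; have Mx := n_M nx; have My := n_M ny; have Mxy := M_add hM Mx My.
have h2 : (0 : R) <= 2 by [].
have P1 : M (2%:C *: sq x) by apply: M_scale => //; exact: M_sq.
have P2 : M (2%:C *: sq y) by apply: M_scale => //; exact: M_sq.
have p1 : psa (2%:C *: sq x) by apply: psaZ => //; exact: sq_psa.
have p2 : psa (2%:C *: sq y) by apply: psaZ => //; exact: sq_psa.
apply: (@n_intro _ (phi (2%:C *: sq x + 2%:C *: sq y))) => //.
  apply: phi_mono; [exact: M_sq|exact: sq_psa|exact: M_add|exact: psaD|move=> a].
  rewrite sqE // !opE !rdDl !rdZl !sqE // !rdE.
  have := rd_ge0 (x a - y a); rewrite !rdE (rdC (y a)); lra.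
rewrite phiD // !phiZ //; [|exact: M_sq|exact: sq_psa|exact: M_sq|exact: sq_psa].
by rewrite lte_add_pinfty // lte_mul_pinfty ?lee_fin ?n_fin.
Qed.
Lemma n_opp x : nphi x -> nphi (- x).
Proof. by move=> nx; rewrite -scaleN1r; exact: n_scale. Qed.
Lemma n_sub x y : nphi x -> nphi y -> nphi (x - y).
Proof. by move=> nx ny; apply: n_add => //; exact: n_opp. Qed.
Lemma n_0 : nphi 0.
Proof.
split; first exact: M_0.
suff -> : adj 0 \o (0 : H -> H) = 0 by rewrite phi_0.
by apply: funext => a /=; rewrite bo0 //; apply: bo_adj; exact: bo_zero.
Qed.
Lemma n_psa x : M x -> psa x -> ole x idfun -> (phi x < +oo)%E -> nphi x.
Proof.
move=> Mx px x1 fx; apply: (@n_intro _ (phi x)) => //.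
have [hx sx p0] := px.
apply: phi_mono => //; [exact: M_sq|exact: sq_psa|move=> a].
rewrite sqE //; have := @pos_le R H x 1 hx sx p0 _ a; rewrite mul1r; apply=> b.
by rewrite mul1r; exact: x1.
Qed.

(** Semifiniteness enters here: evaluation at [xi] is continuous for pointwise convergence, and
    [idfun] is a limit of elements of [nphi]. *)
Lemma sf_sep xi : (forall y, nphi y -> y xi = 0) -> xi = 0.
Proof.
move=> h; apply: nr_eq0; apply/eqP; rewrite eq_le nr_ge0 andbT; apply/ler_addgt0Pr => e e0.
have [_ _ _ /(_ idfun (M_id hM)) cl] := hphi.
have ev : (fun g : {ptws H -> H} => g xi) @ nbhs (idfun : {ptws H -> H}) --> xi.
  by have /pointwise_cvgP := @cvg_id _ (nbhs (idfun : {ptws H -> H})); exact.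
have [|f [nf]] := cl [set f | ball xi e%:C (f xi)].
  by apply: ev; apply: nbhsx_ballx; rewrite ltcR.
by rewrite /= (h f nf) -ball_normE /= subr0 norm_nr ltcR add0r => /ltW.
Qed.

(** It says that [1 - cutf (n a)] is small on the range of [y^*]. With [w = (1 + n a)^-1 y^* zeta]
    and [Q = <w, y^* zeta>], the domination [y^* y <= a] gives [n |y w|^2 <= Q], while
    [Q = <y w, zeta>] gives [Q^2 <= |y w|^2 |zeta|^2]. *)
Lemma dist_le_cut (a : H -> H) (n : R) y zeta : psa a -> 0 < n -> bo y -> ole (sq y) a ->
  rd (res (n%:C *: a) (adj y zeta)) (adj y zeta) <= n^-1 * rd zeta zeta.
Proof.
move=> pa n0 hy ya; have pn : psa (n%:C *: a) by apply: psaZ => //; exact: ltW.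
have [hr sr rx _] := resP pn; have ppos := res_pos pn.
set w := res (n%:C *: a) (adj y zeta); pose Q := rd w (adj y zeta).
have Q0 : 0 <= Q by exact: ppos.
have h1 : rd (y w) (y w) <= n^-1 * Q.
  rewrite ler_pdivlMl // /Q -(rx (adj y zeta)) -/w opE rdDr rdZr.
  have := ya w; rewrite /sq /= -(rd_adjr hy) => h.
  have : n * rd (y w) (y w) <= n * rd (a w) w by rewrite ler_pM2l.
  by rewrite (rdC w (a w)); have := rd_ge0 w; lra.
have h2 : Q ^+ 2 <= rd (y w) (y w) * rd zeta zeta by rewrite /Q -(rd_adj hy); exact: rd_cs2.
have h3 : Q ^+ 2 <= n^-1 * rd zeta zeta * Q.
  apply: le_trans h2 _; rewrite mulrAC; apply: ler_wpM2r => //; exact: rd_ge0.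
rewrite -/Q; have [->|Q1] := eqVneq Q 0; first by rewrite mulr_ge0 ?rd_ge0 // invr_ge0 ltW.
by rewrite -(ler_pM2r (_ : 0 < Q)) -?expr2 // lt0r Q1.
Qed.

Definition fin_pos x := [/\ M x, psa x & (phi x < +oo)%E].

Lemma fin_posD x y : fin_pos x -> fin_pos y -> fin_pos (x + y).
Proof.
move=> [Mx px fx] [My py fy]; split; [exact: M_add|exact: psaD|].
by rewrite phiD // lte_add_pinfty.
Qed.
Lemma fin_posZ k x : 0 <= k -> fin_pos x -> fin_pos (k%:C *: x).
Proof.
move=> k0 [Mx px fx]; split; [exact: M_scale|exact: psaZ|].
by rewrite phiZ // lte_mul_pinfty ?lee_fin.
Qed.
Lemma fin_pos_cut x : fin_pos x -> fin_pos (cutf x).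
Proof.
move=> [Mx px fx]; have Mc := M_cut hM Mx px; have pc := cut_psa px; split=> //.
by apply: le_lt_trans fx; apply: phi_mono => //; exact: cut_le.
Qed.
Lemma fin_pos_sq y : nphi y -> fin_pos (sq y).
Proof. by move=> ny; have My := n_M ny; split; [exact: M_sq|exact: sq_psa|exact: n_fin]. Qed.

(** The cut-offs of the elements of finite weight are directed because [cutf] is monotone. Their
    supremum is [1], since [1 - cutf (n a)] vanishes asymptotically on the ranges of the [y^*] with
    [y] in [nphi], which are dense by [sf_sep]. *)
Lemma approx_unit : exists e : nat -> H -> H, [/\ forall n, fin_pos (e n),
  forall n, ole (e n) idfun, forall n, ole (e n) (e n.+1) & forall a, scvg \oo (fun n => e n a) a].
Proof.
pose D := [set cutf a | a in fin_pos].
have DM : D `<=` pos_part M.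
  by move=> _ [a fa <-]; apply/(pos_partP hM); have [] := fin_pos_cut fa.
have dirD : upward_directed D.
  split; first by exists (cutf 0), 0; rewrite //; split; [exact: M_0|exact: psa0|rewrite phi_0].
  move=> _ _ [a fa <-] [b fb <-]; have fab := fin_posD fa fb.
  exists (cutf (a + b)); have [Ma pa _] := fa; have [Mb pb _] := fb; have [Mab pab _] := fab.
  have [h1 s1 _] := cut_psa pa; have [h2 s2 _] := cut_psa pb; have [h3 s3 _] := cut_psa pab.
  split; first by exists (a + b).
    apply/op_leP => //; apply: cut_mono => // c; rewrite opE rdDl lerDl.
    by have [_ _] := pb.
  apply/op_leP => //; apply: cut_mono => // c; rewrite opE rdDl lerDr.
  by have [_ _] := pa.
have sup1 : is_op_sup M D idfun.
  split; first by apply/(pos_partP hM); split; [exact: M_id|exact: psa_id].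
    move=> _ [a [Ma pa _] <-]; have [h1 s1 _] := cut_psa pa.
    by apply/op_leP => //; [exact: bo_id|exact: cut_le1].
  move=> t /(pos_partP hM)[Mt [ht st pt]] tD.
  apply/(op_leP (@bo_id R H) ht (@sa_id R H) st).
  have tcut (a : H -> H) : fin_pos a -> ole (cutf a) t.
    move=> fa; have [_ /cut_psa[h1 s1 _] _] := fa.
    by apply/(op_leP h1 ht s1 st); apply: tD; exists a.
  (* The decay is required for all [b] above [a]: this uniformity makes [V] stable under sums, where
     the two lower bounds are added. *)
  pose V : set H := [set v | exists (a : H -> H) (C : R), [/\ fin_pos a, 0 <= C & forall (n : R) (b : H -> H), 0 < n -> fin_pos b -> ole a b ->
     rd (res (n%:C *: b) v) v <= n^-1 * C]].
  have Vadj y zeta : nphi y -> V (adj y zeta).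
    move=> ny; have My := n_M ny; exists (sq y), (rd zeta zeta); split; [exact: fin_pos_sq|exact: rd_ge0|].
    by move=> n b n0 [Mb pb _] yb; apply: dist_le_cut => //; exact: (M_bo hM My).
  apply: (@ole_tot _ _ V) => //; last 1 first.
  - move=> v [a [C [fa C0 hv]]]; apply/ler_addgt0Pr => e e0.
    have n0 : 0 < (C + 1) / e by rewrite divr_gt0 // ltr_wpDl.
    have := hv _ a n0 fa (@ole_refl _ _ a).
    have := tcut _ (fin_posZ (ltW n0) fa) v; rewrite cutE rdBl => h1 h2.
    have : ((C + 1) / e)^-1 * C <= e.
      by rewrite ler_pdivrMl // divfK ?gt_eqF // lerDl.
    by move=> h3; rewrite /=; lra.
  - apply: orth_tot.
    + by rewrite -(bo0 (bo_adj (@bo_zero R H))); apply: Vadj; exact: n_0.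
    + move=> v w [a [C [fa C0 hv]]] [b [C' [fb C0' hw]]].
      exists (a + b), (2 * C + 2 * C'); split; [exact: fin_posD|by lra|].
      move=> n c n0 fc abc; have [Mc pc _] := fc.
      have [_ [_ _ pa] _] := fa; have [_ [_ _ pb] _] := fb.
      have ac : ole a c by move=> d; apply: le_trans (abc d); rewrite opE rdDl lerDl.
      have bc : ole b c by move=> d; apply: le_trans (abc d); rewrite opE rdDl lerDr.
      have := hv n c n0 fc ac; have := hw n c n0 fc bc.
      have pn : psa (n%:C *: c) by apply: psaZ => //; exact: ltW.
      have [hr sr pr] := res_psa pn.
      have := pr (v - w); rewrite (boB hr) (boD hr) !rdE; lra.
    + move=> k v [a [C [fa C0 hv]]]; exists a, (k ^+ 2 * C); split=> //; first by rewrite mulr_ge0 ?sqr_ge0.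
      move=> n b n0 fb ab; have [Mb pb _] := fb.
      have pn : psa (n%:C *: b) by apply: psaZ => //; exact: ltW.
      have [hr sr pr] := res_psa pn.
      rewrite (boZ hr) rdZl rdZr mulrA -expr2 mulrCA ler_wpM2l ?sqr_ge0 //.
      exact: hv.
    + move=> w hw; apply: sf_sep => y ny; have hy := M_bo hM (n_M ny).
      apply: rd_inj => c; rewrite rd0l (rd_adj hy); apply: hw; exact: Vadj.
  - exact: bo_id.
have [e [eD em ec]] := sup_seq hM DM dirD sup1.
exists e; split=> // n; have [a fa <-] := eD n; first exact: fin_pos_cut.
by apply: cut_le1; case: fa.
Qed.

(** Does the work of a square root. The recursion [P - P^2] keeps the operators between [0] and [1],
    so [x] minus the sum of the first [n] squares is [P n]; it tends strongly to [0] because the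
    series of the [|P n a|^2] converges. *)
Lemma sq_sum x : M x -> psa x -> ole x idfun -> exists P : nat -> H -> H, exists S : nat -> H -> H,
  [/\ forall n, M (P n) /\ sa (P n), S 0%N = 0, forall n, S n.+1 = S n + (P n \o P n),
    forall n, ole (S n) x & forall a, scvg \oo (fun n => S n a) (x a)].
Proof.
move=> Mx px x1; pose P n := iter n (fun p => p - (p \o p)) x.
have PS n : P n.+1 = P n - (P n \o P n) by [].
have hP n : [/\ M (P n), psa (P n) & ole (P n) idfun].
  elim: n => [|n [Mn pn n1]] //; rewrite PS; have [hn sn p0] := pn.
  have Mnn : M (P n \o P n) by exact: M_comp.
  have pnn : psa (P n \o P n) by exact: psa_sqs.
  split; first exact: M_sub.
    apply: psaB => // a /=; rewrite sn.
    have := @pos_le R H _ 1 hn sn p0 _ a; rewrite mul1r; apply=> b.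
    by rewrite mul1r; exact: n1.
  move=> a; apply: le_trans (n1 a); rewrite opE rdDl opE rdNl /= sn gerDl oppr_le0 sn.
  exact: rd_ge0.
pose S n := x - P n.
have Sm n : ole (S n) (S n.+1).
  move=> a; have [_ [_ sn _] _] := hP n.
  have h : rd (P n (P n a)) a = rd (P n a) (P n a) by rewrite sn.
  by rewrite /S PS !opE !rdE /= h; have := rd_ge0 (P n a); lra.
have Sx n : ole (S n) x.
  by move=> a; have [_ [_ _ p0] _] := hP n; rewrite /S !opE !rdE; have := p0 a; lra.
have pS n : psa (S n).
  have S0 : ole (S 0%N) (S n).
    elim: n => [|n IH]; first exact: ole_refl.
    exact: ole_trans IH (Sm n).
  have [Mn [hn sn p0] _] := hP n; have [hx sx px0] := px.
  split; [exact: bo_sub|exact: saB|move=> a].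
  by apply: le_trans (S0 a); rewrite /S subrr rd0l.
exists P, S; split=> //; [by move=> n; have [? [? ? ?] _] := hP n|by rewrite /S subrr|by move=> n; rewrite /S PS opprB addrCA addrC|].
have [|y [hy sy py yS _]] := @mono_lim R H S 1 ler01 pS Sm.
  by move=> n a; rewrite mul1r; apply: le_trans (Sx n a) (x1 a).
move=> a; have u1 : rd (S n a) a @[n --> \oo] --> rd (y a) a.
  by apply: rd_cvg; [exact: yS|exact: scvg_cst].
have u2 : rd (S n.+1 a) a @[n --> \oo] --> rd (y a) a by rewrite (cvg_shiftS (fun n => rd (S n a) a)).
have u3 : nr (P n a) ^+ 2 @[n --> \oo] --> (0 : R).
  rewrite -(subrr (rd (y a) a)).
  have -> : (fun n => nr (P n a) ^+ 2) = (fun n => rd (S n.+1 a) a - rd (S n a) a); last exact: cvgB.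
  apply: funext => n; have [_ [_ sn _] _] := hP n.
  have h : rd (P n (P n a)) a = rd (P n a) (P n a) by rewrite sn.
  by rewrite /S PS !opE !rdE /= h nr2; ring.
have P0 : scvg \oo (fun n => P n a) 0.
  apply/scvgP => e e0; have /cvgrPdist_le/(_ (e ^+ 2)) := u3.
  rewrite exprn_gt0 // => /(_ isT); apply: filterS => n.
  rewrite sub0r normrN ger0_norm ?sqr_ge0 // subr0 => h.
  by rewrite -(@ler_pXn2r _ 2) // nnegrE ?nr_ge0 // ltW.
rewrite -[x a]subr0; exact: scvgB (scvg_cst _) P0.
Qed.

End Weight.

Lemma sa_of_im {R : realType} {H : hilbert R} (x : H -> H) : linear x ->
  (forall a, rd (x a) ('i%C *: a) = 0) -> sa x.
Proof.
move=> lx him.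
have hs a b : rd (x a) ('i%C *: b) = - rd (x b) ('i%C *: a).
  have := him (a + b); rewrite (linD lx) scalerDr !rdDl !rdDr !him; lra.
move=> a b; have := hs a ('i%C *: b); rewrite (linZ lx) rdi scalerA.
rewrite -expr2 sqr_i scaleN1r rdNr (rdC a); lra.
Qed.

(** * The GNS representation is faithful, normal and adjoint-preserving *)

Section Gns.
Context {R : realType} {H K : hilbert R} (M : set (op H)) (phi : op H -> \bar R).
Context (Lambda : op H -> K) (pi : op H -> op K).
Hypothesis hM : von_neumann_algebra M.
Hypothesis hphi : fns_weight M phi.
Hypothesis hGNS : is_gns M phi Lambda pi.
Implicit Types (x y z : H -> H) (a b c : H) (k l : K).
Local Notation nphi := (nphi M phi).

Lemma LamD x y : nphi x -> nphi y -> Lambda (x + y) = Lambda x + Lambda y.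
Proof. by have [h _ _ _] := hGNS => nx ny; have := h 1 x y nx ny; rewrite !scale1r. Qed.
Lemma Lam0 : Lambda 0 = 0.
Proof.
apply: (addIr (Lambda 0)); rewrite -LamD ?add0r //; exact: n_0 hM hphi.
Qed.
Lemma LamZ (c : R[i]) x : nphi x -> Lambda (c *: x) = c *: Lambda x.
Proof. by have [h _ _ _] := hGNS => nx; have := h c x 0 nx (n_0 hM hphi); rewrite !addr0 Lam0 addr0. Qed.
Lemma LamN x : nphi x -> Lambda (- x) = - Lambda x.
Proof. by move=> nx; rewrite -scaleN1r LamZ // scaleN1r. Qed.
Lemma LamB x y : nphi x -> nphi y -> Lambda (x - y) = Lambda x - Lambda y.
Proof. by move=> nx ny; rewrite LamD ?LamN //; exact: (n_opp hM hphi). Qed.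

Lemma phi_fin x : nphi x -> phi (sq x) = (fine (phi (sq x)))%:E.
Proof.
move=> nx; rewrite fineK // ge0_fin_numE ?(n_fin nx) //.
by apply: (phi_sq_ge0 hM hphi); exact: n_M nx.
Qed.
Lemma Lam_rd x : nphi x -> rd (Lambda x) (Lambda x) = fine (phi (sq x)).
Proof. by have [_ h _ _] := hGNS => /h hx; rewrite /rd hx. Qed.
Lemma Lam_phi x : nphi x -> phi (sq x) = (rd (Lambda x) (Lambda x))%:E.
Proof. by move=> nx; rewrite Lam_rd // -phi_fin. Qed.
Lemma sq_eq0 x : M x -> sq x = 0 -> x = 0.
Proof.
move=> Mx h; apply: funext => a; apply: rd_eq0.
by rewrite -(sqE hM Mx) h rd0l.
Qed.
Lemma Lam_eq0 x : nphi x -> Lambda x = 0 -> x = 0.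
Proof.
move=> nx h; have Mx := n_M nx; apply: sq_eq0 => //.
apply: (phi_eq0 hM hphi); [exact: M_sq|exact: (sq_psa hM)|].
by rewrite Lam_phi // h rd0l.
Qed.
Lemma totL : tot (Lambda @` nphi).
Proof. by apply/dense_tot; have [_ _ h _] := hGNS. Qed.
Lemma pi_bo x : M x -> bo (pi x).
Proof. by have [_ _ _ h] := hGNS => /h[/boP]. Qed.
Lemma pi_L x y : M x -> nphi y -> pi x (Lambda y) = Lambda (x \o y).
Proof. by have [_ _ _ h] := hGNS => /h[_]; apply. Qed.

Lemma pi_ext x (T : K -> K) : M x -> bo T -> (forall y, nphi y -> T (Lambda y) = Lambda (x \o y)) -> pi x = T.
Proof.
move=> Mx hT h; apply: (bo_eq_tot totL) => //; first exact: pi_bo.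
by move=> _ [y ny <-]; rewrite pi_L // h.
Qed.

Lemma pi_comp x y : M x -> M y -> pi (x \o y) = pi x \o pi y.
Proof.
move=> Mx My; apply: pi_ext; [exact: M_comp|by apply: bo_comp; exact: pi_bo|].
by move=> z nz /=; rewrite !pi_L //; exact: (n_comp hM hphi).
Qed.
Lemma pi_add x y : M x -> M y -> pi (x + y) = pi x + pi y.
Proof.
move=> Mx My; apply: pi_ext; [exact: M_add|by apply: bo_add; exact: pi_bo|].
move=> z nz; rewrite opE !pi_L // -LamD //; exact: (n_comp hM hphi).
Qed.
Lemma pi_scale (c : R[i]) x : M x -> pi (c *: x) = c *: pi x.
Proof.
move=> Mx; apply: pi_ext; [exact: M_scale|by apply: bo_scale; exact: pi_bo|].
move=> z nz; rewrite opE !pi_L // -LamZ //; exact: (n_comp hM hphi).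
Qed.
Lemma pi_opp x : M x -> pi (- x) = - pi x.
Proof. by move=> Mx; rewrite -scaleN1r pi_scale // scaleN1r. Qed.
Lemma pi_sub x y : M x -> M y -> pi (x - y) = pi x - pi y.
Proof. by move=> Mx My; rewrite pi_add ?pi_opp //; exact: (M_opp hM). Qed.
Lemma pi_id : pi idfun = idfun.
Proof. by apply: pi_ext => //; [exact: M_id|exact: bo_id]. Qed.
Lemma pi_0 : pi 0 = 0.
Proof. by rewrite -(scale0r (idfun : H -> H)) pi_scale ?scale0r //; exact: M_id. Qed.

Lemma nr_Lam_le x y (C : R) : nphi x -> nphi y -> 0 <= C ->
  (phi (sq x) <= (C ^+ 2)%:E * phi (sq y))%E -> nr (Lambda x) <= C * nr (Lambda y).
Proof.
move=> nx ny C0; rewrite (Lam_phi nx) (Lam_phi ny) -EFinM lee_fin -!nr2 -exprMn.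
by rewrite (@ler_pXn2r _ 2) ?nnegrE ?mulr_ge0 ?nr_ge0.
Qed.
Lemma pi_bnd x (C : R) : M x -> 0 <= C -> bnd C x -> bnd C (pi x).
Proof.
move=> Mx C0 hC; apply: (bnd_tot totL) => //; first exact: pi_bo.
move=> _ [y ny <-]; rewrite pi_L //; have nxy : nphi (x \o y) by exact: (n_comp hM hphi).
by apply: nr_Lam_le => //; apply: (phi_sq_comp hM hphi) => //; exact: n_M ny.
Qed.

Definition conj_by y x := adj y \o x \o y.
Lemma conj_M x y : M x -> M y -> M (conj_by y x).
Proof. by move=> Mx My; apply: (M_comp hM) => //; apply: (M_comp hM) => //; exact: (M_adj hM). Qed.
Lemma conj_rd x y : M y -> forall a, rd (conj_by y x a) a = rd (x (y a)) (y a).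
Proof. by move=> /(M_bo hM) hy a; rewrite /conj_by /= -(rd_adjr hy). Qed.
Lemma conj_psa x y : M y -> psa x -> psa (conj_by y x).
Proof.
move=> My [hx sx px]; have hy := M_bo hM My; split.
- by apply: bo_comp => //; apply: bo_comp => //; exact: bo_adj.
- by move=> a b /=; rewrite -(rd_adjr hy) sx -(rd_adj hy).
- by move=> a; rewrite conj_rd.
Qed.

(** [is_gns] ties norms to weights of squares; this polarization writes [y^* x y] by two squares and
    leads to [pi_form]. *)
Lemma sq_conj_add x y : M x -> psa x -> M y ->
  sq ((x + idfun) \o y) = sq ((x - idfun) \o y) + 4%:C *: conj_by y x.
Proof.
move=> Mx px My; have Mi := M_id hM; have [hx sx p0] := px.
have M1 : M ((x + idfun) \o y) by apply: (M_comp hM) => //; exact: M_add.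
have M2 : M ((x - idfun) \o y) by apply: (M_comp hM) => //; exact: M_sub.
have pc : psa (4%:C *: conj_by y x) by apply: psaZ => //; exact: conj_psa.
apply: psa_eq; [exact: (sq_psa hM)|by apply: psaD => //; exact: (sq_psa hM)|move=> a].
rewrite [in RHS]opE [in RHS]rdDl [in RHS]opE rdZl conj_rd // !(sqE hM) //= !opE !rdE /= (rdC (y a) (x _)); ring.
Qed.

Lemma pi_form x y : M x -> psa x -> nphi y ->
  phi (conj_by y x) = (rd (pi x (Lambda y)) (Lambda y))%:E.
Proof.
move=> Mx px ny; have Mi := M_id hM; have My := n_M ny.
have M1 : M (x + idfun) by exact: M_add.
have M2 : M (x - idfun) by exact: M_sub.
have n1 : nphi ((x + idfun) \o y) by exact: (n_comp hM hphi).
have n2 : nphi ((x - idfun) \o y) by exact: (n_comp hM hphi).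
have Mc : M (conj_by y x) by exact: conj_M.
have pc : psa (conj_by y x) by exact: conj_psa.
have := congr1 phi (sq_conj_add Mx px My).
have h4 : (0 : R) <= 4 by [].
have M4 : M (4%:C *: conj_by y x) by apply: M_scale.
have q2 := M_sq hM (n_M n2); have p2 := sq_psa hM (n_M n2).
have p4 : psa (4%:C *: conj_by y x) by exact: psaZ.
rewrite (phiD hM hphi) //.
have e1 : Lambda ((x + idfun) \o y) = pi x (Lambda y) + Lambda y by rewrite -pi_L // pi_add // pi_id.
have e2 : Lambda ((x - idfun) \o y) = pi x (Lambda y) - Lambda y by rewrite -pi_L // pi_sub // pi_id.
rewrite (phiZ hM hphi) // (Lam_phi n1) (Lam_phi n2) e1 e2.
rewrite !rdE (rdC (Lambda y)) => h.
have : phi (conj_by y x) \is a fin_num.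
  rewrite ge0_fin_numE ?(phi_ge0 hM hphi) //.
  rewrite ltNge; apply/negP; rewrite leye_eq => /eqP h'; move: h; rewrite h'.
  by rewrite mulry gtr0_sg // mul1e addey.
move=> fc; move: h; rewrite -(fineK fc) -EFinM -EFinD => -[h]; congr (_%:E).
move: h; rewrite /= ; lra.
Qed.

Lemma rd_tot_ge0 (D : set K) (T : K -> K) : tot D -> bo T ->
  (forall d, D d -> 0 <= rd (T d) d) -> pos T.
Proof.
move=> tD hT h; have := @ole_tot R K D 0 T tD (@bo_zero R K) hT.
move=> /(_ _)h2 a; have := h2 _ a; rewrite rd0l; apply=> d Dd; rewrite rd0l; exact: h.
Qed.

(** That [pi] respects adjoints is no clause of [is_gns]. For self-adjoint [x] the elements
    [(x + i) y] and [(x - i) y] have the same square, so their vectors have the same norm, and this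
    norm identity says that the form of [pi x] is real. *)
Lemma pi_sa x : M x -> sa x -> sa (pi x).
Proof.
move=> Mx sx; have hp := pi_bo Mx; apply: sa_of_im; first exact: bo_lin.
have Mi := M_id hM; have hi := @bo_id R H.
have dense0 y : nphi y -> rd (pi x (Lambda y)) ('i%C *: Lambda y) = 0.
  move=> ny; have My := n_M ny.
  have Mci : M ('i%C *: idfun) by exact: M_scale.
  have M1 : M (x + 'i%C *: idfun) by exact: M_add.
  have M2 : M (x - 'i%C *: idfun) by exact: M_sub.
  have n1 : nphi ((x + 'i%C *: idfun) \o y) by exact: (n_comp hM hphi).
  have n2 : nphi ((x - 'i%C *: idfun) \o y) by exact: (n_comp hM hphi).
  have e : sq ((x + 'i%C *: idfun) \o y) = sq ((x - 'i%C *: idfun) \o y).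
    apply: psa_eq; [apply: (sq_psa hM); exact: n_M n1|apply: (sq_psa hM); exact: n_M n2|move=> a].
    rewrite !(sqE hM); [|exact: n_M n2|exact: n_M n1].
    have z : rd (x (y a)) ('i%C *: y a) = 0.
      have := sx (y a) ('i%C *: y a); rewrite (boZ (M_bo hM Mx)).
      have -> : rd (y a) ('i%C *: x (y a)) = - rd (x (y a)) ('i%C *: y a).
        by rewrite -rdiC rdC.
      lra.
    rewrite /= !opE /= !rdE (rdC ('i%C *: y a) (x (y a))) z; ring.
  have e1 : Lambda ((x + 'i%C *: idfun) \o y) = pi x (Lambda y) + 'i%C *: Lambda y.
    by rewrite -pi_L // pi_add // pi_scale // pi_id.
  have e2 : Lambda ((x - 'i%C *: idfun) \o y) = pi x (Lambda y) - 'i%C *: Lambda y.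
    by rewrite -pi_L // pi_sub // pi_scale // pi_id.
  have := Lam_rd n1; rewrite e -Lam_rd // e1 e2.
  rewrite !rdE (rdC ('i%C *: Lambda y)); lra.
move=> k; have [u uD uk] := tot_seq k totL.
have : rd (pi x (u n)) ('i%C *: u n) @[n --> \oo] --> rd (pi x k) ('i%C *: k).
  by apply: rd_cvg; [exact: bo_scvg|exact: scvgi].
have -> : (fun n => rd (pi x (u n)) ('i%C *: u n)) = fun=> 0.
  by apply: funext => n; have [y ny <-] := uD n; exact: dense0.
by move=> /(cvg_unique _ (cvg_cst _)) => /(_ _) <-.
Qed.

Lemma pi_psa x : M x -> psa x -> psa (pi x).
Proof.
move=> Mx px; have [hx sx p0] := px; split; [exact: pi_bo|exact: pi_sa|].
apply: (rd_tot_ge0 totL) => [|_ [y ny <-]]; first exact: pi_bo.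
rewrite -lee_fin -pi_form //; apply: (phi_ge0 hM hphi).
  by apply: conj_M => //; exact: n_M ny.
by apply: conj_psa => //; exact: n_M ny.
Qed.

Lemma pi_adj x : M x -> pi (adj x) = adj (pi x).
Proof.
move=> Mx; have [x1 [x2 [M1 M2 s1 s2 ->]]] := M_re hM Mx.
have h1 := M_bo hM M1; have h2 := M_bo hM M2; have Mi2 := M_scale hM 'i%C M2.
have b1 := pi_bo M1; have b2 := pi_bo M2.
rewrite (adjD h1 (bo_scale _ h2)) (adji h2) (sa_adj h1 s1) (sa_adj h2 s2).
rewrite !pi_add ?pi_scale //; last exact: M_scale.
rewrite (adjD b1 (bo_scale _ b2)) (adji b2) !sa_adj //; exact: pi_sa.
Qed.

(** If [pi x = 0], faithfulness of [phi] kills every [x \o e n], and the approximate unit tends to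
    [1]. *)
Lemma pi_inj x : M x -> pi x = 0 -> x = 0.
Proof.
move=> Mx h; have [e [fe e1 _ ec]] := approx_unit hM hphi.
apply: funext => a.
have : scvg \oo (x \o (fun n => e n a)) (x a) by apply: bo_scvg (ec a); exact: (M_bo hM Mx).
have -> : x \o (fun n => e n a) = fun=> 0.
  apply: funext => n /=; have [Me pe fe'] := fe n.
  have ne : nphi (e n) by exact: (n_psa hM hphi).
  have : x \o e n = 0.
    by apply: Lam_eq0; [exact: (n_comp hM hphi)|rewrite -pi_L // h].
  by move=> /(congr1 (fun f => f a)).
by move=> h0; apply: (scvg_uniq h0); exact: scvg_cst.
Qed.

Lemma pi_inj2 x y : M x -> M y -> pi x = pi y -> x = y.
Proof.
move=> Mx My h; apply/eqP; rewrite -subr_eq0; apply/eqP; apply: pi_inj; first exact: M_sub.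
by rewrite pi_sub // h subrr.
Qed.

Lemma psa_anti {L : hilbert R} (x y : L -> L) : psa x -> psa y -> ole x y -> ole y x -> x = y.
Proof. by move=> px py xy yx; apply: psa_eq => // a; apply/eqP; rewrite eq_le xy yx. Qed.

(** The limit [T] of the [pi (x n)] lies below [pi y]. Conversely the form of [pi y] at [Lambda z]
    is [phi (z^* y z)], which normality of [phi] bounds by the values of [T]. *)
Lemma pi_lim (x : nat -> H -> H) y : (forall n, M (x n) /\ psa (x n)) -> bo y ->
  (forall n, ole (x n) (x n.+1)) -> (forall a, scvg \oo (fun n => x n a) (y a)) ->
  forall k, scvg \oo (fun n => pi (x n) k) (pi y k).
Proof.
move=> hx hy mx xy; have [My py _ _ _] := range_sup hM hx hy mx xy.
have le_y n : ole (x n) y.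
  have mono n1 m : (n1 <= m)%N -> ole (x n1) (x m).
    move=> nm; rewrite -(subnK nm); elim: (m - n1)%N => [|k IH]; first exact: ole_refl.
    by rewrite addSn; apply: ole_trans IH (mx _).
  move=> a; have lim_rd : rd (x m a) a @[m --> \oo] --> rd (y a) a.
    by apply: rd_cvg; [exact: xy|exact: scvg_cst].
  have /cvgP/nondecreasing_cvgn_le := lim_rd.
  by rewrite (cvg_lim _ lim_rd) //; apply=> k m km; exact: mono.
have pmono z w : M z -> psa z -> M w -> psa w -> ole z w -> ole (pi z) (pi w).
  move=> Mz pz Mw pw zw; apply/posB; rewrite -pi_sub //.
  by have [_ _] := pi_psa (M_sub hM Mw Mz) (psaB pz pw zw).
have ppi n : psa (pi (x n)) by have [? ?] := hx n; exact: pi_psa.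
have [C C0 hC] := bo_bnd (pi_bo My).
have [n l||T [hT sT pT xT leT]] := @mono_lim R K (fun n => pi (x n)) C C0 ppi.
- by have [? ?] := hx n; have [? ?] := hx n.+1; exact: pmono.
- move=> n l; have [Mn pn] := hx n; apply: le_trans (pmono _ _ Mn pn My py (le_y n) l) _.
  by apply: le_trans (rd_le _ _) _; rewrite -nr2 expr2 mulrA ler_wpM2r ?nr_ge0 //.
suff -> : pi y = T by [].
have pTT : psa T by split.
apply: psa_anti => //; first exact: pi_psa.
  apply: (ole_tot totL) => //; first exact: pi_bo.
  move=> _ [z nz <-]; have Mz := n_M nz.
  rewrite -lee_fin -pi_form //.
  apply: (@phi_lim _ _ _ _ hM hphi (fun n => conj_by z (x n))).
  - by move=> n; have [? ?] := hx n; split; [exact: conj_M|exact: conj_psa].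
  - by have [] := conj_psa Mz py.
  - by move=> n a; rewrite !conj_rd //; exact: mx.
  - by move=> a; apply: (@bo_scvg _ _ _ _ _ (adj z) (fun n => x n (z a))); [exact: (bo_adj (M_bo hM Mz))|exact: xy].
  - move=> n; have [Mn pn] := hx n; rewrite pi_form // lee_fin; exact: leT.
move=> k; apply: (@cvg_ub _ _ \oo _ (fun n => rd (pi (x n) k) k)).
  by move=> n; have [? ?] := hx n; exact: pmono.
by apply: rd_cvg; [exact: xT|exact: scvg_cst].
Qed.

End Gns.

(** * Comparison of strong convergence in two normal representations *)

Section NormalRep.
Context {R : realType} {H : hilbert R} (M : set (op H)).
Hypothesis hM : von_neumann_algebra M.
Implicit Types (x y z : H -> H).

(** Kept abstract so that the comparison can be run from [pi] to the identity representation and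
    back. The fourth clause is what multiplicativity and the adjoint mean for norms of vectors. *)
Definition normal_rep {L : hilbert R} (rho : (H -> H) -> (L -> L)) : Prop :=
  [/\ forall x, M x -> psa x -> psa (rho x),
      forall x y, M x -> M y -> rho (x + y) = rho x + rho y,
      forall (c : R) x, M x -> rho (c%:C *: x) = c%:C *: rho x,
      forall x, M x -> forall l, rd (rho (sq x) l) l = rd (rho x l) (rho x l) &
      forall (x : nat -> H -> H) y, (forall n, M (x n) /\ psa (x n)) -> bo y ->
        (forall n, ole (x n) (x n.+1)) -> (forall a, scvg \oo (fun n => x n a) (y a)) ->
        forall l, scvg \oo (fun n => rho (x n) l) (rho y l)].

Context {L1 L2 : hilbert R} (rho1 : (H -> H) -> (L1 -> L1)) (rho2 : (H -> H) -> (L2 -> L2)).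
Hypothesis h1 : normal_rep rho1.
Hypothesis h2 : normal_rep rho2.
Hypothesis inj1 : forall x, M x -> psa x -> rho1 x = 0 -> x = 0.

Lemma rho_mono {L : hilbert R} (rho : (H -> H) -> (L -> L)) x y : normal_rep rho ->
  M x -> psa x -> M y -> psa y -> ole x y -> ole (rho x) (rho y).
Proof.
move=> [p a _ _ _] Mx px My py xy l.
have [_ _ h] := p _ (M_sub hM My Mx) (psaB px py xy).
have -> : y = (y - x) + x by rewrite subrK.
by rewrite a ?opE ?rdDl ?lerDr //; exact: M_sub.
Qed.

Lemma rho_0 {L : hilbert R} (rho : (H -> H) -> (L -> L)) : normal_rep rho -> rho 0 = 0.
Proof.
move=> [_ a _ _ _]; have := a 0 0 (M_0 hM) (M_0 hM); rewrite addr0 => /eqP.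
by rewrite -subr_eq0 opprD addrA subrr sub0r oppr_eq0 => /eqP.
Qed.

(* A noncommutative Egorov theorem: a fast subsequence of [d] lies below a decreasing sequence [2 G_n] with
   infimum 0, where [1 - G_n = inf_m (1 + d_n + ... + d_m)^-1]. *)
Lemma egorov (d : nat -> H -> H) : (forall n, [/\ M (d n), psa (d n) & ole (d n) idfun]) ->
  (forall l, rd (rho1 (d n) l) l @[n --> \oo] --> (0 : R)) ->
  forall l (e : R), 0 < e -> exists n, rd (rho2 (d n) l) l <= e.
Proof.
move=> hd d0 l e e0; have [p1 a1 _ _ lim1] := h1; have [p2 a2 _ _ lim2] := h2.
have [xi txi _] := @tot_setT R L1.
pose f j x := rd (rho1 x (xi j)) (xi j).
have fD j x y : M x -> M y -> f j (x + y) = f j x + f j y.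
  by move=> Mx My; rewrite /f a1 // opE rdDl.
have fmono j x y : M x -> psa x -> M y -> psa y -> ole x y -> f j x <= f j y.
  by move=> *; exact: (rho_mono h1).
(* A fast subsequence: the test vectors [xi j] with [j <= k] see [d (s k)] below [2^-k], so that the
   sums starting at [n] are seen below [2 * 2^-n] for [j <= n]. *)
have /choice[s sP] (k : nat) : exists n, forall j, (j <= k)%N -> f j (d n) <= (2^-1) ^+ k.
  have e1 : (0 : R) < (2^-1) ^+ k by rewrite exprn_gt0 // invr_gt0.
  suff /filter_ex : \forall n \near \oo, forall j, (j <= k)%N -> f j (d n) <= (2^-1) ^+ k by [].
  have hj j : \forall n \near \oo, f j (d n) <= (2^-1) ^+ k.
    have /cvgrPdist_le/(_ _ e1) := d0 (xi j); apply: filterS => n.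
    by rewrite sub0r normrN => /ler_normlW.
  suff hk m : \forall n \near \oo, forall j, (j <= m)%N -> f j (d n) <= (2^-1) ^+ k by exact: hk.
  elim: m => [|m IH]; first by apply: filterS (hj 0%N) => n h [|j].
  apply: filterS2 IH (hj m.+1) => n h h' j; rewrite leq_eqVlt => /orP[/eqP -> //|].
  by rewrite ltnS; exact: h.
pose S n m := \sum_(n <= k < m) d (s k).
have MS n m : M (S n m) /\ psa (S n m).
  rewrite /S; apply: (big_ind (fun x => M x /\ psa x)).
  - by split; [exact: M_0|exact: psa0].
  - by move=> x y [? ?] [? ?]; split; [exact: M_add|exact: psaD].
  - by move=> k _; have [? ? _] := hd (s k).
have Sr n m : (n <= m)%N -> S n m.+1 = S n m + d (s m) by move=> nm; rewrite /S big_nat_recr.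
have Sm n m : ole (S n m) (S n m.+1).
  have [nm|nm] := leqP n m; last first.
    by rewrite /S !big_geq ?(ltnW nm) //; exact: ole_refl.
  by rewrite Sr // => a; rewrite opE rdDl lerDl; have [_ [_ _ ->]] := hd (s m).
have Sn n m : ole (S n.+1 m) (S n m).
  have [nm|nm] := ltnP n m; last first.
    by rewrite /S !big_geq ?(leqW nm) //; exact: ole_refl.
  rewrite /S (big_ltn nm) => a; rewrite opE rdDl lerDr; have [_ [_ _]] := hd (s n); exact.
(* The sums of the [d (s k)] may be unbounded as operators; their cut-offs stay below [1] and still
   increase with [m]. *)
pose g n m := cutf (S n m).
have Mg n m : M (g n m) /\ psa (g n m).
  by have [? ?] := MS n m; split; [exact: M_cut|exact: cut_psa].
have gm n m : ole (g n m) (g n m.+1).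
  by have [_ ?] := MS n m; have [_ ?] := MS n m.+1; exact: cut_mono.
have g1 n m : ole (g n m) idfun by have [_ ?] := MS n m; exact: cut_le1.
have /choice[G GP] (n : nat) : exists y, [/\ M y /\ psa y, ole y idfun,
    forall a, scvg \oo (fun m => g n m a) (y a) & forall m, ole (g n m) y].
  have [|y [hy sy py gy le_y]] := @mono_lim R H (g n) 1 ler01 (fun m => (Mg n m).2) (gm n).
    by move=> m a; rewrite mul1r; exact: g1.
  exists y; split=> //; first by split=> //; apply: M_lim (gy) => // m; case: (Mg n m).
  move=> a; apply: (@cvg_ub _ nat \oo _ (fun m => rd (g n m a) a)); first by move=> m; exact: g1.
  by apply: rd_cvg; [exact: gy|exact: scvg_cst].
have GS n : ole (G n.+1) (G n).
  have [_ _ gy _] := GP n.+1; have [_ _ _ leG] := GP n.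
  move=> a; apply: (@cvg_ub _ nat \oo _ (fun m => rd (g n.+1 m a) a)).
    move=> m; apply: le_trans (leG m a); apply: cut_mono; [by case: (MS n.+1 m)|by case: (MS n m)|exact: Sn].
  by apply: rd_cvg; [exact: gy|exact: scvg_cst].
have fS j n m : (j <= n)%N -> f j (S n m) <= 2 * (2^-1) ^+ n.
  move=> jn; have [nm|nm] := leqP n m; last first.
    rewrite /S big_geq; last exact: ltnW.
    by rewrite /f (rho_0 h1) rd0l mulr_ge0 // exprn_ge0 // invr_ge0.
  suff : f j (S n m) <= 2 * (2^-1) ^+ n - 2 * (2^-1) ^+ m.
    move=> h; apply: le_trans h _; rewrite gerDl oppr_le0 mulr_ge0 // exprn_ge0 // invr_ge0 //.
  rewrite -(subnKC nm); elim: (m - n)%N => [|k IH].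
    by rewrite addn0 subrr /S big_geq // /f (rho_0 h1) rd0l.
  rewrite addnS Sr ?leq_addr // fD; [|by case: (MS n (n + k))|by case: (hd (s (n + k)))].
  have := sP (n + k)%N j (leq_trans jn (leq_addr _ _)); rewrite exprS.
  set q := _ ^+ (n + k); move: IH; rewrite -/q; lra.
have fG j n : (j <= n)%N -> f j (G n) <= 2 * (2^-1) ^+ n.
  move=> jn; have [[MG [hG _ _]] _ gG _] := GP n.
  apply: (@cvg_ub _ nat \oo _ (fun m => f j (g n m))).
    move=> m; apply: le_trans (fS j n m jn); have [? ?] := MS n m; have [? ?] := Mg n m.
    by apply: fmono => //; exact: cut_le.
  apply: rd_cvg; last exact: scvg_cst.
  by apply: lim1 => //; exact: Mg.
pose h n := idfun - G n.
have Mh n : M (h n) /\ psa (h n).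
  have [[MG pG] G1 _ _] := GP n; split; first by apply: M_sub => //; exact: M_id.
  by apply: psaB => //; exact: psa_id.
have hm n : ole (h n) (h n.+1).
  by move=> a; rewrite /h !opE !rdE lerD2l lerN2; exact: GS.
have hle1 n : ole (h n) idfun.
  by move=> a; rewrite /h !opE !rdE gerDl oppr_le0; have [[_ [_ _ p]] _ _ _] := GP n; exact: p.
have [|y [hy sy py hcv le_y]] := @mono_lim R H h 1 ler01 (fun m => (Mh m).2) hm.
  by move=> m a; rewrite mul1r; exact: hle1.
have My : M y by apply: M_lim (hcv) => // m; case: (Mh m).
have ppy : psa y by split.
have y1 : ole y idfun.
  move=> a; apply: (@cvg_ub _ nat \oo _ (fun m => rd (h m a) a)); first by move=> m; exact: hle1.
  by apply: rd_cvg; [exact: hcv|exact: scvg_cst].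
have pq : psa (idfun - y) by apply: psaB => //; exact: psa_id.
have Mq : M (idfun - y) by apply: M_sub => //; exact: M_id.
have q0 : idfun - y = 0.
  apply: inj1 => //; have [b1 s1 P1] := p1 _ Mq pq.
  apply: pos_eq0 => //.
  have le0 : ole (rho1 (idfun - y)) 0.
    apply: (ole_tot txi) => //; first exact: bo_zero.
    move=> _ [j _ <-]; rewrite rd0l -/(f j _).
    apply/ler_addgt0Pr => r r0; rewrite add0r.
    have : 2 * (2^-1) ^+ n @[n --> \oo] --> (0 : R).
      by apply: cvg0M; apply: cvg_expr; rewrite ger0_norm ?invr_ge0 // invf_lt1 // ltr1n.
    move=> /cvgrPdist_le/(_ r r0)[N _ /(_ (maxn N j) (leq_maxl _ _))] /=.
    rewrite sub0r normrN => /ler_normlW; apply: le_trans; apply: le_trans (fG j _ (leq_maxr N j)).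
    have [[MG pG] _ _ _] := GP (maxn N j).
    apply: fmono => // a; rewrite !opE !rdE; have := le_y (maxn N j) a; rewrite /h !opE !rdE; lra.
  by move=> a; apply/eqP; rewrite eq_le P1 andbT; have := le0 a; rewrite rd0l.
have y_id : y = idfun by apply/esym/eqP; rewrite -subr_eq0 q0.
have rh : scvg \oo (fun n => rho2 (h n) l) (rho2 idfun l).
  by apply: lim2 => //; [exact: bo_id|move=> a; rewrite -y_id; exact: hcv].
have rh2 : rd (rho2 (h n) l) l @[n --> \oo] --> rd (rho2 idfun l) l.
  by apply: rd_cvg => //; exact: scvg_cst.
have e2 : 0 < e / 2 by rewrite divr_gt0.
have /cvgrPdist_le/(_ _ e2)/filter_ex[n hn] := rh2.
(* Now [rho2 (G n)] is small at [l], and [cut_half] gives [d (s n) <= 2 G n] from the first term of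
   the sum. *)
exists (s n); have [[MG pG] _ _ leG] := GP n; have [Md pd d1] := hd (s n).
have dG : ole (d (s n)) (G n + G n).
  move=> a; have [_ pS] := MS n n.+1; have dS : ole (d (s n)) (S n n.+1).
    by move=> b; rewrite /S big_nat1.
  have := cut_half pS pd dS d1 a; have := leG n.+1 a; rewrite opE rdDl /g; lra.
have := rho_mono h2 Md pd (M_add hM MG MG) (psaD pG pG) dG l.
have : rho2 idfun = rho2 (h n) + rho2 (G n).
  by rewrite -a2 ?/h ?subrK //; case: (Mh n).
rewrite a2 // !opE rdDl => E; move: hn; rewrite E opE rdDl addrAC subrr add0r => /ler_normlW; lra.
Qed.

(** [egorov] for multiples of [x n^* x n]; the factor uses [C + 1] so that it exists for [C = 0].
    One index in the conclusion is enough, because the sequence fed in may start arbitrarily late or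
    be chosen for a contradiction. *)
Lemma egorov_op (x : nat -> H -> H) (C : R) : 0 <= C -> (forall n, M (x n) /\ bnd C (x n)) ->
  (forall l, scvg \oo (fun n => rho1 (x n) l) 0) ->
  forall l (e : R), 0 < e -> exists n, nr (rho2 (x n) l) <= e.
Proof.
move=> C0 hx x0 l e e0; have [_ _ Z1 q1 _] := h1; have [_ _ Z2 q2 _] := h2.
have C1 : 0 < (C + 1) ^- 2 by rewrite invr_gt0 exprn_gt0 // ltr_wpDl.
pose d n := ((C + 1) ^- 2)%:C *: sq (x n).
have [n|l'||n hn] := @egorov d _ _ l ((C + 1) ^- 2 * e ^+ 2).
- have [Mx bx] := hx n; split.
  + by apply: M_scale => //; exact: M_sq.
  + by apply: psaZ; [exact: ltW|exact: (sq_psa hM)].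
  move=> a; rewrite /d opE rdZl (sqE hM) // -!nr2 ler_pdivrMl ?exprn_gt0 ?ltr_wpDl //.
  rewrite -exprMn (@ler_pXn2r _ 2) // ?nnegrE ?mulr_ge0 ?nr_ge0 ?addr_ge0 //.
  by apply: le_trans (bx a) _; rewrite ler_wpM2r ?nr_ge0 // lerDl.
- have -> : (fun n => rd (rho1 (d n) l') l') = fun n => (C + 1) ^- 2 * (nr (rho1 (x n) l') * nr (rho1 (x n) l')).
    by apply: funext => n; have [Mx _] := hx n; rewrite /d Z1 ?opE ?rdZl ?q1 // -?nr2 ?expr2 //; exact: M_sq.
  apply: cvg0M; rewrite -[0%R](mulr0 (0 : R)).
  have := x0 l'; rewrite /scvg; have -> : (fun n => nr (rho1 (x n) l' - 0)) = (fun n => nr (rho1 (x n) l')).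
    by apply: funext => n; rewrite subr0.
  by move=> h; exact: (cvgM h h).
- by rewrite mulr_gt0 // exprn_gt0.
exists n; move: hn; have [Mx _] := hx n.
rewrite /d Z2 ?opE ?rdZl ?q2 //; last exact: M_sq.
by rewrite ler_pM2l // -nr2 (@ler_pXn2r _ 2) // ?nnegrE ?nr_ge0 // ltW.
Qed.

End NormalRep.

(** * Bounded limits, norms and positivity pulled back along the GNS representation *)

Section GnsTopology.
Context {R : realType} {H K : hilbert R} (M : set (op H)) (phi : op H -> \bar R).
Context (Lambda : op H -> K) (pi : op H -> op K).
Hypothesis hM : von_neumann_algebra M.
Hypothesis hphi : fns_weight M phi.
Hypothesis hGNS : is_gns M phi Lambda pi.
Implicit Types (x y z : H -> H) (k l : K).
Local Notation nphi := (nphi M phi).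

Lemma normal_rep_pi : normal_rep M pi.
Proof.
split.
- exact: (pi_psa hM hphi hGNS).
- exact: (pi_add hM hphi hGNS).
- by move=> c x Mx; exact: (pi_scale hM hphi hGNS).
- move=> x Mx l; rewrite /sq (pi_comp hM hphi hGNS) ?(pi_adj hM hphi hGNS) //=; last exact: (M_adj hM).
  by rewrite -(rd_adjr (pi_bo hGNS Mx)).
- exact: (pi_lim hM hphi hGNS).
Qed.

Lemma normal_rep_id : normal_rep M (fun x => x).
Proof. by split=> // x Mx l; rewrite (sqE hM). Qed.

(** Sequential form of the closedness of [pi M]. Comparison from [pi] to the identity makes [c]
    strongly Cauchy on [H]; comparison from the identity to [pi] identifies the limit on [K]. *)
Lemma pi_closed (c : nat -> H -> H) (C : R) : 0 <= C -> (forall n, M (c n) /\ bnd C (c n)) ->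
  (forall k, exists l, scvg \oo (fun n => pi (c n) k) l) ->
  exists y, [/\ M y, bnd C y, forall a, scvg \oo (fun n => c n a) (y a) &
    forall k, scvg \oo (fun n => pi (c n) k) (pi y k)].
Proof.
move=> C0 hc hk; have [|||y [hy by_ cy]] := @bo_lim R H nat \oo _ c C C0.
- by move=> n; apply: bo_lin; apply: (M_bo hM); case: (hc n).
- by move=> n; case: (hc n).
- move=> a; apply: scvg_complete => e e0; apply: contrapT => hN.
  have /choice[p pP] N : exists p : nat * nat, [/\ (N <= p.1)%N, (N <= p.2)%N & e < nr (c p.1 a - c p.2 a)].
    apply: contrapT => h; apply: hN; exists N => n m Nn Nm.
    by rewrite leNgt; apply/negP => h'; apply: h; exists (n, m).
  have [||||n] := egorov_op hM normal_rep_pi normal_rep_id _ (x := fun N => c (p N).1 - c (p N).2) (C := C + C) _ _ _ a e0.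
  + by move=> x Mx _; exact: (pi_inj hM hphi hGNS).
  + exact: addr_ge0.
  + move=> N; have [M1 b1] := hc (p N).1; have [M2 b2] := hc (p N).2; split; first exact: M_sub.
    by move=> b; rewrite !opE mulrDl; apply: le_trans (nrD _ _) _; rewrite nrN lerD.
  + move=> l; have [l' hl'] := hk l; apply/scvgP => r r0.
    have r2 : 0 < r / 2 by rewrite divr_gt0.
    have /scvgP/(_ _ r2)[N0 _ hN0] := hl'; exists N0 => // N /= NN.
    have [N1 N2 _] := pP N; have [M1 _] := hc (p N).1; have [M2 _] := hc (p N).2.
    rewrite subr0 (pi_sub hM hphi hGNS) // !opE.
    have := hN0 _ (leq_trans NN N1); have := hN0 _ (leq_trans NN N2) => /=.
    have -> : pi (c (p N).1) l - pi (c (p N).2) l = (pi (c (p N).1) l - l') - (pi (c (p N).2) l - l') by hring.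
    have := nrD (pi (c (p N).1) l - l') (- (pi (c (p N).2) l - l')); rewrite nrN; lra.
  by rewrite !opE leNgt; have [_ _ ->] := pP n.
have My : M y by apply: (M_lim hM) (cy) => // n; case: (hc n).
exists y; split=> // k; have [l hl] := hk k; suff -> : pi y k = l by [].
apply: subr0_eq; apply: nr_eq0; apply/eqP; rewrite eq_le nr_ge0 andbT; apply/ler_addgt0Pr => e e0; rewrite add0r.
have e2 : 0 < e / 2 by rewrite divr_gt0.
have /scvgP/(_ _ e2)[N _ hN] := hl.
have [||||n] := egorov_op hM normal_rep_id normal_rep_pi _ (x := fun n => c (n + N)%N - y) (C := C + C) _ _ _ k e2.
- by [].
- exact: addr_ge0.
- move=> n; have [M1 b1] := hc (n + N)%N; split; first exact: M_sub.
  by move=> b; rewrite !opE mulrDl; apply: le_trans (nrD _ _) _; rewrite nrN lerD.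
- move=> a; have /scvgP ha := cy a; apply/scvgP => r /ha[N1 _ hN1]; exists N1 => // n /= nN.
  by rewrite subr0 !opE; apply: hN1 => /=; apply: leq_trans nN (leq_addr _ _).
have [M1 b1] := hc (n + N)%N; rewrite (pi_sub hM hphi hGNS) // !opE nrB.
have := hN (n + N)%N (leq_addl _ _) => /=.
have -> : pi y k - l = (pi y k - pi (c (n + N)%N) k) + (pi (c (n + N)%N) k - l) by hring.
have := nrD (pi y k - pi (c (n + N)%N) k) (pi (c (n + N)%N) k - l); lra.
Qed.

Lemma bo_iter {L : hilbert R} (x : L -> L) n : bo x -> bo (iter n x).
Proof.
move=> hx; elim: n => [|n IH]; first exact: bo_id.
exact: (@bo_comp R L x (iter n x) hx IH).
Qed.
Lemma M_iter x n : M x -> M (iter n x).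
Proof.
move=> Mx; elim: n => [|n IH]; first exact: (M_id hM).
exact: (M_comp hM Mx IH).
Qed.
Lemma sa_iter {L : hilbert R} (x : L -> L) n : sa x -> sa (iter n x).
Proof. by move=> sx; elim: n => [|n IH] // a b; rewrite iterS sx IH -iterSr. Qed.
Lemma pi_iter x n : M x -> pi (iter n x) = iter n (pi x).
Proof.
move=> Mx; elim: n => [|n IH]; first by change (pi idfun = idfun); exact: (pi_id hM hGNS).
have -> : iter n.+1 x = x \o iter n x by [].
by rewrite (pi_comp hM hphi hGNS) ?IH //; exact: M_iter.
Qed.
Lemma bnd_iter {L : hilbert R} (x : L -> L) q n : 0 <= q -> bnd q x -> bnd (q ^+ n) (iter n x).
Proof.
move=> q0 hq; elim: n => [|n IH] a; first by rewrite expr0 mul1r.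
by rewrite iterS exprS -mulrA; apply: le_trans (hq _) _; rewrite ler_wpM2l.
Qed.

(* [1 - a^2] is the infimum of [(1 + a^2 + ... + a^(2n))^-1]: this is checked after applying [pi]. *)
Lemma pi_contr a q : M a -> sa a -> 0 <= q < 1 -> bnd q (pi a) -> bnd 1 a.
Proof.
move=> Ma sa_a /andP[q0 q1] hq; have ha := M_bo hM Ma.
pose p n := iter n.+1 a \o iter n.+1 a.
have Mp n : M (p n) /\ psa (p n).
  have Mn := M_iter n.+1 Ma; split; first exact: M_comp.
  by apply: psa_sqs; [exact: (M_bo hM)|exact: sa_iter].
have pS n b : a (a (p n b)) = p n.+1 b.
  by rewrite /p /= -!iterS -!iterSr.
pose t n := \sum_(0 <= j < n) p j.
have tS n : t n.+1 = t n + p n by rewrite /t big_nat_recr.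
have Mt n : M (t n) /\ psa (t n).
  rewrite /t; apply: (big_ind (fun x => M x /\ psa x)) => //.
  - by split; [exact: M_0|exact: psa0].
  - by move=> x y [? ?] [? ?]; split; [exact: M_add|exact: psaD].
have tm n : ole (t n) (t n.+1).
  by move=> b; rewrite tS opE rdDl lerDl; have [_ [_ _ ->]] := Mp n.
pose x n := cutf (t n).
have Mx n : M (x n) /\ psa (x n) by have [? ?] := Mt n; split; [exact: M_cut|exact: cut_psa].
have xm n : ole (x n) (x n.+1) by have [_ ?] := Mt n; have [_ ?] := Mt n.+1; exact: cut_mono.
have x1 n : ole (x n) idfun by have [_ ?] := Mt n; exact: cut_le1.
have [|y [hy sy py xy le_y]] := @mono_lim R H x 1 ler01 (fun m => (Mx m).2) xm.
  by move=> m b; rewrite mul1r; exact: x1.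
have My : M y by apply: (M_lim hM) (xy) => // n; case: (Mx n).
have y1 : ole y idfun.
  move=> b; apply: (@cvg_ub _ nat \oo _ (fun m => rd (x m b) b)); first by move=> m; exact: x1.
  by apply: rd_cvg; [exact: xy|exact: scvg_cst].
have piy := pi_lim hM hphi hGNS Mx hy xm xy.
have tel n b : (b + t n b) - a (a (b + t n b)) = b - p n b.
  elim: n => [|n IH].
    by rewrite /t big_geq // !addr0.
  rewrite tS opE !(boD ha) pS; move: IH; rewrite !(boD ha) => IH.
  have -> : b + (t n b + p n b) - (a (a b) + (a (a (t n b)) + p n.+1 b)) =
    (b + t n b - (a (a b) + a (a (t n b)))) + p n b - p n.+1 b by hring.
  by rewrite IH; hring.
(* The telescoping identity [(1 + t n) (1 - a^2) = 1 - p n] multiplied by [(1 + t n)^-1], which is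
   [idfun - x n]. Under [pi] the last term decays like [q^(2n+2)]. *)
have key n : idfun - (a \o a) = (idfun - x n) - ((idfun - x n) \o p n).
  have [Mtn ptn] := Mt n; have [hr _ rt _] := resP ptn; apply: funext => b.
  rewrite !opE /= !opE /x /= !cutE !subKr /=.
  have tp m d : p n (t m d) = t m (p n d).
    have hp := M_bo hM (Mp n).1.
    elim: m => [|m IH]; first by rewrite /t big_geq //; exact: bo0.
    rewrite tS !opE (boD hp) IH; congr (_ + _).
    have ic i j e : iter i a (iter j a e) = iter j a (iter i a e) by rewrite -!iterD addnC.
    by rewrite /p /comp !(ic n.+1 m.+1).
  have comm : res (t n) (p n b) = p n (res (t n) b).
    by apply/esym; apply: res_comm => //; exact: (M_bo hM (Mp n).1).
  by rewrite comm -tel rt.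
have pib : pi (a \o a) = pi y.
  apply: funext => k.
  have Mi := M_id hM; have Maa := M_comp hM Ma Ma.
  have lim0 : scvg \oo (fun n => pi (idfun - x n) (pi (p n) k)) 0.
    apply: (scvg_le (v := fun n => (q ^+ n.+1) ^+ 2 * nr k)).
      move=> n; rewrite subr0; have [Mtn ptn] := Mt n.
      have b1 : bnd 1 (idfun - x n) by move=> b; rewrite /x /cutf subKr; exact: res_bnd.
      have b2 := pi_bnd hM hphi hGNS (M_sub hM Mi (Mx n).1) ler01 b1.
      apply: le_trans (b2 _) _; rewrite mul1r /p (pi_comp hM hphi hGNS) ?(pi_iter n.+1 Ma); [|exact: M_iter|exact: M_iter].
      have b3 := bnd_iter n.+1 q0 hq; apply: le_trans (b3 _) _.
      by rewrite expr2 -mulrA ler_wpM2l ?exprn_ge0 //; exact: b3.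
    have -> : (fun n => (q ^+ n.+1) ^+ 2 * nr k) = (fun n => (q ^+ 2 * nr k) * (q ^+ 2) ^+ n).
      by apply: funext => n; rewrite -exprM mulnC exprM exprS mulrAC.
    apply: cvg0M; apply: cvg_expr.
    by rewrite ger0_norm ?sqr_ge0 // expr_lt1.
  have E n : pi (a \o a) k = pi (x n) k + pi (idfun - x n) (pi (p n) k).
    have [Mxn _] := Mx n; have [Mpn _] := Mp n; have Mix := M_sub hM Mi Mxn.
    have := congr1 (fun f => pi f k) (key n) => /=.
    rewrite (pi_sub hM hphi hGNS) // (pi_id hM hGNS) (pi_sub hM hphi hGNS) //; last exact: M_comp.
    rewrite (pi_comp hM hphi hGNS Mix Mpn) !opE /=.
    rewrite {1}(pi_sub hM hphi hGNS) // (pi_id hM hGNS) !opE /= => /eqP.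
    move=> /eqP E; rewrite -[LHS](subKr k) E; move: (pi (idfun - x n) _) => z; hring.
  have h : scvg \oo (fun n => pi (x n) k + pi (idfun - x n) (pi (p n) k)) (pi y k + 0).
    by apply: scvgD => //; exact: piy.
  move: h; rewrite addr0.
  have -> : (fun n => pi (x n) k + pi (idfun - x n) (pi (p n) k)) = fun=> pi (a \o a) k.
    by apply: funext => n; rewrite -E.
  by move=> h; apply: (scvg_uniq (F := \oo)) h; exact: scvg_cst.
have e : a \o a = y by apply: (pi_inj2 hM hphi hGNS) => //; exact: M_comp.
move=> b; rewrite mul1r; apply: nr_le; rewrite ?nr_ge0 // nr2.
by rewrite sa_a rdC; have := y1 b; rewrite -e.
Qed.

Lemma pi_iso_sa a q : M a -> sa a -> 0 <= q -> bnd q (pi a) -> bnd q a.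
Proof.
move=> Ma sa_a q0 hq b.
have key r : q < r -> nr (a b) <= r * nr b.
  move=> qr; have r0 : 0 < r by exact: le_lt_trans qr.
  have ri : 0 <= r^-1 by rewrite invr_ge0 ltW.
  have h : bnd 1 (r^-1%:C *: a).
    apply: (@pi_contr _ (r^-1 * q)); [exact: M_scale|exact: saZ| |].
      by rewrite mulr_ge0 //= ltr_pdivrMl // mulr1.
    by move=> k; rewrite (pi_scale hM hphi hGNS) // opE nrZ ger0_norm // -mulrA ler_wpM2l.
  by have := h b; rewrite mul1r opE nrZ ger0_norm // ler_pdivrMl.
apply/ler_addgt0Pr => e e0; have n1 : 0 < nr b + 1 by rewrite ltr_wpDl ?nr_ge0.
have := key (q + e / (nr b + 1)); rewrite ltrDl divr_gt0 // => /(_ isT) /le_trans; apply.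
rewrite mulrDl lerD2l mulrAC ler_pdivrMr // ler_pM2l //; lra.
Qed.

Lemma pi_iso x q : M x -> 0 <= q -> bnd q (pi x) -> bnd q x.
Proof.
move=> Mx q0 hq a; have hx := M_bo hM Mx; have [hs ss _] := psa_sq hx.
have Ms := M_sq hM Mx; have hp := pi_bo hGNS Mx.
have h : bnd (q ^+ 2) (sq x).
  apply: pi_iso_sa => //; first exact: sqr_ge0.
  rewrite /sq (pi_comp hM hphi hGNS) ?(pi_adj hM hphi hGNS) //; last exact: (M_adj hM).
  move=> k /=; apply: le_trans (bnd_adj hp q0 hq _) _.
  by rewrite expr2 -mulrA ler_wpM2l.
apply: nr_le; first by rewrite mulr_ge0 ?nr_ge0.
rewrite -(sqE hM Mx); apply: le_trans (rd_le _ _) _.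
by rewrite exprMn expr2 (expr2 (nr a)) mulrA ler_wpM2r ?nr_ge0 // -expr2; exact: h.
Qed.

Lemma sa_reflect x : M x -> sa (pi x) -> sa x.
Proof.
move=> Mx sx; have hp := pi_bo hGNS Mx; apply: (adj_sa (M_bo hM Mx)).
apply: (pi_inj2 hM hphi hGNS) => //; first exact: (M_adj hM).
by rewrite (pi_adj hM hphi hGNS) // sa_adj.
Qed.

(** After scaling, [0 <= pi y <= 1], so [pi (1 - y)] has norm at most [1]. By [pi_iso] so has
    [1 - y], and [<(1 - y) a, a> <= <a, a>] is positivity of [y]. *)
Lemma pos_reflect x : M x -> psa (pi x) -> psa x.
Proof.
move=> Mx [hp sp pp]; have hx := M_bo hM Mx; have sx := sa_reflect Mx sp.
have [C C0 hC] := bo_bnd hp; have C1 : 0 < C + 1 by rewrite ltr_wpDl.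
pose y := (C + 1)^-1%:C *: x.
have My : M y by exact: M_scale.
have Mi := M_id hM; have piy : pi y = (C + 1)^-1%:C *: pi x by exact: (pi_scale hM hphi hGNS).
have ci : 0 <= (C + 1)^-1 by rewrite invr_ge0 ltW.
have ppy : psa (pi y) by rewrite piy; apply: psaZ.
have y1 : ole (pi y) idfun.
  move=> k; rewrite piy opE rdZl ler_pdivrMl //; apply: le_trans (rd_le _ _) _.
  rewrite /= -nr2 expr2 mulrA ler_wpM2r ?nr_ge0 //; apply: le_trans (hC _) _.
  by rewrite ler_wpM2r ?nr_ge0 // lerDl.
have b1 : bnd 1 (idfun - y).
  apply: pi_iso => //; first exact: M_sub.
  have [b s p] := psaB ppy (@psa_id R K) y1.
  rewrite (pi_sub hM hphi hGNS) // (pi_id hM hGNS).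
  apply: ole_bnd => // k; rewrite mul1r opE opNE rdDl rdNl gerDl oppr_le0.
  by have [_ _] := ppy.
split=> // a; have := le_trans (rd_le _ a) (ler_wpM2r (nr_ge0 a) (b1 a)).
rewrite mul1r -expr2 nr2 opE opNE rdDl rdNl /y opE rdZl gerDl oppr_le0.
by rewrite pmulr_rge0 ?invr_gt0.
Qed.

End GnsTopology.

(** Cauchy-Schwarz with the weights [2^-(j+1)], whose sum is at most [1]. *)
Lemma rd_sum_le {R : realType} {H : hilbert R} J (v : nat -> H) :
  rd (\sum_(0 <= j < J) v j) (\sum_(0 <= j < J) v j) <= \sum_(0 <= j < J) 2 ^+ j.+1 * rd (v j) (v j).
Proof.
elim: J v => [|J IH] v; first by rewrite !big_geq // rd0l.
rewrite !(big_nat_recl _ _ _ (leq0n J)) expr1.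
set w := \sum_(0 <= i < J) v i.+1.
have := IH (fun j => v j.+1); rewrite -/w => h.
apply: (@le_trans _ _ (2 * rd (v 0%N) (v 0%N) + 2 * rd w w)).
  have := rd_ge0 (v 0%N - w); rewrite !rdE (rdC w (v 0%N)); lra.
rewrite lerD2l; apply: (@le_trans _ _ (2 * \sum_(0 <= j < J) 2 ^+ j.+1 * rd (v j.+1) (v j.+1))).
  by rewrite ler_pM2l.
rewrite big_distrr /= le_eqVlt; apply/orP; left; apply/eqP; apply: eq_bigr => i _.
by rewrite mulrA -exprS.
Qed.

(** * Lower semicontinuity of the weight and closedness of the GNS map *)

Section Closed.
Context {R : realType} {H K : hilbert R} (M : set (op H)) (phi : op H -> \bar R).
Context (Lambda : op H -> K) (pi : op H -> op K).
Hypothesis hM : von_neumann_algebra M.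
Hypothesis hphi : fns_weight M phi.
Hypothesis hGNS : is_gns M phi Lambda pi.
Implicit Types (x y z : H -> H) (k l : K).
Local Notation nphi := (nphi M phi).

(** The operators [y (1 + t y)^-1] increase to [y] as [t] decreases to [0]; the sequence
    [t n = 1 / (n + 1)] is fed to normality. *)
Lemma phi_cut_le y (c : \bar R) : M y -> psa y ->
  (forall t : R, 0 < t -> (phi (t^-1%:C *: cutf (t%:C *: y)) <= c)%E) -> (phi y <= c)%E.
Proof.
move=> My py hc; have [hy sy p0] := py.
pose t n : R := n.+1%:R^-1; have t0 n : 0 < t n by rewrite /t invr_gt0.
have pt n : psa ((t n)%:C *: y) by apply: psaZ => //; exact: ltW.
have Mt n : M ((t n)%:C *: y) by exact: M_scale.
have ti n : 0 <= (t n)^-1 by rewrite invr_ge0 ltW.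
pose f n := (t n)^-1%:C *: cutf ((t n)%:C *: y).
have fE n a : rd (f n a) a = rd (y (res ((t n)%:C *: y) a)) (res ((t n)%:C *: y) a) +
    (t n)^-1 * rd (a - res ((t n)%:C *: y) a) (a - res ((t n)%:C *: y) a).
  by rewrite /f opE rdZl cut_eq // opE rdZl mulrDr mulKf // gt_eqF.
apply: (@phi_lim _ _ _ _ hM hphi f) => //.
- by move=> n; split; [apply: M_scale => //; exact: M_cut|apply: psaZ => //; exact: cut_psa].
- move=> n a; rewrite (fE n.+1) /f opE rdZl ler_pdivrMl //.
  apply: le_trans (cut_var (pt n) a (res ((t n.+1)%:C *: y) a)) _.
  rewrite opE rdZl mulrDr lerD2l mulrA -[leLHS]mul1r; apply: ler_wpM2r; first exact: rd_ge0.
  by rewrite /t invrK ler_pdivlMl // mulr1 ler_nat.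
- move=> a; have [C C0 hC] := bo_bnd hy.
  apply: (scvg_le (v := fun n => (C * (C * nr a)) * t n)).
    move=> n; have [_ _ rx _] := resP (pt n).
    have -> : f n a - y a = - ((t n)%:C *: y (y (res ((t n)%:C *: y) a))).
      rewrite /f opE cut_x // opE scalerA -rmorphM /= mulVf ?gt_eqF // scale1r.
      by rewrite -{2}(rx a) opE (boD hy) (boZ hy) opprD addrA subrr sub0r.
    rewrite nrN nrZ ger0_norm ?(ltW (t0 n)) // mulrC; apply: ler_wpM2r; first exact: ltW.
    apply: le_trans (hC _) _; rewrite ler_wpM2l //; apply: le_trans (hC _) _; rewrite ler_wpM2l //.
    by have := res_bnd (pt n) a; rewrite mul1r.
  apply: cvg0M; exact: cvg_harmonic.
- by move=> n; exact: hc.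
Qed.

(** By [rd_sum_le] the squares of the partial sums lie below [s J], a sum of weighted squares whose
    weights are bounded: [2^(j+1) c 8^-j = 2 c 4^-j] sums to less than [4 c]. As operators the [s J]
    may diverge, so both sides are cut off at height [1 / t], where monotone limits exist, and
    [phi_cut_le] removes the cut-off. *)
Lemma phi_series (w : nat -> H -> H) y (c C : R) : 0 <= c -> 0 <= C -> (forall j, nphi (w j)) -> M y ->
  (forall J, bnd C (\sum_(0 <= j < J) w j)) ->
  (forall a, scvg \oo (fun J => (\sum_(0 <= j < J) w j) a) (y a)) ->
  (forall j, rd (Lambda (w j)) (Lambda (w j)) <= c * (8^-1) ^+ j) ->
  (phi (sq y) <= (4 * c)%:E)%E.
Proof.
move=> c0 C0 nw My bY Yy hc.
pose Y J := \sum_(0 <= j < J) w j; rewrite -/(Y _) in bY Yy.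
have Mw j := n_M (nw j).
have MY J : M (Y J) by apply: (big_ind M) => //; [exact: M_0|exact: M_add].
pose s J := \sum_(0 <= j < J) ((2 ^+ j.+1)%:C *: sq (w j)).
have p2 j : (0 : R) <= 2 ^+ j by rewrite exprn_ge0.
have Ms J : M (s J) /\ psa (s J).
  rewrite /s; apply: (big_ind (fun x => M x /\ psa x)) => //.
  - by split; [exact: M_0|exact: psa0].
  - by move=> ? ? [? ?] [? ?]; split; [exact: M_add|exact: psaD].
  - by move=> j _; split; [apply: M_scale => //; exact: M_sq|apply: psaZ => //; exact: (sq_psa hM)].
have sS J : s J.+1 = s J + (2 ^+ J.+1)%:C *: sq (w J) by rewrite /s big_nat_recr.
have YS J : Y J.+1 = Y J + w J by rewrite /Y big_nat_recr.
have sE J b : rd (s J b) b = \sum_(0 <= j < J) 2 ^+ j.+1 * rd (w j b) (w j b).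
  elim: J => [|J IH]; first by rewrite /s !big_geq // rd0l.
  by rewrite sS big_nat_recr //= opE rdDl IH opE rdZl (sqE hM).
have YE J b : Y J b = \sum_(0 <= j < J) w j b.
  elim: J => [|J IH]; first by rewrite /Y !big_geq.
  by rewrite YS big_nat_recr //= opE IH.
have Ys J b : rd (Y J b) (Y J b) <= rd (s J b) b by rewrite YE sE; exact: rd_sum_le.
have phis J : (phi (s J) <= (4 * c)%:E)%E.
  suff : (phi (s J) <= (4 * c * (1 - (4^-1) ^+ J))%:E)%E.
    move=> h; apply: le_trans h _; rewrite lee_fin.
    have q0 : (0 : R) <= 4^-1 ^+ J by rewrite exprn_ge0 // invr_ge0.
    by move: q0; set q := 4^-1 ^+ J => q0; nra.
  elim: J => [|J IH].
    by rewrite /s big_geq // (phi_0 hM hphi) subrr mulr0.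
  have [MsJ psJ] := Ms J; have Mq := M_sq hM (Mw J); have pq := sq_psa hM (Mw J).
  rewrite sS (phiD hM hphi) //; [|exact: M_scale|exact: psaZ].
  rewrite (phiZ hM hphi) // (Lam_phi hM hphi hGNS) //.
  apply: le_trans (leeD2r _ IH) _; rewrite -EFinM -EFinD lee_fin.
  have h : 2 ^+ J.+1 * rd (Lambda (w J)) (Lambda (w J)) <= 2 * c * (4^-1) ^+ J.
    apply: (@le_trans _ _ (2 ^+ J.+1 * (c * 8^-1 ^+ J))); first by rewrite ler_wpM2l.
    have -> : (8^-1 : R) ^+ J = 4^-1 ^+ J * 2^-1 ^+ J by rewrite -exprMn; congr (_ ^+ _); field.
    rewrite exprS (_ : 2 * 2 ^+ J * (c * (4^-1 ^+ J * 2^-1 ^+ J)) = 2 * c * 4^-1 ^+ J * (2 ^+ J * 2^-1 ^+ J)); last by ring.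
    by rewrite -exprMn divff // expr1n mulr1.
  have q0 : (0 : R) <= 4^-1 ^+ J by rewrite exprn_ge0 // invr_ge0.
  have e4 : (4^-1 : R) ^+ J.+1 = 4^-1 * 4^-1 ^+ J by rewrite exprS.
  rewrite e4; move: q0 h (mulr_ge0 c0 q0); set q := 4^-1 ^+ J; set p := _ * rd _ _ => q0 h cq; nra.
have Mqy := M_sq hM My; have pqy := sq_psa hM My.
apply: phi_cut_le => // t t0.
have ti : 0 <= t^-1 by rewrite invr_ge0 ltW.
have pts J : psa (t%:C *: s J) by apply: psaZ; [exact: ltW|case: (Ms J)].
have Mts J : M (t%:C *: s J) by apply: M_scale => //; case: (Ms J).
have pty : psa (t%:C *: sq y) by apply: psaZ => //; exact: ltW.
pose g J := t^-1%:C *: cutf (t%:C *: s J).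
have Mg J : M (g J) /\ psa (g J) by split; [apply: M_scale => //; exact: M_cut|apply: psaZ => //; exact: cut_psa].
have sm J : ole (s J) (s J.+1).
  by move=> a; rewrite sS opE rdDl lerDl opE rdZl mulr_ge0 // (sqE hM) // rd_ge0.
have gm J : ole (g J) (g J.+1).
  move=> a; rewrite /g !opE !rdZl ler_wpM2l //; apply: cut_mono => // b.
  by rewrite !opE !rdZl ler_pM2l //; exact: sm.
have g1 J a : rd (g J a) a <= t^-1 * rd a a.
  by rewrite /g opE rdZl ler_wpM2l //; exact: cut_le1.
have [G [hG sG pG Gg leG]] := mono_lim ti (fun J => (Mg J).2) gm g1.
have MG : M G by apply: (M_lim hM) (Gg) => // J; case: (Mg J).
apply: (@le_trans _ _ (phi G)).
  apply: (phi_mono hM hphi) => //.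
  - by apply: M_scale => //; exact: M_cut (M_scale hM _ Mqy) pty.
  - by apply: psaZ => //; exact: cut_psa.
  move=> a; rewrite opE rdZl ler_pdivrMl //.
  (* The minimizers in [cut_var] for [t s J] converge as [J] grows. They serve as trial vectors for
     [t y^* y], where the comparison of [Y J] with [s J] passes to the limit. *)
  have lim_r : scvg \oo (fun J => res (t%:C *: s J) a) (a - t%:C *: G a).
    have -> : (fun J => res (t%:C *: s J) a) = (fun J => a - t%:C *: g J a).
      apply: funext => J; rewrite /g opE scalerA -rmorphM /= divff ?gt_eqF // scale1r.
      by rewrite cutE subKr.
    by apply: scvgB; [exact: scvg_cst|exact: scvgZ].
  set b := a - _ in lim_r.
  have hy := M_bo hM My.
  have A_L : t * rd (y (res (t%:C *: s J) a)) (y (res (t%:C *: s J) a)) + rd (a - res (t%:C *: s J) a) (a - res (t%:C *: s J) a) @[J --> \oo]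
     --> t * rd (y b) (y b) + rd (a - b) (a - b).
    apply: cvgD; last by apply: rd_cvg; apply: scvgB => //; exact: scvg_cst.
    by apply: cvgMr; apply: rd_cvg; apply: (bo_scvg hy).
  have B_L : t * rd (Y J (res (t%:C *: s J) a)) (Y J (res (t%:C *: s J) a)) + rd (a - res (t%:C *: s J) a) (a - res (t%:C *: s J) a) @[J --> \oo]
     --> t * rd (y b) (y b) + rd (a - b) (a - b).
    have YL : scvg \oo (fun J => Y J (res (t%:C *: s J) a)) (y b).
      by apply: (scvg_bnd C0 (fun J => bo_lin (M_bo hM (MY J))) bY (Yy b) lim_r).
    apply: cvgD; last by apply: rd_cvg; apply: scvgB => //; exact: scvg_cst.
    by apply: cvgMr; apply: rd_cvg.
  apply: (@le_trans _ _ (t * rd (y b) (y b) + rd (a - b) (a - b))).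
    apply: (cvg_lb _ A_L) => J.
    by have := cut_var pty a (res (t%:C *: s J) a); rewrite opE rdZl (sqE hM).
  apply: (cvg_ub _ B_L) => J.
  apply: (@le_trans _ _ (rd (cutf (t%:C *: s J) a) a)).
    by rewrite cut_eq // lerD2r opE rdZl ler_pM2l.
  by have := leG J a; rewrite /g opE rdZl ler_pdivrMl.
apply: (@phi_lim _ _ _ _ hM hphi g) => // J.
apply: le_trans (phis J); have [MsJ psJ] := Ms J; have [MgJ pgJ] := Mg J.
apply: (phi_mono hM hphi) => // a; rewrite /g opE rdZl ler_pdivrMl //.
by rewrite -rdZl; exact: (cut_le (pts J) a).
Qed.

(* Along a subsequence the increments are summable in the GNS norm; [phi_series] is then
   the lower semicontinuity of [phi] at the limit. *)
Lemma Lam_closed (k : nat -> H -> H) y chi (C : R) : 0 <= C -> M y ->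
  (forall n, nphi (k n) /\ bnd C (k n)) -> (forall a, scvg \oo (fun n => k n a) (y a)) ->
  scvg \oo (fun n => Lambda (k n)) chi -> nphi y /\ Lambda y = chi.
Proof.
move=> C0 My hk ky kchi.
have key (c : R) : 0 < c -> exists n, [/\ nphi (y - k n),
    rd (Lambda (y - k n)) (Lambda (y - k n)) <= 4 * c &
    rd (Lambda (k n) - chi) (Lambda (k n) - chi) <= c].
  (* With [c / 4] the square norm of an increment is at most [2 (r j.+1 + r j)], which is below
     [c 8^-j] as [phi_series] requires. *)
  move=> c0; pose r j := c / 4 * 8^-1 ^+ j.
  have r0 j : 0 < r j by rewrite /r mulr_gt0 ?divr_gt0 // exprn_gt0 // invr_gt0.
  have /choice[s sP] j : exists n, (j <= n)%N /\ rd (Lambda (k n) - chi) (Lambda (k n) - chi) <= r j.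
    have rs : 0 < Num.sqrt (r j) by rewrite sqrtr_gt0.
    have /scvgP/(_ _ rs)[N _ hN] := kchi; exists (maxn j N); split; first exact: leq_maxl.
    rewrite -nr2 -(sqr_sqrtr (ltW (r0 j))) (@ler_pXn2r _ 2) // ?nnegrE ?nr_ge0 ?sqrtr_ge0 //.
    by apply: hN; exact: leq_maxr.
  pose w j := k (s j.+1) - k (s j).
  have Yk J : \sum_(0 <= j < J) w j = k (s J) - k (s 0%N) by rewrite telescope_sumr.
  have nk n : nphi (k n) by case: (hk n).
  have hs : (phi (sq (y - k (s 0%N))%R) <= (4 * c)%:E)%E.
    apply: (@phi_series w _ c (C + C)); [exact: ltW|exact: addr_ge0| | | | |].
    - by move=> j; exact: (n_sub hM hphi).
    - by apply: M_sub => //; exact: n_M (nk _).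
    - move=> J; rewrite Yk => a; have [_ b1] := hk (s J); have [_ b2] := hk (s 0%N).
      by rewrite !opE mulrDl; apply: le_trans (nrD _ _) _; rewrite nrN lerD.
    - move=> a.
      have -> : (fun J => (\sum_(0 <= j < J) w j) a) = (fun J => k (s J) a - k (s 0%N) a).
        by apply: funext => J; rewrite Yk !opE.
      rewrite !opE; apply: scvgB; last exact: scvg_cst.
      have /scvgP ha := ky a; apply/scvgP => e /ha[N _ hN]; exists N => // J /= NJ.
      by apply: hN => /=; apply: leq_trans NJ _; case: (sP J).
    move=> j; rewrite /w (LamB hM hphi hGNS) //.
    have q0 : (0 : R) < 8^-1 ^+ j by rewrite exprn_gt0 // invr_gt0.
    have e8 : (8^-1 : R) ^+ j.+1 = 8^-1 * 8^-1 ^+ j by rewrite exprS.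
    have [_] := sP j; have [_] := sP j.+1; rewrite /r e8; move: q0 (mulr_gt0 c0 q0); set q := 8^-1 ^+ j => q0 cq.
    have -> : Lambda (k (s j.+1)) - Lambda (k (s j)) = (Lambda (k (s j.+1)) - chi) - (Lambda (k (s j)) - chi) by hring.
    move: (Lambda (k (s j.+1)) - chi) (Lambda (k (s j)) - chi) => p p' h1 h2.
    have := rd_ge0 (p + p'); rewrite !rdE (rdC p' p); nra.
  have Mys : M (y - k (s 0%N)) by apply: M_sub => //; exact: n_M (nk _).
  have nys : nphi (y - k (s 0%N)) by apply: (n_intro Mys hs); rewrite ltry.
  exists (s 0%N); split=> //.
    by rewrite -lee_fin -(Lam_phi hM hphi hGNS).
  have [_] := sP 0%N; rewrite /r expr0 mulr1; lra.
have nk n : nphi (k n) by case: (hk n).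
have ny : nphi y.
  by have [n [n1 _ _]] := key 1 ltr01; rewrite -(subrK (k n) y); exact: (n_add hM hphi).
split=> //; apply: subr0_eq; apply: rd_eq0; apply/eqP; rewrite eq_le rd_ge0 andbT.
apply/ler_addgt0Pr => e e0; rewrite add0r.
have [|n [n1 h1 h2]] := key (e / 10); first by rewrite divr_gt0.
have -> : Lambda y - chi = Lambda (y - k n) + (Lambda (k n) - chi).
  by rewrite (LamB hM hphi hGNS) //; hring.
move: (Lambda (y - k n)) (Lambda (k n) - chi) h1 h2 => p p' h1 h2.
have := rd_ge0 (p - p'); rewrite !rdE (rdC p' p); lra.
Qed.

End Closed.

(** [K * K] is not packaged as a [hilbert]; the general projection is applied to the sum of the two
    real products. *)
Lemma proj_pair {R : realType} {K : hilbert R} (V : set (K * K)) :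
  (forall a b c d, V (a, b) -> V (c, d) -> V (a + c, b + d)) ->
  (forall (k : R) a b, V (a, b) -> V (k%:C *: a, k%:C *: b)) -> V (0, 0) ->
  (forall (u v : nat -> K) a b, (forall n, V (u n, v n)) -> scvg \oo u a -> scvg \oo v b -> V (a, b)) ->
  forall r : K * K, exists2 v : K * K, V v &
    forall v' : K * K, V v' -> rd (r.1 - v.1) v'.1 + rd (r.2 - v.2) v'.2 = 0.
Proof.
move=> VD VZ V0 Vcl r; pose ip (p q : K * K) := rd p.1 q.1 + rd p.2 q.2.
apply: (@proj_exists R (K * K)%type ip V).
- by move=> p q s; rewrite /ip /= !rdDl; ring.
- by move=> k p q; rewrite /ip /= !rdZl; ring.
- by move=> p q; rewrite /ip !(rdC p.1) !(rdC p.2).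
- by move=> p; rewrite /ip addr_ge0 ?rd_ge0.
- by move=> [p q] [s t]; exact: VD.
- by move=> k [p q]; exact: VZ.
- exact: V0.
move=> u Vu hu.
have C (f : K * K -> K) : (forall p q, f (p - q) = f p - f q) -> (forall p, rd (f p) (f p) <= ip p p) ->
    exists2 l, scvg \oo (fun n => f (u n)) l &
    forall e : R, 0 < e -> exists N, forall n, (N <= n)%N -> rd (f (u n) - l) (f (u n) - l) <= e.
  move=> fB fle; apply: complete_rd => e /hu[N hN]; exists N => n m Nn Nm.
  by rewrite -fB; apply: le_trans (fle _) _; exact: hN.
have [||l1 h1 k1] := C fst; [by []|by move=> p; rewrite lerDl rd_ge0|].
have [||l2 h2 k2] := C snd; [by []|by move=> p; rewrite lerDr rd_ge0|].
exists (l1, l2); first by apply: (Vcl _ _ _ _ _ h1 h2) => n; case: (u n) (Vu n).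
move=> e e0; have e2 : 0 < e / 2 by lra.
have [N hN] := k1 _ e2; have [N' hN'] := k2 _ e2; exists (maxn N N') => n.
by rewrite geq_max => /andP[/hN p1 /hN' p2]; rewrite /ip /=; lra.
Qed.

(** * Resolvents of a positive self-adjoint operator given by its graph *)

Section PosGraph.
Context {R : realType} {K : hilbert R} (G : set (K * K)).
Hypothesis hG : pos_selfadjoint_graph G.
Implicit Types (a b c d k l v w : K).

Lemma G_adjE a b : G (a, b) <-> forall q, G q -> '[q.2, a] = '[q.1, b].
Proof. by case: hG => _ _ h; exact: h. Qed.

Lemma G_D a b c d : G (a, b) -> G (c, d) -> G (a + c, b + d).
Proof.
move=> /G_adjE h1 /G_adjE h2; apply/G_adjE => q Gq.
by rewrite !linearDr /= h1 // h2.
Qed.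
Lemma G_Z (k : R[i]) a b : G (a, b) -> G (k *: a, k *: b).
Proof. by move=> /G_adjE h1; apply/G_adjE => q Gq; rewrite !dotZr h1. Qed.
Lemma G_N a b : G (a, b) -> G (- a, - b).
Proof. by move=> /(G_Z (-1)); rewrite (scaleN1r a) (scaleN1r b). Qed.
Lemma G_B a b c d : G (a, b) -> G (c, d) -> G (a - c, b - d).
Proof. by move=> h /G_N; exact: G_D. Qed.

Lemma G_rdE a b : G (a, b) <-> forall c d, G (c, d) -> rd d a = rd c b.
Proof.
rewrite G_adjE; split=> [h c d /h /=|h [c d] Gq /=]; first by rewrite /rd => ->.
apply: dot_eq; first exact: h.
have := h _ _ (G_Z 'i%C Gq); rewrite !rdiC => /eqP; rewrite eqr_opp => /eqP ->.
by [].
Qed.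
Lemma G_rd a b c d : G (a, b) -> G (c, d) -> rd d a = rd c b.
Proof. by move=> /G_rdE; apply. Qed.

Lemma G_pos a b : G (a, b) -> 0 <= rd b a.
Proof.
case: hG => _ h _ /h /=; rewrite dotE; move: (rd b a) (rd b _) => x y.
by rewrite lecE /= => /andP[].
Qed.

Lemma G_tot : tot (fst @` G).
Proof. by apply/dense_tot; case: hG. Qed.

Lemma tot_orth (D : set K) a : tot D -> (forall d, D d -> rd d a = 0) -> a = 0.
Proof.
move=> tD h; have [u Du ua] := tot_seq a tD; apply: rd_eq0.
have L : rd (u n) a @[n --> \oo] --> rd a a by apply: rd_cvg => //; exact: scvg_cst.
apply: (limR_uniq L).
have -> : (fun n => rd (u n) a) = fun=> 0 by apply: funext => n; exact: h.
exact: cvg_cst.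
Qed.

Lemma G_fun a b c : G (a, b) -> G (a, c) -> b = c.
Proof.
move=> h1 h2; have := G_B h1 h2; rewrite subrr => h; apply: subr0_eq.
apply: (tot_orth G_tot) => d [[p q] Gp /= <-]; rewrite -(G_rd h Gp).
exact: rd0r.
Qed.
Lemma G_0 b : G (0, b) -> b = 0.
Proof.
move=> h; apply: (G_fun h); apply/G_adjE => q _; rewrite dotE [RHS]dotE.
by rewrite scaler0 !rd0r.
Qed.
Lemma G_00 : G (0, 0).
Proof. by apply/G_rdE => c d _; rewrite !rd0r. Qed.

Lemma G_lim {T} {F : set_system T} {FF : ProperFilter F} (u v : T -> K) a b :
  (forall n, G (u n, v n)) -> scvg F u a -> scvg F v b -> G (a, b).
Proof.
move=> Gn ua vb; apply/G_rdE => c d Gc.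
have L1 : rd d (u n) @[n --> F] --> rd d a by apply: rd_cvg => //; exact: scvg_cst.
have L2 : rd c (v n) @[n --> F] --> rd c b by apply: rd_cvg => //; exact: scvg_cst.
apply: (limR_uniq L1).
have -> : (fun n => rd d (u n)) = fun n => rd c (v n) by apply: funext => n; exact: G_rd.
exact: L2.
Qed.

(** Von Neumann's argument: projecting [(b, 0)] onto the graph leaves the residue [(b - a, - v)],
    and orthogonality to the graph says that [(v, b - a)] belongs to the adjoint, that is to [G]. *)
Lemma G_res_exists b : exists a v, G (a, v) /\ G (v, b - a).
Proof.
have [[a v] Gav h] := proj_pair G_D (fun k : R => @G_Z k%:C) G_00 (@G_lim _ \oo _) (b, 0).
exists a, v; split=> //; apply/G_rdE => c d Gcd.
by have := h _ Gcd; rewrite /= !rdBl rd0l !rdBr (rdC c b) (rdC c a) (rdC d v); lra.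
Qed.

Lemma G_res_uniq b a v a' v' : G (a, v) -> G (v, b - a) -> G (a', v') -> G (v', b - a') ->
  a = a' /\ v = v'.
Proof.
move=> h1 h2 h1' h2'; have h := G_B h1 h1'; have k := G_B h2 h2'.
have e : b - a - (b - a') = - (a - a') by hring.
rewrite e in k.
have := G_rd h k; rewrite rdNl; move: (rd_ge0 (a - a')) (rd_ge0 (v - v')) => p q r.
split; apply/subr0_eq/rd_eq0; lra.
Qed.

(* [resg = (1 + G^2)^-1] and [resh = G (1 + G^2)^-1] *)
Definition resg b : K := xget 0 [set a | exists v, G (a, v) /\ G (v, b - a)].
Definition resh b : K := xget 0 [set v | G (resg b, v)].

Lemma resgP b : G (resg b, resh b) /\ G (resh b, b - resg b).
Proof.
rewrite /resh; have [a [v [h1 h2]]] := G_res_exists b.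
have : [set a | exists v, G (a, v) /\ G (v, b - a)] (resg b).
  by rewrite /resg; case: xgetP => [? -> //|/(_ a) []]; exists v.
move=> [w [k1 k2]]; case: xgetP => [z -> /= h|/(_ w)//].
by split=> //; rewrite (G_fun h k1).
Qed.
Lemma resg_uniq b a v : G (a, v) -> G (v, b - a) -> resg b = a /\ resh b = v.
Proof. by have [h1 h2] := resgP b; move=> k1 k2; exact: (G_res_uniq h1 h2 k1 k2). Qed.

Lemma resg_lin : linear resg /\ linear resh.
Proof.
suff h (k : R[i]) a b : resg (k *: a + b) = k *: resg a + resg b /\ resh (k *: a + b) = k *: resh a + resh b.
  by split=> k a b; case: (h k a b).
have [a1 a2] := resgP a; have [b1 b2] := resgP b; apply: resg_uniq.
  by apply: G_D => //; exact: G_Z.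
by have := G_D (G_Z k a2) b2; rewrite scalerBr [in X in X -> _](_ : _ - _ + _ = k *: a + b - (k *: resg a + resg b)) //; rewrite opprD addrACA.
Qed.

Lemma res_form a b : rd (resg a) b = rd (resg a) (resg b) + rd (resh a) (resh b).
Proof.
have [a1 a2] := resgP a; have [b1 b2] := resgP b.
have := G_rd a1 b2; rewrite rdBl (rdC b) (rdC (resg b)) (rdC (resh b)); lra.
Qed.

Lemma resgh_sum b : rd (resg b) (resg b) + rd (resh b) (resh b) <= rd b b.
Proof.
have := res_form b b; have := rd_ge0 (b - resg b); rewrite !rdBl !rdBr (rdC b (resg b)).
move: (rd_ge0 (resh b)); lra.
Qed.
Lemma resg_bo : [/\ bo resg, bo resh, bnd 1 resg & bnd 1 resh].
Proof.
have [l1 l2] := resg_lin.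
have b1 : bnd 1 resg.
  move=> a; apply: nr_le; rewrite mul1r ?nr_ge0 // nr2; have := resgh_sum a; move: (rd_ge0 (resh a)); lra.
have b2 : bnd 1 resh.
  move=> a; apply: nr_le; rewrite mul1r ?nr_ge0 // nr2; have := resgh_sum a; move: (rd_ge0 (resg a)); lra.
by split=> //; [exact: (bo_mk l1 ler01 b1)|exact: (bo_mk l2 ler01 b2)].
Qed.
Lemma resg_psa : psa resg.
Proof.
have [h _ _ _] := resg_bo; split=> // [a b|a].
  by have := res_form b a; have := res_form a b; rewrite (rdC a) (rdC (resg b) (resg a)) (rdC (resh b) (resh a)); lra.
by rewrite res_form addr_ge0 ?rd_ge0.
Qed.
Lemma resh_psa : psa resh.
Proof.
have [_ h _ _] := resg_bo; split=> // [a b|a].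
  have [a1 a2] := resgP a; have [b1 b2] := resgP b.
  have := G_rd a2 b2; have := G_rd a1 b1; rewrite !rdBl !rdBr (rdC (resh a) b) (rdC a (resh b)); lra.
have [a1 a2] := resgP a; have := G_pos a1; have := G_pos a2; rewrite rdBl (rdC a) (rdC (resg a)); lra.
Qed.
Lemma resh_sq a : resh (resh a) = resg (a - resg a).
Proof.
have [a1 a2] := resgP a; have [b1 b2] := resgP (resh a).
apply/esym; apply: (proj1 (resg_uniq (v := resh a - resg (resh a)) _ _)) => //.
exact: G_B.
Qed.

Hypothesis G_ker : forall a, G (a, 0) -> a = 0.

Lemma resh_inj a : resh a = 0 -> a = 0.
Proof.
move=> e; have [h1 h2] := resgP a; rewrite e in h1 h2.
by have := G_0 h2; rewrite (G_ker h1) subr0.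
Qed.
Lemma resg_inj a : resg a = 0 -> a = 0.
Proof.
move=> e; have [h1 h2] := resgP a; rewrite e in h1 h2.
by rewrite (G_0 h1) subr0 in h2; exact: G_0 h2.
Qed.

End PosGraph.

Lemma closure_pair {R : realType} {K : hilbert R} (D : set (K * K)) v w :
  closure D (v, w) <->
  forall e : R, 0 < e -> exists2 d, D d & nr (v - d.1) <= e /\ nr (w - d.2) <= e.
Proof.
have nb (a : K) (e : R) : 0 < e -> nbhs a [set b | nr (a - b) <= e].
  move=> e0; rewrite -nbhs_ballE; exists e%:C; first by rewrite /= ltcR.
  by move=> b; rewrite -ball_normE /= norm_nr ltcR => /ltW.
have bn (a : K) (B : set K) : nbhs a B -> exists2 r : R, 0 < r & forall b, nr (a - b) < r -> B b.
  rewrite -nbhs_ballE => -[e /= /complexr_pos[r r0 ->] rB]; exists r => // b h.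
  by apply: rB; rewrite -ball_normE /= norm_nr ltcR.
split=> [h e e0|h B [[B1 B2] [/= n1 n2] sB]].
  have [|d [Dd [/= d1 d2]]] := h ([set b | nr (v - b) <= e] `*` [set b | nr (w - b) <= e]).
    by exists ([set b | nr (v - b) <= e], [set b | nr (w - b) <= e]) => //=; split; exact: nb.
  by exists d.
have [r r0 rB] := bn _ _ n1; have [s s0 sB2] := bn _ _ n2.
have m0 : 0 < Num.min r s / 2 by rewrite divr_gt0 // lt_min r0.
have [d Dd [d1 d2]] := h _ m0; exists d; split=> //; apply: sB; split=> /=.
  apply: rB; apply: le_lt_trans d1 _; apply: (@lt_le_trans _ _ (Num.min r s)); first by move: m0; lra.
  by rewrite ge_min lexx.
apply: sB2; apply: le_lt_trans d2 _; apply: (@lt_le_trans _ _ (Num.min r s)); first by move: m0; lra.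
by rewrite ge_min lexx orbT.
Qed.

Lemma closure_pair_seq {R : realType} {K : hilbert R} (P : set (K * K)) a b : closure P (a, b) ->
  exists u v : nat -> K, [/\ forall n, P (u n, v n), scvg \oo u a & scvg \oo v b].
Proof.
move=> /closure_pair h; have [eps [e0 eN]] := eps_seq R.
have /choice[u uP] (n : nat) : exists p, P p /\ (nr (a - p.1) <= eps n /\ nr (b - p.2) <= eps n).
  by have [p ? ?] := h _ (e0 n); exists p.
have epsc : eps n @[n --> \oo] --> (0 : R).
  apply/cvgr0Pnorm_le => e /eN[N hN]; exists N => // n /= Nn; rewrite ger0_norm ?hN //; exact: ltW.
exists (fun n => (u n).1), (fun n => (u n).2); split=> [n||].
- by rewrite -surjective_pairing; case: (uP n).
- by apply: (scvg_le _ epsc) => n; rewrite nrB; case: (uP n) => _ [].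
- by apply: (scvg_le _ epsc) => n; rewrite nrB; case: (uP n) => _ [].
Qed.

(** * Antiunitary operators *)

Section Antiunitary.
Context {R : realType} {K : hilbert R} (J : K -> K).
Hypothesis hJ : antiunitary J.

Lemma rdJ a b : rd (J a) (J b) = rd a b.
Proof. by case: hJ => _ _ h _; rewrite /rd h dotC; case: '[a,b]. Qed.
Lemma JD a b : J (a + b) = J a + J b. Proof. by case: hJ. Qed.
Lemma JZ (k : R[i]) a : J (k *: a) = k^* *: J a. Proof. by case: hJ. Qed.
Lemma JZr (k : R) a : J (k%:C *: a) = k%:C *: J a.
Proof. by rewrite JZ; congr (_ *: _); apply/eqP; rewrite eq_complex /= oppr0 !eqxx. Qed.
Lemma Ji a : J ('i%C *: a) = - 'i%C *: J a.
Proof. by rewrite JZ; congr (_ *: _); apply/eqP; rewrite eq_complex /= oppr0 !eqxx. Qed.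
Lemma JN a : J (- a) = - J a.
Proof. by have := JZr (-1) a; rewrite rmorphN1 (scaleN1r a) (scaleN1r (J a)). Qed.
Lemma JB a b : J (a - b) = J a - J b. Proof. by rewrite JD JN. Qed.
Lemma J_inj a b : J a = J b -> a = b.
Proof.
move=> e; apply/subr0_eq/rd_eq0; rewrite -rdJ JB e subrr; exact: rd0l.
Qed.

(** [antiunitary] has no clause [J^2 = 1]; the inverse is therefore a map of its own, total by
    surjectivity. *)
Definition Jinv b := xget 0 [set a | J a = b].
Lemma JinvK b : J (Jinv b) = b.
Proof.
rewrite /Jinv; case: xgetP => [//|h]; case: hJ => _ _ _ /(_ b)[a e]; case: (h a e).
Qed.
Lemma JK a : Jinv (J a) = a. Proof. by apply: J_inj; rewrite JinvK. Qed.
Lemma rdJinv a b : rd (J a) b = rd a (Jinv b).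
Proof. by rewrite -{1}(JinvK b) rdJ. Qed.
Lemma JinvD a b : Jinv (a + b) = Jinv a + Jinv b.
Proof. by apply: J_inj; rewrite JD !JinvK. Qed.
Lemma JinvB a b : Jinv (a - b) = Jinv a - Jinv b.
Proof. by apply: J_inj; rewrite JB !JinvK. Qed.
Lemma JinvZ (k : R[i]) a : Jinv (k *: a) = k^* *: Jinv a.
Proof. by apply: J_inj; rewrite JZ !JinvK conjCK. Qed.
Lemma JinvZr (k : R) a : Jinv (k%:C *: a) = k%:C *: Jinv a.
Proof. by apply: J_inj; rewrite JZr !JinvK. Qed.
Lemma Jinvi a : Jinv (- 'i%C *: a) = 'i%C *: Jinv a.
Proof. by apply: J_inj; rewrite Ji !JinvK. Qed.
Lemma Jinv_rd a b : rd (Jinv a) (Jinv b) = rd a b.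
Proof. by rewrite -rdJ !JinvK. Qed.
Lemma nrJ a : nr (J a) = nr a. Proof. by rewrite /nr rdJ. Qed.
Lemma nrJinv a : nr (Jinv a) = nr a. Proof. by rewrite /nr Jinv_rd. Qed.

Lemma conj_J_psa x : psa x -> psa (J \o x \o Jinv).
Proof.
move=> [hx sx px]; have [C C0 hC] := bo_bnd hx; split.
- have b1 : bnd C (J \o x \o Jinv) by move=> a /=; rewrite nrJ -(nrJinv a); exact: hC.
  apply: (bo_mk _ C0 b1) => k a b /=.
  by rewrite JinvD JinvZ (boD hx) (boZ hx) JD JZ conjCK.
- by move=> a b /=; rewrite rdJinv sx [RHS]rdC rdJinv rdC.
- by move=> a /=; rewrite rdJinv.
Qed.

End Antiunitary.

(** * The Tomita operator, its adjoint and the resolvent of their product *)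

Section Tomita.
Context {R : realType} {H K : hilbert R} (M : set (op H)) (phi : op H -> \bar R).
Context (Lambda : op H -> K) (pi : op H -> op K) (J : op K) (G : set (K * K)).
Hypothesis hM : von_neumann_algebra M.
Hypothesis hphi : fns_weight M phi.
Hypothesis hGNS : is_gns M phi Lambda pi.
Hypothesis hJ : antiunitary J.
Hypothesis hG : pos_selfadjoint_graph G.
Hypothesis hS : tomita_graph M phi Lambda = [set (p.1, J p.2) | p in G].
Implicit Types (x y z : H -> H) (k l : K).

Local Notation nphi := (nphi M phi).
Local Notation jinv := (Jinv J).

Definition n2 x := nphi x /\ nphi (adj x).
Definition Sg v w := tomita_graph M phi Lambda (v, w).
(** The adjoint of the conjugate-linear [S], written as a real adjoint. [Sg_G] and [Fg_G] read
    [S = J G] and [F = G J^-1]. *)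
Definition Fg v w := forall a b, Sg a b -> rd b v = rd w a.

Lemma Sg_G v w : Sg v w <-> G (v, jinv w).
Proof.
rewrite /Sg hS; split=> [[[a b] Gab [<- <-]] /=|h]; first by rewrite (JK hJ).
by exists (v, jinv w) => //=; rewrite (JinvK hJ).
Qed.
Lemma G_Sg v w : G (v, w) -> Sg v (J w).
Proof. by move=> h; apply/Sg_G; rewrite (JK hJ). Qed.

Lemma Fg_G v w : Fg v w <-> G (jinv v, w).
Proof.
split=> [h|h a b /Sg_G Gab].
  apply/(G_rdE hG) => c d /G_Sg /h; rewrite (rdJinv hJ) => ->; exact: rdC.
by rewrite rdC -{1}(JinvK hJ v) (rdJinv hJ) rdC (G_rd hG h Gab) rdC.
Qed.

Lemma Sg_core v w : Sg v w <-> forall e : R, 0 < e ->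
  exists2 x, n2 x & nr (v - Lambda x) <= e /\ nr (w - Lambda (adj x)) <= e.
Proof.
rewrite /Sg /tomita_graph closure_pair; split=> h e e0; have := h e e0.
  by move=> [_ [x hx <-] /= ?]; exists x.
by move=> [x hx ?]; exists (Lambda x, Lambda (adj x)) => //; exists x.
Qed.

Lemma n2M x : n2 x -> M x. Proof. by move=> [/n_M]. Qed.
Lemma n2_adj x : n2 x -> n2 (adj x).
Proof. by move=> [h1 h2]; split=> //; rewrite adjK //; exact: (M_bo hM (n_M h1)). Qed.
Lemma n2_sa x : nphi x -> sa x -> n2 x.
Proof. by move=> h s; split=> //; rewrite sa_adj //; exact: (M_bo hM (n_M h)). Qed.
Lemma n2_mul x y : nphi x -> nphi y -> n2 (adj x \o y).
Proof.
move=> nx ny; have hx := M_bo hM (n_M nx); have hy := M_bo hM (n_M ny).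
split; first by apply: (n_comp hM hphi) => //; exact: (M_adj hM (n_M nx)).
rewrite adjM // ?adjK //; last exact: bo_adj.
by apply: (n_comp hM hphi) => //; exact: (M_adj hM (n_M ny)).
Qed.

Lemma Sg_Lam x : n2 x -> Sg (Lambda x) (Lambda (adj x)).
Proof. by move=> hx; apply/Sg_core => e e0; exists x => //; rewrite !subrr nr0 ltW. Qed.
Lemma Sg_sa x : nphi x -> sa x -> Sg (Lambda x) (Lambda x).
Proof. by move=> h s; have := Sg_Lam (n2_sa h s); rewrite sa_adj //; exact: (M_bo hM (n_M h)). Qed.

Lemma Sg_swap v w : Sg v w -> Sg w v.
Proof.
move=> /Sg_core h; apply/Sg_core => e /h[x nx [h1 h2]].
exists (adj x); first exact: n2_adj.
by rewrite adjK //; exact: (M_bo hM (n2M nx)).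
Qed.

Lemma Sg_Z (k : R) v w : Sg v w -> Sg (k%:C *: v) (k%:C *: w).
Proof. by move=> /Sg_G h1; apply/Sg_G; rewrite (JinvZr hJ); exact: G_Z. Qed.
Lemma Sg_i v w : Sg v w -> Sg ('i%C *: v) (- 'i%C *: w).
Proof. by move=> /Sg_G h1; apply/Sg_G; rewrite (Jinvi hJ); exact: G_Z. Qed.
Lemma Sg_B v w v' w' : Sg v w -> Sg v' w' -> Sg (v - v') (w - w').
Proof. by move=> /Sg_G h1 /Sg_G h2; apply/Sg_G; rewrite (JinvB hJ); exact: G_B. Qed.
Lemma Sg_fun v w w' : Sg v w -> Sg v w' -> w = w'.
Proof. by move=> /Sg_G h1 /Sg_G h2; rewrite -(JinvK hJ w) (G_fun hG h1 h2) (JinvK hJ). Qed.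

Lemma Fg_D v w v' w' : Fg v w -> Fg v' w' -> Fg (v + v') (w + w').
Proof. by move=> h1 h2 a b h; rewrite rdDr rdDl (h1 a b) // (h2 a b). Qed.
Lemma Fg_Z (k : R) v w : Fg v w -> Fg (k%:C *: v) (k%:C *: w).
Proof. by move=> h1 a b h; rewrite rdZr rdZl (h1 a b). Qed.
Lemma Fg_i v w : Fg v w -> Fg ('i%C *: v) (- 'i%C *: w).
Proof. by move=> h1 a b /Sg_i /h1; rewrite scaleNr rdNl rdiC opprK scaleNr rdNl rdiC opprK. Qed.
Lemma Fg_N v w : Fg v w -> Fg (- v) (- w).
Proof. by move=> h1 a b h; rewrite rdNr rdNl (h1 a b). Qed.
Lemma Fg_B v w v' w' : Fg v w -> Fg v' w' -> Fg (v - v') (w - w').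
Proof. by move=> h1 /Fg_N; exact: Fg_D. Qed.
Lemma Fg_swap v w : Fg v w -> Fg w v.
Proof. by move=> h a b /Sg_swap /h e; rewrite rdC -e rdC. Qed.
Lemma Fg_fun v w w' : Fg v w -> Fg v w' -> w = w'.
Proof. by move=> /Fg_G h1 /Fg_G h2; exact: (G_fun hG h1 h2). Qed.

Lemma Sg_seq v w : Sg v w -> exists x : nat -> H -> H, [/\ forall n, n2 (x n),
  scvg \oo (fun n => Lambda (x n)) v & scvg \oo (fun n => Lambda (adj (x n))) w].
Proof.
move=> /closure_pair_seq[p [q [Ppq pv qw]]].
have /choice[x xP] n : exists x, n2 x /\ (Lambda x, Lambda (adj x)) = (p n, q n).
  by have [x nx e] := Ppq n; exists x.
exists x; split=> [n||]; first by case: (xP n).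
  by rewrite (_ : (fun n => Lambda (x n)) = p) //; apply: funext => n; case: (xP n) => _ [].
by rewrite (_ : (fun n => Lambda (adj (x n))) = q) //; apply: funext => n; case: (xP n) => _ [].
Qed.

Lemma Fg_core v w : (forall x, n2 x -> rd (Lambda (adj x)) v = rd w (Lambda x)) -> Fg v w.
Proof.
move=> h a b /Sg_seq[x [nx xa xb]].
have L1 : rd (Lambda (adj (x n))) v @[n --> \oo] --> rd b v by apply: rd_cvg => //; exact: scvg_cst.
have L2 : rd w (Lambda (x n)) @[n --> \oo] --> rd w a by apply: rd_cvg => //; exact: scvg_cst.
apply: (limR_uniq L1).
by have -> : (fun n => rd (Lambda (adj (x n))) v) = fun n => rd w (Lambda (x n)) by apply: funext => n; exact: h.
Qed.

(** The closed operator [S] is the adjoint of [F]; through [J] this is the self-adjointness of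
    [G]. *)
Lemma Sg_dual v w : (forall a b, Fg a b -> rd w a = rd b v) -> Sg v w.
Proof.
move=> h; apply/Sg_G/(G_rdE hG) => c d Gcd.
have /h : Fg (J c) d by apply/Fg_G; rewrite (JK hJ).
by rewrite rdC (rdJinv hJ) => ->.
Qed.

Lemma tot_n2 : tot (Lambda @` n2).
Proof.
move=> a e e0; have e2 : 0 < e / 2 by lra.
have [_ [[p q] Gp <-] /= h] := G_tot hG a e2.
have /Sg_core /(_ _ e2) [x nx [h1 _]] := G_Sg Gp.
exists (Lambda x); first by exists x.
have -> : a - Lambda x = (a - p) + (p - Lambda x) by hring.
apply: le_trans (nrD _ _) _; lra.
Qed.

(** Symmetrize a sequence of the core. Only the vectors converge: the operator norms of the [z n]
    are not controlled. *)
Lemma Sg_approx v : Sg v v -> exists2 z : nat -> H -> H,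
  (forall n, nphi (z n) /\ sa (z n)) & scvg \oo (fun n => Lambda (z n)) v.
Proof.
move=> /Sg_seq[x [nx xv yv]].
have i2 : (2^-1 : R) + 2^-1 = 1 by field.
exists (fun n => 2^-1%:C *: (x n + adj (x n))) => [n|].
  have [n1 n2'] := nx n; have hx := M_bo hM (n_M n1); split.
    by apply: (n_scale hM hphi); apply: (n_add hM hphi).
  apply: saZ => a b; rewrite !opDE rdDl rdDr (rd_adj hx) (rdC (adj _ a)).
  by rewrite addrC; congr (_ + _); rewrite [RHS]rdC (rd_adj hx).
have -> : (fun n => Lambda (2^-1%:C *: (x n + adj (x n)))) = fun n => 2^-1%:C *: (Lambda (x n) + Lambda (adj (x n))).
  apply: funext => n; have [n1 n2'] := nx n.
  have ns := n_add hM hphi n1 n2'; by rewrite (LamZ hM hphi hGNS _ ns) (LamD hGNS n1 n2').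
have -> : v = 2^-1%:C *: (v + v) by rewrite scalerDr -scalerDl -rmorphD i2 scale1r.
by apply: scvgZ; apply: scvgD.
Qed.

(* [Rt = (1 + S F)^-1], where [F] is the adjoint of [S]. *)
Definition Rt := J \o resg G \o jinv.

Lemma RtP k : exists2 v, Fg (Rt k) v & Sg v (k - Rt k).
Proof.
have [h1 h2] := resgP hG (jinv k); exists (resh G (jinv k)).
  by apply/Fg_G; rewrite /Rt /= (JK hJ).
by apply/Sg_G; rewrite /Rt /= (JinvB hJ) (JK hJ).
Qed.

Lemma Rt_uniq k a v : Fg a v -> Sg v (k - a) -> Rt k = a.
Proof.
move=> /Fg_G h1 /Sg_G; rewrite (JinvB hJ) => h2; rewrite /Rt /=.
by have [-> _] := resg_uniq hG h1 h2; rewrite (JinvK hJ).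
Qed.

Lemma Rt_psa : psa Rt. Proof. by apply: (conj_J_psa hJ); exact: resg_psa. Qed.
Lemma Rt_bo : bo Rt. Proof. by case: Rt_psa. Qed.

(** [S] is its own inverse, so [S] and with it [G] are injective. *)
Lemma G_ker0 a : G (a, 0) -> a = 0.
Proof.
move=> /G_Sg h; have J0 : J 0 = 0 by apply: (@addrI _ (J 0)); rewrite -(JD hJ) !addr0.
rewrite J0 in h; by have := Sg_fun (Sg_swap h) (G_Sg (G_00 hG)); rewrite J0.
Qed.

Lemma Rt_inj k : Rt k = 0 -> k = 0.
Proof.
move=> e; have J0 : J 0 = 0 by apply: (@addrI _ (J 0)); rewrite -(JD hJ) !addr0.
have e2 : resg G (jinv k) = 0 by apply: (J_inj hJ); rewrite J0.
by have := resg_inj hG e2; rewrite -{2}(JinvK hJ k) => ->.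
Qed.

(** Put [v = F (R k)], so that [S v = k - R k]. Applying [S] and using [S k = k] gives
    [S (R k) = k - v], and [F v = R k]; these are the equations that determine [R k], so
    [v = R k]. *)
Lemma Rt_real k : Sg k k -> Fg (Rt k) (Rt k) /\ Sg (Rt k) (k - Rt k).
Proof.
move=> Skk; have [v h1 h2] := RtP k.
have h3 := Sg_B Skk (Sg_swap h2).
have e : k - (k - Rt k) = Rt k by rewrite subKr.
rewrite e in h3; have h4 := Rt_uniq (Fg_swap h1) h3.
by split; [rewrite {2}h4|rewrite {2}h4].
Qed.

End Tomita.

(** * Closed graphs: extension by continuity and matrix entries of the graph projection *)

Section GraphExtension.
Context {R : realType} {K : hilbert R}.
Implicit Types (a b c d k l : K).

Lemma closure_pair_lim (P : set (K * K)) (u v : nat -> K) a b :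
  (forall n, closure P (u n, v n)) -> scvg \oo u a -> scvg \oo v b -> closure P (a, b).
Proof.
move=> h ua vb; apply/closure_pair => e e0; have e2 : 0 < e / 2 by lra.
have /scvgP/(_ _ e2)[N _ hN] := ua; have /scvgP/(_ _ e2)[N' _ hN'] := vb.
have /closure_pair/(_ _ e2)[p Pp [h1 h2]] := h (maxn N N').
have := hN (maxn N N') (leq_maxl _ _); have := hN' (maxn N N') (leq_maxr _ _) => /= k2 k1.
exists p => //; split.
  have -> : a - p.1 = (u (maxn N N') - p.1) - (u (maxn N N') - a) by hring.
  by apply: le_trans (nrD _ _) _; rewrite nrN; lra.
have -> : b - p.2 = (v (maxn N N') - p.2) - (v (maxn N N') - b) by hring.
by apply: le_trans (nrD _ _) _; rewrite nrN; lra.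
Qed.

Lemma closure_pair_lin (P : set (K * K)) :
  (forall (k : R[i]) a b c d, P (a, b) -> P (c, d) -> P (k *: a + c, k *: b + d)) ->
  forall (k : R[i]) a b c d, closure P (a, b) -> closure P (c, d) ->
    closure P (k *: a + c, k *: b + d).
Proof.
move=> PL k a b c d /closure_pair_seq[u [v [Pu ua vb]]] /closure_pair_seq[w [t [Pw wc td]]].
have kS (u' : nat -> K) l : scvg \oo u' l -> scvg \oo (fun n => k *: u' n) (k *: l).
  by move=> ul; exact: (bo_scvg (bo_scale k bo_id) ul).
apply: (@closure_pair_lim _ (fun n => k *: u n + w n) (fun n => k *: v n + t n)).
- by move=> n; apply: subset_closure; exact: PL.
- by apply: scvgD => //; exact: kS.
- by apply: scvgD => //; exact: kS.
Qed.

Lemma graph_ext (P : set (K * K)) (C : R) : 0 <= C ->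
  (forall (k : R[i]) a b c d, P (a, b) -> P (c, d) -> P (k *: a + c, k *: b + d)) ->
  (forall a b, P (a, b) -> nr b <= C * nr a) -> tot (fst @` P) ->
  exists T : K -> K, [/\ bo T, bnd C T & forall a b, P (a, b) -> T a = b].
Proof.
move=> C0 PL Pb tP.
have cE a l : closure P (a, l) <-> forall e : R, 0 < e ->
    exists p q, [/\ P (p, q), nr (a - p) <= e & nr (l - q) <= e].
  rewrite closure_pair; split=> h e /h; first by move=> [[p q] ? [? ?]]; exists p, q.
  by move=> [p [q [? ? ?]]]; exists (p, q).
have PB a b c d : P (a, b) -> P (c, d) -> P (a - c, b - d).
  by move=> h1 h2; have := PL (-1) _ _ _ _ h2 h1; rewrite (scaleN1r c) (scaleN1r d) ![- _ + _]addrC.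
have cb a l : closure P (a, l) -> nr l <= C * nr a.
  move=> /cE h; apply/ler_addgt0Pr => e e0.
  have e1 : 0 < e / (C + 1) by rewrite divr_gt0 // ltr_wpDl.
  have [p [q [Ppq h1 h2]]] := h _ e1.
  have -> : l = (l - q) + q by rewrite subrK.
  apply: le_trans (nrD _ _) _; have := Pb _ _ Ppq.
  have : nr p <= nr a + e / (C + 1).
    have -> : p = a - (a - p) by rewrite subKr.
    by apply: le_trans (nrD _ _) _; rewrite nrN lerD2l.
  have : (C + 1) * (e / (C + 1)) = e by rewrite mulrC divfK // gt_eqF // ltr_wpDl.
  move: h2; move: (e / _) (nr p) (nr a) (nr q) (nr (l - q)) => t u v w z; nra.
have cL := closure_pair_lin PL.
have c0 l : closure P (0, l) -> l = 0.
  move=> /cb; rewrite nr0 mulr0 => h; apply: nr_eq0; apply/eqP.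
  by rewrite eq_le h nr_ge0.
have cf a l l' : closure P (a, l) -> closure P (a, l') -> l = l'.
  move=> h1 h2; apply: subr0_eq; apply: c0.
  have := cL (-1) _ _ _ _ h2 h1; rewrite (scaleN1r a) (scaleN1r l') addNr addrC.
  by [].
have ex a : exists l, closure P (a, l).
  have [p Pp pa] := tot_seq a tP.
  have /choice[q Pq] n : exists q, P (p n, q) by have [[x y] Pxy /= e] := Pp n; exists y; rewrite -e.
  have [|l ql] := @scvg_complete _ _ q.
    move=> e e0; have e1 : 0 < e / (C + 1) / 2 by rewrite !divr_gt0 // ltr_wpDl.
    have /scvgP/(_ _ e1)[N _ hN] := pa; exists N => n m Nn Nm.
    apply: le_trans (Pb _ _ (PB _ _ _ _ (Pq n) (Pq m))) _.
    have : nr (p n - p m) <= e / (C + 1) / 2 + e / (C + 1) / 2.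
      have -> : p n - p m = (p n - a) - (p m - a) by hring.
      apply: le_trans (nrD _ _) _; rewrite nrN lerD //; exact: hN.
    rewrite -splitr; have : (C + 1) * (e / (C + 1)) = e by rewrite mulrC divfK // gt_eqF // ltr_wpDl.
    move: (nr_ge0 (p n - p m)) e1; move: (nr _) (e / (C + 1)) => s t; nra.
  exists l; apply/cE => e e0; have /scvgP/(_ _ e0)[N _ hN] := pa.
  have /scvgP/(_ _ e0)[N' _ hN'] := ql.
  exists (p (maxn N N')), (q (maxn N N')); split=> //; rewrite nrB.
    by apply: hN; rewrite /= leq_maxl.
  by apply: hN'; rewrite /= leq_maxr.
have /choice[T PT] := ex; have bT : bnd C T by move=> a; exact: cb.
exists T; split=> //.
  by apply: (bo_mk _ C0 bT) => k a b; apply: cf (PT _) _; exact: cL.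
move=> a b Pab; apply: cf (PT a) _; exact: subset_closure.
Qed.

Definition perp (V : set (K * K)) a b := forall p q, V (p, q) -> rd a p + rd b q = 0.

(* [c], [d], [d'], [g] are the matrix entries of the projection of [K * K] onto [V]. *)
Lemma graph_proj (V : set (K * K)) :
  (forall (k : R[i]) a b c d, V (a, b) -> V (c, d) -> V (k *: a + c, k *: b + d)) ->
  V (0, 0) ->
  (forall (u v : nat -> K) a b, (forall n, V (u n, v n)) -> scvg \oo u a -> scvg \oo v b -> V (a, b)) ->
  exists c d d' g : K -> K, [/\ [/\ bo c, bo d, bo d' & bo g],
    forall a b, V (c a + d' b, d a + g b),
    forall a b, perp V (a - (c a + d' b)) (b - (d a + g b)) &
    forall a b a' b', V (a', b') -> perp V (a - a') (b - b') -> a' = c a + d' b /\ b' = d a + g b].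
Proof.
move=> VL V0 Vcl.
have VD a b c d : V (a, b) -> V (c, d) -> V (a + c, b + d).
  by move=> h1 h2; have := VL 1 _ _ _ _ h1 h2; rewrite (scale1r a) (scale1r b).
have VZ (k : R[i]) a b : V (a, b) -> V (k *: a, k *: b).
  by move=> h1; have := VL k _ _ _ _ h1 V0; rewrite !addr0.
have VN a b : V (a, b) -> V (- a, - b).
  by move=> h1; have := VZ (-1) _ _ h1; rewrite (scaleN1r a) (scaleN1r b).
have ex (r : K * K) : exists r', V r' /\ perp V (r.1 - r'.1) (r.2 - r'.2).
  have [r' Vr h] := proj_pair VD (fun k : R => @VZ k%:C) V0 Vcl r.
  by exists r'; split=> // p q Vpq; exact: (h (p, q)).
have /choice[P PP] := ex.
have uq r a b : V (a, b) -> perp V (r.1 - a) (r.2 - b) -> P r = (a, b).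
  move=> Vab h; have [Vp hp] := PP r; rewrite [P r]surjective_pairing in Vp hp *.
  move: (P r).1 (P r).2 Vp hp => p q Vp /= hp.
  have Vd := VD _ _ _ _ Vp (VN _ _ Vab).
  have := hp _ _ Vd; have := h _ _ Vd; rewrite !rdBl => h1 h2.
  have := rd_ge0 (p - a); have := rd_ge0 (q - b).
  rewrite (rdBl p) (rdBl q) => k1 k2.
  have [z1 z2] : rd (p - a) (p - a) = 0 /\ rd (q - b) (q - b) = 0 by rewrite (rdBl p) (rdBl q); split; lra.
  by rewrite (subr0_eq (rd_eq0 z1)) (subr0_eq (rd_eq0 z2)).
have Pl (k : R[i]) r s : P (k *: r + s) = k *: P r + P s.
  have [V1 h1] := PP r; have [V2 h2] := PP s.
  rewrite [P r]surjective_pairing [P s]surjective_pairing in V1 V2 *.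
  apply: uq; first exact: VL.
  move=> p q Vpq /=.
  have VZs : V (k^*%C *: p, k^*%C *: q) by exact: VZ.
  have zz (z t : K) : rd (k *: z) t = rd z (k^*%C *: t).
    rewrite /rd dotZl dotZr; congr complex.Re; congr (_ * _).
    by case: (k) => x y /=; rewrite /Num.conj_op /= opprK.
  have := h1 _ _ VZs; have := h2 _ _ Vpq.
  rewrite !rdBl !rdDl !zz; lra.
have Pn r : rd (P r).1 (P r).1 + rd (P r).2 (P r).2 <= rd r.1 r.1 + rd r.2 r.2.
  have [V1 h1] := PP r; rewrite [P r]surjective_pairing in V1; have := h1 _ _ V1.
  have := rd_ge0 (r.1 - (P r).1); have := rd_ge0 (r.2 - (P r).2).
  rewrite !rdBl !rdBr (rdC (P r).1 r.1) (rdC (P r).2 r.2); lra.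
have mk (f : K -> K * K) (h : K * K -> K) : (forall (k : R[i]) a b, f (k *: a + b) = k *: f a + f b) ->
    (forall a, rd (f a).1 (f a).1 + rd (f a).2 (f a).2 = rd a a) ->
    (forall (k : R[i]) p q, h (k *: p + q) = k *: h p + h q) ->
    (forall p, rd (h p) (h p) <= rd p.1 p.1 + rd p.2 p.2) -> bo (fun a => h (P (f a))).
  move=> fl fn hl hn; apply: (@bo_mk _ _ 1) => // [k a b|a]; first by rewrite fl Pl hl.
  apply: nr_le; rewrite mul1r ?nr_ge0 // nr2 -(fn a); apply: le_trans (hn _) _; exact: Pn.
have sp (p : K * K) : rd p.1 p.1 <= rd p.1 p.1 + rd p.2 p.2 by rewrite lerDl rd_ge0.
have sp2 (p : K * K) : rd p.2 p.2 <= rd p.1 p.1 + rd p.2 p.2 by rewrite lerDr rd_ge0.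
have f1l (k : R[i]) a b : (k *: a + b, 0) = k *: (a, 0) + (b, 0) :> K * K.
  by congr pair; rewrite /= scaler0 addr0.
have f2l (k : R[i]) a b : (0, k *: a + b) = k *: (0, a) + (0, b) :> K * K.
  by congr pair; rewrite /= scaler0 addr0.
have r0 : rd (0 : K) 0 = 0 by exact: rd0l.
have Ps a b : P (a, b) = ((P (a, 0)).1 + (P (0, b)).1, (P (a, 0)).2 + (P (0, b)).2).
  have := Pl 1 (a, 0) (0, b); rewrite !scale1r.
  have -> : (a, 0) + (0, b) = (a, b) :> K * K by congr pair; rewrite /= ?addr0 ?add0r.
  by move=> ->.
exists (fun a => (P (a, 0)).1), (fun a => (P (a, 0)).2), (fun b => (P (0, b)).1), (fun b => (P (0, b)).2).
split.
- split; [apply: (mk (fun a => (a, 0)) fst)|apply: (mk (fun a => (a, 0)) snd)|apply: (mk (fun a => (0, a)) fst)|apply: (mk (fun a => (0, a)) snd)] => //= a; rewrite ?r0 ?addr0 ?add0r //.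
- by move=> a b; rewrite -Ps; case: (PP (a, b)).
- by move=> a b; have [_] := PP (a, b); rewrite Ps.
- by move=> a b a' b' Vab h; have := uq (a, b) _ _ Vab h; rewrite Ps => -[<- <-].
Qed.

(** If [V] is the graph of [T], then [c = (1 + T^*T)^-1], [d = T c], [d'] is the adjoint of [d], and
    [1 - g] is the resolvent of [T T^*]. The quadratic identities say that the projection is
    idempotent. The fourth clause holds because it fixes [(a, b)] and, by symmetry of [V], kills
    [(- b, a)]. Uniqueness of the projection gives the commutation. *)
Lemma sym_proj (V : set (K * K)) :
  (forall (k : R[i]) a b c d, V (a, b) -> V (c, d) -> V (k *: a + c, k *: b + d)) ->
  V (0, 0) ->
  (forall (u v : nat -> K) a b, (forall n, V (u n, v n)) -> scvg \oo u a -> scvg \oo v b -> V (a, b)) ->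
  (forall a b p q, V (a, b) -> V (p, q) -> rd b p = rd a q) ->
  exists c d d' g : K -> K, [/\ [/\ psa c, psa g, bo d, bo d' & forall a b, rd (d a) b = rd a (d' b)],
    [/\ pos (idfun - c), pos (idfun - g), forall a, d' (d a) = c a - c (c a) & forall b, d (d' b) = g b - g (g b)],
    (forall a, d (c a) = d a - g (d a)) /\ (forall b, c (d' b) = d' b - d' (g b)),
    forall a b, V (a, b) -> [/\ d a = b - g b, d' b = a - c a, c b = d' a & g a = d b] &
    forall A : K -> K, bo A -> (forall a b, V (a, b) -> V (A a, A b) /\ V (adj A a, adj A b)) ->
      forall a, [/\ A (c a) = c (A a), A (d a) = d (A a), A (d' a) = d' (A a) & A (g a) = g (A a)]].
Proof.
move=> VL V0 Vcl Vsym; have [c [d [d' [g [[hc hd hd' hg] VP perpP uq]]]]] := graph_proj VL V0 Vcl.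
have V1 a : V (c a, d a) by have := VP a 0; rewrite (bo0 hd') (bo0 hg) !addr0.
have V2 b : V (d' b, g b) by have := VP 0 b; rewrite (bo0 hc) (bo0 hd) !add0r.
have p1 a : perp V (a - c a) (- d a).
  by have := perpP a 0; rewrite (bo0 hd') (bo0 hg) !addr0 sub0r.
have p2 b : perp V (- d' b) (b - g b).
  by have := perpP 0 b; rewrite (bo0 hc) (bo0 hd) !add0r.
have cf a b : rd (c b) a = rd (c b) (c a) + rd (d b) (d a).
  have := p1 a _ _ (V1 b); rewrite rdBl rdNl (rdC a) (rdC (c a)) (rdC (d a)); lra.
have gf a b : rd (g b) a = rd (d' b) (d' a) + rd (g b) (g a).
  have := p2 a _ _ (V2 b); rewrite rdBl rdNl (rdC a) (rdC (d' a)) (rdC (g a)); lra.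
have df a b : rd (d a) b = rd a (d' b).
  have := p2 b _ _ (V1 a); have := p1 a _ _ (V2 b).
  by rewrite !rdBl !rdNl (rdC (d a) b) (rdC (d' b)) (rdC (g b)); lra.
have V1P a b : V (a, b) -> a = c a + d' b /\ b = d a + g b.
  by move=> h; apply: uq => //; move=> p q _; rewrite !subrr !rd0l addr0.
exists c, d, d', g; split.
- split=> //; split=> //.
  + by move=> a b; rewrite (cf b a) [RHS]rdC (cf a b) (rdC (c a)) (rdC (d a)).
  + by move=> a; rewrite cf addr_ge0 ?rd_ge0.
  + by move=> a b; rewrite (gf b a) [RHS]rdC (gf a b) (rdC (d' a)) (rdC (g a)).
  + by move=> a; rewrite gf addr_ge0 ?rd_ge0.
- split=> [a|b|a|b].
  + rewrite opE /= opE rdBl; have := cf a a; have := rd_ge0 (a - c a); have := rd_ge0 (d a).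
    rewrite !rdBl !rdBr (rdC a (c a)); lra.
  + rewrite opE /= opE rdBl; have := gf b b; have := rd_ge0 (b - g b); have := rd_ge0 (d' b).
    rewrite !rdBl !rdBr (rdC b (g b)); lra.
  + by have [e _] := V1P _ _ (V1 a); rewrite {1}e addrAC subrr add0r.
  + by have [_ e] := V1P _ _ (V2 b); rewrite {1}e -addrA subrr addr0.
- split=> [a|b].
  + by have [_ e] := V1P _ _ (V1 a); rewrite {1}e -addrA subrr addr0.
  + by have [e _] := V1P _ _ (V2 b); rewrite {2}e -addrA subrr addr0.
- move=> a b h; have [e1 e2] := V1P _ _ h.
  have [k1 k2] : 0 = c (- b) + d' a /\ 0 = d (- b) + g a.
    apply: uq => // p q Vpq; rewrite !subr0 rdNl (Vsym _ _ _ _ h Vpq); lra.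
  split.
  + by rewrite {1}e2 -addrA subrr addr0.
  + by rewrite {1}e1 addrAC subrr add0r.
  + by apply/eqP; rewrite -subr_eq0 -oppr_eq0 opprB -(boN hc) addrC -k1.
  + by apply/eqP; rewrite -subr_eq0 -(boN hd) addrC -k2.
- move=> A hA VA a.
  have k1 : A (c a) = c (A a) + d' 0 /\ A (d a) = d (A a) + g 0.
    apply: uq; first by case: (VA _ _ (V1 a)).
    move=> p q Vpq; rewrite -(boB hA) sub0r -(boN hA) !(rd_adj hA).
    by apply: p1; case: (VA _ _ Vpq).
  have k2 : A (d' a) = c 0 + d' (A a) /\ A (g a) = d 0 + g (A a).
    apply: uq; first by case: (VA _ _ (V2 a)).
    move=> p q Vpq; rewrite -(boB hA) sub0r -(boN hA) !(rd_adj hA).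
    by apply: p2; case: (VA _ _ Vpq).
  move: k1 k2; rewrite (bo0 hc) (bo0 hd) (bo0 hg) (bo0 hd') !addr0 !add0r => -[? ?] [? ?].
  by split.
Qed.

Lemma iter_commute (h A : K -> K) n : (forall a, A (h a) = h (A a)) ->
  forall a, A (iter n h a) = iter n h (A a).
Proof. by move=> Ah a; elim: n => //= n IH; rewrite Ah IH. Qed.
End GraphExtension.

(** The ratios [t n.+1 / t n] increase. If the first one exceeded [k], the sequence would outgrow
    [C k^n]. *)
Lemma log_convex_ratio {R : realType} (t : nat -> R) (k C : R) : 0 <= k ->
  (forall n, 0 <= t n) -> (forall n, t n.+1 ^+ 2 <= t n * t n.+2) ->
  (forall n, t n <= C * k ^+ n) -> t 1%N <= k * t 0%N.
Proof.
move=> k0 t0 lc tb; rewrite leNgt; apply/negP => h.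
have t1 : 0 < t 1%N by apply: le_lt_trans h; rewrite mulr_ge0.
have r n : t n * t 1%N <= t n.+1 * t 0%N.
  elim: n => [|n IH]; first by rewrite mulrC.
  have := t0 n.+1; rewrite le0r => /orP[/eqP ->|p]; first by rewrite mul0r mulr_ge0.
  rewrite -(ler_pM2l p).
  have := lc n; have := t0 n.+2; have := t0 0%N; move: IH t1 p; rewrite expr2.
  move: (t n.+1) (t n) (t n.+2) (t 1%N) (t 0%N) => x y z u v IH u0 x0 v0 z0 l.
  apply: (@le_trans _ _ (y * z * u)); first by rewrite mulrA ler_wpM2r // ltW.
  have -> : y * z * u = z * (y * u) by ring.
  have -> : x * (z * v) = z * (x * v) by ring.
  by rewrite ler_wpM2l.
have tz : 0 < t 0%N.
  have := lc 0%N; rewrite lt0r t0 andbT; case: eqP => // ->; rewrite mul0r => hh.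
  by move: (exprn_gt0 2 t1); rewrite ltNge hh.
have kp : 0 < k.
  rewrite lt0r k0 andbT; apply/eqP => e.
  by have := tb 1%N; rewrite e expr1 mulr0 leNgt t1.
pose q := k * t 0%N / t 1%N.
have q0 : 0 < q by rewrite !mulr_gt0 ?invr_gt0.
have q1 : q < 1 by rewrite /q ltr_pdivrMr // mul1r.
have b n : t 0%N <= C * q ^+ n.
  suff : t 0%N * k ^+ n <= t n * q ^+ n.
    move=> hn; have kn : 0 < k ^+ n by rewrite exprn_gt0.
    rewrite -(ler_pM2r kn); apply: le_trans hn _.
    by rewrite mulrAC ler_wpM2r // exprn_ge0 // ltW.
  elim: n => [|n IH]; first by rewrite !expr0.
  have h1 : k * t n <= q * t n.+1.
    rewrite /q mulrAC ler_pdivlMr // -!mulrA ler_wpM2l // (mulrC (t 0%N)); exact: r.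
  rewrite !exprS mulrCA; apply: (@le_trans _ _ (k * (t n * q ^+ n))); first by rewrite ler_wpM2l.
  by rewrite mulrA mulrCA mulrA ler_wpM2r // exprn_ge0 // ltW.
have L : C * q ^+ n @[n --> \oo] --> (0 : R).
  by apply: cvg0M; apply: cvg_expr; rewrite ger0_norm ?ltW.
by move: tz; rewrite ltNge (cvg_lb b L).
Qed.

Lemma mulii {R : realType} : ('i * 'i : R[i])%C = -1.
Proof. by apply/eqP; rewrite eq_complex /= !mulr0 !mul0r !mulr1 addr0 sub0r oppr0 !eqxx. Qed.

(** * Products of square-finite elements form a core *)

Section Core.
Context {R : realType} {H K : hilbert R} (M : set (op H)) (phi : op H -> \bar R).
Context (Lambda : op H -> K) (pi : op H -> op K).
Hypothesis hM : von_neumann_algebra M.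
Hypothesis hphi : fns_weight M phi.
Hypothesis hGNS : is_gns M phi Lambda pi.
Implicit Types (x y z : H -> H) (k l v w : K).

Local Notation nphi := (nphi M phi).
Local Notation n2 := (n2 M phi).
Local Notation Fg := (Fg M phi Lambda).

Lemma n2_re x : n2 x -> exists x1 x2,
  [/\ nphi x1 /\ sa x1, nphi x2 /\ sa x2, x = x1 + 'i%C *: x2 & adj x = x1 - 'i%C *: x2].
Proof.
move=> [n1 n2']; have Mx := n_M n1; have [x1 [x2 [M1 M2 s1 s2 e]]] := M_re hM Mx.
have h1 := M_bo hM M1; have h2 := M_bo hM M2.
have ea : adj x = x1 - 'i%C *: x2.
  rewrite {1}e adjD //; last exact: bo_scale.
  by rewrite adji // !sa_adj // scaleNr.
have i2 : (2^-1 : R) + 2^-1 = 1 by field.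
have nx1 : nphi x1.
  have -> : x1 = 2^-1%:C *: (x + adj x).
    by rewrite ea {1}e addrACA subrr addr0 scalerDr -scalerDl -rmorphD i2 scale1r.
  by apply: (n_scale hM hphi); apply: (n_add hM hphi).
have nx2 : nphi x2.
  have -> : x2 = - 'i%C *: (x - x1).
    rewrite {1}e addrAC subrr add0r scalerA mulNr.
    rewrite mulii.
    by rewrite opprK scale1r.
  by apply: (n_scale hM hphi); apply: (n_sub hM hphi).
by exists x1, x2.
Qed.

(** [y n] is the cut-off of [x n = 4^n z^2], written with a factor [z] on the right so that it
    visibly lies in [nphi]. The cut-offs increase strongly to an operator [E] that fixes the range
    of [z], and [pi_lim] carries this to [Lambda z]. *)
Lemma prod_approx z : nphi z -> sa z -> exists y : nat -> H -> H,
  [/\ forall n, nphi (y n) /\ sa (y n), forall n, y n \o z = z \o y n &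
      scvg \oo (fun n => Lambda (z \o y n)) (Lambda z)].
Proof.
move=> nz sz; have Mz := n_M nz; have hz := M_bo hM Mz.
have pzz := psa_sqs hz sz; have Mzz := M_comp hM Mz Mz.
have p4 n : (0 : R) <= 4 ^+ n by rewrite exprn_ge0.
pose x n := (4 ^+ n)%:C *: (z \o z).
have px n : psa (x n) by apply: psaZ.
have Mx n : M (x n) by exact: M_scale.
have zx n a : z (x n a) = x n (z a) by rewrite /x !opE (boZ hz).
have zr n a : z (res (x n) a) = res (x n) (z a) by exact: res_comm.
pose y n := (4 ^+ n)%:C *: ((z \o res (x n)) \o z).
have ny n : nphi (y n).
  apply: (n_scale hM hphi); apply: (n_comp hM hphi) => //.
  by apply: (M_comp hM) => //; exact: M_res.
have sr n : sa (res (x n)) by case: (res_psa (px n)).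
have zy n a : z (y n a) = cutf (x n) (z a).
  by rewrite (cut_x (px n)) /x /y !opE (boZ hz) /=.
exists y; split.
- move=> n; split=> //; apply: saZ => a b /=.
  by rewrite sz sr sz.
- move=> n; apply: funext => a /=.
  by rewrite zy (cut_x (px n)) /x /y !opE /= -!zr.
have -> : (fun n => Lambda (z \o y n)) = fun n => pi (cutf (x n)) (Lambda z).
  apply: funext => n; rewrite (pi_L hGNS) //; last exact: M_cut.
  by congr Lambda; apply: funext => a; rewrite /= zy.
have xm n : ole (x n) (x n.+1).
  move=> a; rewrite /x !opE !rdZl exprS -mulrA ler_peMl ?mulr_ge0 //.
    by rewrite /= sz rd_ge0.
  lra.
have cm n : ole (cutf (x n)) (cutf (x n.+1)) by apply: cut_mono.
have [|E [hE _ _ cE _]] := @mono_lim _ _ (fun n => cutf (x n)) 1 ler01 (fun n => cut_psa (px n)) cm.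
  by move=> n a; rewrite mul1r; exact: cut_le1.
have ME : M E by apply: (M_lim hM _ hE cE) => n; exact: M_cut.
have e : Lambda z = pi E (Lambda z).
  rewrite (pi_L hGNS) //; congr Lambda; apply: funext => a /=.
  apply: (scvg_uniq (F := \oo) (u := fun n => cutf (x n) (z a))); last exact: cE.
  (* With [r = res (x n)] the error is [z (r a)], and [4^n |z (r a)|^2 = <x n (r a), r a>] is at
     most [|a|^2]. *)
  apply: (scvg_le (v := fun n => nr a * 2^-1 ^+ n)); last first.
    by apply: cvg0M; apply: cvg_expr; rewrite ger0_norm ?invr_ge0 // invf_lt1 // ltr1n.
  move=> n; rewrite cutE addrAC subrr add0r nrN -zr.
  have i0 : (0 : R) <= 2^-1 ^+ n by rewrite exprn_ge0 // invr_ge0.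
  apply: nr_le; first by rewrite mulr_ge0 ?nr_ge0.
  have h : rd (x n (res (x n) a)) (res (x n) a) <= nr a ^+ 2.
    rewrite -(cut_x (px n)); apply: le_trans (rd_le _ _) _; rewrite expr2.
    have := cut_bnd (px n) a; have := res_bnd (px n) a; rewrite !mul1r => h1 h2.
    by apply: ler_pM => //; exact: nr_ge0.
  move: h; rewrite {1}/x opE rdZl /= sz => h.
  have e4 : (4 ^+ n : R) * (2^-1 ^+ n) ^+ 2 = 1.
    by rewrite -exprM mulnC exprM -exprMn (_ : 4 * 2^-1 ^+ 2 = 1 :> R) ?expr1n //; field.
  rewrite exprMn; move: h e4 (p4 n) (sqr_ge0 (2^-1 ^+ n : R)).
  move: (rd _ _) (nr a ^+ 2) (4 ^+ n) ((2^-1 ^+ n) ^+ 2) => A B C D h1 h2 h3 h4.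
  by rewrite -[A]mul1r -h2 mulrAC (mulrC C) mulrC ler_wpM2r.
rewrite [X in scvg _ _ X]e.
apply: (pi_lim hM hphi hGNS) => // n; split; [exact: M_cut|exact: cut_psa].
Qed.

(** By [prod_approx] it is enough to test [F] on products. The hypothesis then sees [v] and [w] only
    through the action of [M], so that it can be verified for vectors moved by operators commuting
    with [pi M]. *)
Lemma Fg_core2 v w :
  (forall y z, nphi y -> nphi z -> rd (Lambda z) (pi y v) = rd (pi z w) (Lambda y)) -> Fg v w.
Proof.
move=> h; have hyp z : nphi z -> sa z ->
    rd (Lambda z) v = rd w (Lambda z) /\ rd ('i%C *: Lambda z) v = - rd w ('i%C *: Lambda z).
  move=> nz sz; have [y [ny yz yL]] := prod_approx nz sz.
  have hpz := pi_bo hGNS (n_M nz); have spz := pi_sa hM hphi hGNS (n_M nz) sz.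
  have spy n := pi_sa hM hphi hGNS (n_M (ny n).1) (ny n).2.
  have A1 n : rd (Lambda (z \o y n)) v = rd w (Lambda (z \o y n)).
    have [ny1 _] := ny n.
    rewrite -{1}(pi_L hGNS (n_M nz) ny1) spz (h _ _ nz ny1).
    by rewrite spy (pi_L hGNS (n_M ny1) nz) yz.
  have A2 n : rd (Lambda (z \o y n)) ('i%C *: v) = rd w ('i%C *: Lambda (z \o y n)).
    have [ny1 _] := ny n; have nzi := n_scale hM hphi 'i%C nz.
    rewrite -{1}(pi_L hGNS (n_M nz) ny1) spz (boZ hpz).
    have := h _ _ nzi ny1; rewrite (pi_scale hM hphi hGNS _ (n_M nz)) opE => ->.
    rewrite spy (LamZ hM hphi hGNS _ nz) (boZ (pi_bo hGNS (n_M ny1))).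
    by rewrite (pi_L hGNS (n_M ny1) nz) yz.
  split.
    have L1 : rd (Lambda (z \o y n)) v @[n --> \oo] --> rd (Lambda z) v by apply: rd_cvg => //; exact: scvg_cst.
    have L2 : rd w (Lambda (z \o y n)) @[n --> \oo] --> rd w (Lambda z) by apply: rd_cvg => //; exact: scvg_cst.
    apply: (limR_uniq L1).
    by rewrite (_ : (fun n => rd _ v) = fun n => rd w (Lambda (z \o y n))) //; apply: funext.
  rewrite rdiC; congr (- _).
  have L1 : rd (Lambda (z \o y n)) ('i%C *: v) @[n --> \oo] --> rd (Lambda z) ('i%C *: v) by apply: rd_cvg => //; exact: scvg_cst.
  have L2 : rd w ('i%C *: Lambda (z \o y n)) @[n --> \oo] --> rd w ('i%C *: Lambda z).
    by apply: rd_cvg; [exact: scvg_cst|exact: scvgi].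
  apply: (limR_uniq L1).
  by rewrite (_ : (fun n => rd _ ('i%C *: v)) = fun n => rd w ('i%C *: Lambda (z \o y n))) //; apply: funext.
apply: Fg_core => x /n2_re[x1 [x2 [[n1 s1] [n2' s2] -> ->]]].
have ni := n_scale hM hphi 'i%C n2'.
rewrite (LamB hM hphi hGNS n1 ni) (LamD hGNS n1 ni) (LamZ hM hphi hGNS _ n2').
have [e1 _] := hyp _ n1 s1; have [_ e2] := hyp _ n2' s2.
by rewrite rdBl rdDr e1 e2 opprK.
Qed.

End Core.

(** * The norm estimate for right multiplication by [R Lambda x] *)

Section RightBounded.
Context {R : realType} {H K : hilbert R} (M : set (op H)) (phi : op H -> \bar R).
Context (Lambda : op H -> K) (pi : op H -> op K).
Hypothesis hM : von_neumann_algebra M.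
Hypothesis hphi : fns_weight M phi.
Hypothesis hGNS : is_gns M phi Lambda pi.
Implicit Types (x y z : H -> H) (k l v w : K).

Local Notation nphi := (nphi M phi).
Local Notation Fg := (Fg M phi Lambda).
Local Notation Sg := (Sg M phi Lambda).

Lemma adj_mul_rd y z k : nphi y -> nphi z ->
  rd (pi y k) (Lambda z) = rd k (Lambda (adj y \o z)).
Proof.
move=> ny nz; rewrite (rd_adj (pi_bo hGNS (n_M ny))) -(pi_adj hM hphi hGNS (n_M ny)).
by rewrite (pi_L hGNS) //; exact: (M_adj hM (n_M ny)).
Qed.

(* Let [T] be the closure of [Lambda y |-> pi y eta] and [h = T^*T (1 + T^*T)^-1], which is
   affiliated with the commutant of [pi M]. The relations [F (g^n eta) = h^n eta] and
   [S eta = Lambda x - eta] bound the odd moments of [h] at [eta] by [dl^2 / 4] times the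
   even ones, hence the spectrum of [h] on the cyclic space of [eta]. *)
Lemma key_bound x eta (dl : R) y : nphi x -> sa x -> 0 <= dl -> dl <= 1 -> bnd dl x ->
  Fg eta eta -> Sg eta (Lambda x - eta) -> nphi y ->
  nr (pi y eta) * (1 - dl ^+ 2 / 4) <= dl / 2 * nr (Lambda y).
Proof.
move=> nx sx dl0 dl1 bx Fe Se ny.
pose P : set (K * K) := [set p | exists2 y, nphi y & p = (Lambda y, pi y eta)].
pose V := closure P.
have Mn z : nphi z -> M z by exact: n_M.
have VP z : nphi z -> V (Lambda z, pi z eta).
  by move=> nz; apply: subset_closure; exists z.
have VL : forall (k : R[i]) a b c d, V (a, b) -> V (c, d) -> V (k *: a + c, k *: b + d).
  apply: closure_pair_lin => k a b c d [z nz [-> ->]] [z' nz' [-> ->]].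
  have nkz := n_scale hM hphi k nz.
  exists (k *: z + z'); first exact: (n_add hM hphi).
  rewrite (LamD hGNS nkz nz') (LamZ hM hphi hGNS _ nz) (pi_add hM hphi hGNS (Mn _ nkz) (Mn _ nz')).
  by rewrite (pi_scale hM hphi hGNS _ (Mn _ nz)) !opE.
have V0 : V (0, 0).
  have := VP _ (n_0 hM hphi); rewrite (Lam0 hM hphi hGNS) (pi_0 hM hphi hGNS).
  by [].
have Vcl : forall (u v : nat -> K) a b, (forall n, V (u n, v n)) -> scvg \oo u a -> scvg \oo v b -> V (a, b).
  by move=> u v a b; exact: closure_pair_lim.
(* [F eta = eta] makes [T] symmetric. *)
have sym0 z z' : nphi z -> nphi z' -> rd (pi z eta) (Lambda z') = rd (Lambda z) (pi z' eta).
  move=> nz nz'; rewrite adj_mul_rd // [RHS]rdC adj_mul_rd //.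
  have e : adj (adj z' \o z) = adj z \o z'.
    have hz := M_bo hM (Mn _ nz); have hz' := M_bo hM (Mn _ nz').
    by rewrite adjM ?adjK //; exact: bo_adj.
  by have := Fe _ _ (Sg_Lam (n2_mul hM hphi nz' nz)); rewrite e rdC => ->.
have Vsym a b p q : V (a, b) -> V (p, q) -> rd b p = rd a q.
  move=> /closure_pair_seq[u [v [Puv ua vb]]] /closure_pair_seq[u' [v' [Puv' up vq]]].
  have L1 : rd (v n) (u' n) @[n --> \oo] --> rd b p by apply: rd_cvg.
  have L2 : rd (u n) (v' n) @[n --> \oo] --> rd a q by apply: rd_cvg.
  apply: (limR_uniq L1).
  rewrite (_ : (fun n => rd (v n) _) = fun n => rd (u n) (v' n)) //; apply: funext => n.
  by have [z nz [-> ->]] := Puv n; have [z' nz' [-> ->]] := Puv' n; exact: sym0.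
have [c [d [d' [g [[pc pg hd hd' ddp] [ph pb dd1 dd2] [dcE cdE] VE comm]]]]] := sym_proj VL V0 Vcl Vsym.
have [hc sc _] := pc; have [hg sg _] := pg.
have VM z : M z -> forall a b, V (a, b) -> V (pi z a, pi z b).
  move=> Mz a b /closure_pair_seq[u [v [Puv ua vb]]].
  have hz := pi_bo hGNS Mz.
  apply: (@closure_pair_lim _ _ _ (pi z \o u) (pi z \o v)); [|exact: bo_scvg|exact: bo_scvg].
  move=> n /=; have [z' nz' [-> ->]] := Puv n; rewrite (pi_L hGNS Mz nz').
  have -> : pi z (pi z' eta) = pi (z \o z') eta by rewrite (pi_comp hM hphi hGNS Mz (Mn _ nz')).
  by apply: VP; exact: (n_comp hM hphi).
have cM z : M z -> forall a, [/\ pi z (c a) = c (pi z a), pi z (d a) = d (pi z a),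
    pi z (d' a) = d' (pi z a) & pi z (g a) = g (pi z a)].
  move=> Mz; apply: comm; first exact: (pi_bo hGNS).
  move=> a b Vab; split; first exact: VM.
  by rewrite -(pi_adj hM hphi hGNS Mz); apply: VM => //; exact: (M_adj hM).
pose h : K -> K := idfun - c.
have hE (a : K) : h a = a - c a by rewrite /h opE.
have hh : bo h by apply: bo_sub => //; exact: bo_id.
have sh : sa h by apply: saB => //; exact: sa_id.
have psh : psa h by [].
have hM' z : M z -> forall a, pi z (h a) = h (pi z a).
  move=> Mz a; rewrite !hE (boB (pi_bo hGNS Mz)); by have [-> _ _ _] := cM _ Mz a.
have gM z : M z -> forall a, pi z (g a) = g (pi z a).
  by move=> Mz a; have [_ _ _ ->] := cM _ Mz a.
have dh a : d (h a) = g (d a) by rewrite hE (boB hd) dcE subKr.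
have hd'E a : h (d' a) = d' (g a) by rewrite hE cdE subKr.
have V1 z : nphi z -> [/\ g (Lambda z) = d (pi z eta), c (pi z eta) = d' (Lambda z) & h (Lambda z) = d' (pi z eta)].
  by move=> nz; have [e1 e2 e3 e4] := VE _ _ (VP _ nz); split=> //; rewrite hE e2.
pose p m := iter m h eta; pose q m := iter m g eta.
have sp m : sa (iter m h) by exact: sa_iter.
have sq' m : sa (iter m g) by exact: sa_iter.
have gd n a : iter n g (d a) = d (iter n h a) by elim: n => //= n ->; rewrite dh.
(* Checked by [Fg_core2]: powers of [g] and [h] commute with [pi M], and [g^n d = d h^n] moves them
   across [d]. *)
have Fk (n : nat) : Fg (iter n.+1 g eta) (iter n.+1 h eta).
  apply: (Fg_core2 hM hphi hGNS) => y' z ny' nz.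
  rewrite (iter_commute n.+1 (gM _ (Mn _ ny'))) (iter_commute n.+1 (hM' _ (Mn _ nz))).
  rewrite rdC sq' iterSr; have [-> _ _] := V1 _ nz.
  by have [_ _ e] := V1 _ ny'; rewrite gd rdC ddp -e iterS sh.
pose kp := dl ^+ 2 / 4.
(* Pair [Fk] at exponent [2m + 1] with [S eta = Lambda x - eta]. With [A = <h p, p>] and
   [B = <g q, q>] this reads [A + B = <pi x p, d' q>], at most [dl |p| |d' q|]. Since
   [|d' q|^2 <= B], completing the square leaves [A <= (dl^2 / 4) |p|^2]. *)
have step m : rd (h (p m)) (p m) <= kp * rd (p m) (p m).
  have := Fk m.*2 _ _ Se; rewrite rdBl.
  have e1 : rd (iter m.*2.+1 h eta) eta = rd (h (p m)) (p m).
    by rewrite -addnn -addSn iterD -/(p m) sp.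
  have e2 : rd eta (iter m.*2.+1 g eta) = rd (g (q m)) (q m).
    by rewrite rdC -addnn -addSn iterD -/(q m) sq'.
  have e3 : rd (Lambda x) (iter m.*2.+1 g eta) = rd (pi x (p m)) (d' (q m)).
    rewrite iterS -sg; have [-> _ _] := V1 _ nx.
    rewrite -addnn iterD -/(q m) -sq'.
    rewrite gd.
    by rewrite ddp -(iter_commute m (hM' _ (Mn _ nx))).
  rewrite e1 e2 e3 => E.
  have b1 : rd (pi x (p m)) (d' (q m)) <= dl * nr (p m) * nr (d' (q m)).
    apply: le_trans (rd_le _ _) _; rewrite ler_wpM2r ?nr_ge0 //.
    exact: (pi_bnd hM hphi hGNS (Mn _ nx) dl0 bx).
  have b2 : nr (d' (q m)) ^+ 2 <= rd (g (q m)) (q m).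
    rewrite nr2 -ddp dd2 rdBl (sg (g (q m))) lerBlDr lerDl; exact: rd_ge0.
  rewrite -nr2 /kp; move: E b1 b2; move: (rd (h _) _) (rd (g _) _) (rd (pi x _) _) (nr (p m)) (nr (d' _)) => A B C D F.
  have := sqr_ge0 (dl * D / 2 - F); nra.
have kp0 : 0 <= kp by rewrite /kp divr_ge0 ?sqr_ge0.
have pcs := pos_cs hh sh ph.
(* From forms to norms: Cauchy-Schwarz for [h] combines the form bounds at [p m] and [p m.+1]. *)
have p_dec m : nr (p m.+1) <= kp * nr (p m).
  apply: nr_le; first by rewrite mulr_ge0 ?nr_ge0.
  rewrite exprMn nr2 /=; have := step m; have := step m.+1; rewrite /=.
  have := pcs (p m) (h (p m)); have := rd_ge0 (h (p m)); have := ph (p m); have := ph (h (p m)).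
  rewrite -/(p m) -/h; move: kp0; clear.
  move: (rd (h (p m)) (h (p m))) (rd (h (p m)) (p m)) (rd (h (h (p m))) (h (p m))) (rd (p m) (p m)).
  move=> A B C D k0 C0 B0 A0 cs s2 s1.
  have hA : A <= kp * B.
    move: A0; rewrite le0r => /orP[/eqP ->|A0]; first by rewrite mulr_ge0.
    rewrite -(ler_pM2l A0) -expr2; apply: le_trans cs _.
    by apply: le_trans (ler_wpM2l B0 s2) _; rewrite mulrC mulrA mulrAC mulrC -!mulrA.
  by apply: le_trans hA _; rewrite expr2 -mulrA ler_wpM2l.
have p_le m : nr (p m) <= kp ^+ m * nr eta.
  elim: m => [|m IH]; first by rewrite expr0 mul1r.
  by apply: le_trans (p_dec m) _; rewrite exprS -mulrA ler_wpM2l.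
(* Log-convexity of [|h^m A eta|] carries the decay rate from [eta] to the vectors [A eta],
   independently of the norm of [A]. *)
have ratio A : bo A -> (forall a, A (h a) = h (A a)) -> nr (h (A eta)) <= kp * nr (A eta).
  move=> hA Ah; have [C C0 bA] := bo_bnd hA.
  apply: (@log_convex_ratio _ (fun m => nr (iter m h (A eta))) kp (C * nr eta)) => //.
  - by move=> m; exact: nr_ge0.
  - move=> m; rewrite nr2 /= sh mulrC; apply: le_trans (rd_le _ _) _.
    by rewrite mulrC.
  - move=> m; rewrite -(iter_commute m Ah); apply: le_trans (bA _) _.
    by rewrite -mulrA ler_wpM2l // mulrC; exact: p_le.
have My := Mn _ ny; have hpy := pi_bo hGNS My.
have hc' a : c (h a) = h (c a) by rewrite !hE (boB hc).
have r1 := ratio _ hpy (hM' _ My).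
have r2 : nr (h (c (pi y eta))) <= kp * nr (c (pi y eta)).
  apply: (ratio (c \o pi y)); first exact: bo_comp.
  by move=> a /=; rewrite (hM' _ My) hc'.
set w := pi y eta in r1 r2 *.
have [_ cw _] := V1 _ ny; rewrite -/w in cw.
have b1 : nr w <= nr (c w) + nr (h w).
  have e : w = c w + h w by rewrite hE; hring.
  rewrite {1}e; exact: nrD.
(* Here [d' d = c - c^2 = c h], so smallness of [h] at [c w] makes [d (c w)] small. As
   [c w = d' (Lambda y)], the next two bounds give [|c w| <= (dl / 2) |Lambda y|], and
   [w = c w + h w] finishes. *)
have b2 : nr (d (c w)) ^+ 2 <= kp * nr (c w) ^+ 2.
  rewrite nr2 ddp dd1 -/(h _).
  have -> : c (c w) - c (c (c w)) = c (h (c w)) by rewrite hE (boB hc).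
  have -> : c (h (c w)) = h (c w) - h (h (c w)) by rewrite (hE (h _)) subKr.
  rewrite rdBr -(sh (c w) (h (c w))).
  apply: (@le_trans _ _ (nr (c w) * nr (h (c w)))).
    rewrite lerBlDr; apply: le_trans (rd_le _ _) _.
    by rewrite lerDl rd_ge0.
  by rewrite expr2 mulrCA ler_wpM2l ?nr_ge0.
have b3 : nr (c w) ^+ 2 <= nr (d (c w)) * nr (Lambda y).
  by rewrite nr2 {2}cw -ddp; exact: rd_le.
have b4 : nr (c w) <= dl / 2 * nr (Lambda y).
  have : nr (c w) ^+ 2 * nr (c w) ^+ 2 <= nr (c w) ^+ 2 * (dl / 2 * nr (Lambda y)) ^+ 2.
    apply: (@le_trans _ _ ((nr (d (c w)) * nr (Lambda y)) ^+ 2)).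
      by rewrite -expr2 ler_pXn2r // nnegrE ?mulr_ge0 ?nr_ge0 ?sqr_ge0.
    rewrite exprMn; apply: (@le_trans _ _ (kp * nr (c w) ^+ 2 * nr (Lambda y) ^+ 2)).
      by rewrite ler_wpM2r ?sqr_ge0.
    by rewrite /kp le_eqVlt; apply/orP; left; apply/eqP; field.
  have := nr_ge0 (c w); rewrite le0r => /orP[/eqP ->|cw0].
    by move=> _; rewrite !mulr_ge0 ?nr_ge0 ?invr_ge0.
  rewrite ler_pM2l ?exprn_gt0 // (@ler_pXn2r _ 2) ?nnegrE ?mulr_ge0 ?nr_ge0 ?invr_ge0 //.
rewrite -/kp; move: b1 b4 r1; move: (nr w) (nr (c w)) (nr (h w)) => s t u; lra.
Qed.

(** For [t x] and [t eta] the estimate [key_bound] is homogeneous up to the factor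
    [1 - (t dl)^2 / 4], which tends to [1] as [t] tends to [0]. *)
Lemma half_bound x eta (dl : R) y : nphi x -> sa x -> 0 <= dl -> bnd dl x ->
  Fg eta eta -> Sg eta (Lambda x - eta) -> (forall (t : R) a b, Sg a b -> Sg (t%:C *: a) (t%:C *: b)) ->
  nphi y -> nr (pi y eta) <= dl / 2 * nr (Lambda y).
Proof.
move=> nx sx dl0 bx Fe Se SZ ny; apply/ler_addgt0Pr => e e0.
set w := pi y eta; have w0 := nr_ge0 w.
(* [t = 1 / s] is small enough for [t dl <= 1] and for [t dl^2 |w| <= e], which bounds the defect of
   that factor. *)
pose s := 1 + dl + dl ^+ 2 * nr w / e.
have q0 : 0 <= dl ^+ 2 * nr w / e by rewrite divr_ge0 ?mulr_ge0 ?sqr_ge0 // ltW.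
have s1 : 1 <= s by rewrite /s; move: q0; lra.
have s0 : 0 < s by exact: lt_le_trans s1.
pose t := s^-1.
have t0 : 0 < t by rewrite invr_gt0.
have ts : t * s = 1 by rewrite mulVf // gt_eqF.
have t1 : t <= 1 by rewrite invf_le1.
have td : t * dl <= 1 by move: ts; rewrite /s; move: q0 t0 dl0; move: (_ / e) => q; nra.
have te : t * (dl ^+ 2 * nr w) <= e.
  have E : dl ^+ 2 * nr w = (dl ^+ 2 * nr w / e) * e by rewrite divfK // gt_eqF.
  rewrite E mulrA ler_piMl // ?ltW //.
  by move: ts; rewrite /s; move: q0 t0 dl0; move: (_ / e) => q; nra.
have nx' := n_scale hM hphi t%:C nx.
have bx' : bnd (t * dl) (t%:C *: x).
  by move=> a; rewrite opE nrZ gtr0_norm // -mulrA ler_pM2l.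
have Se' : Sg (t%:C *: eta) (Lambda (t%:C *: x) - t%:C *: eta).
  by rewrite (LamZ hM hphi hGNS _ nx) -scalerBr; exact: SZ.
have := key_bound nx' (saZ t sx) (mulr_ge0 (ltW t0) dl0) td bx' (Fg_Z t Fe) Se' ny.
rewrite (boZ (pi_bo hGNS (n_M ny))) nrZ gtr0_norm // -/w.
have -> : t * dl / 2 * nr (Lambda y) = t * (dl / 2 * nr (Lambda y)) by ring.
rewrite -(mulrA t (nr w)) ler_pM2l // => h.
have D0 : 0 <= dl ^+ 2 * nr w by rewrite mulr_ge0 // sqr_ge0.
have E2 : t * (t * (dl ^+ 2 * nr w)) <= e.
  by apply: le_trans te; rewrite ler_piMl // mulr_ge0 // ltW.
have E3 : nr w * (1 - (t * dl) ^+ 2 / 4) = nr w - t * (t * (dl ^+ 2 * nr w)) / 4 by rewrite exprMn; field.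
rewrite E3 in h; move: h E2; move: (t * _) (dl / 2 * _) => A B; lra.
Qed.

End RightBounded.

Lemma sa_i0 {R : realType} {H : hilbert R} (x : H -> H) a : bo x -> sa x -> rd (x a) ('i%C *: a) = 0.
Proof.
move=> hx sx; have : rd (x a) ('i%C *: a) = - rd (x a) ('i%C *: a).
  by rewrite {1}sx (boZ hx) rdC rdiC.
lra.
Qed.

(** * Right multiplications, and reconstruction of an element of [M] from its left action *)

Section RightAction.
Context {R : realType} {H K : hilbert R} (M : set (op H)) (phi : op H -> \bar R).
Context (Lambda : op H -> K) (pi : op H -> op K) (J : op K) (G : set (K * K)).
Hypothesis hM : von_neumann_algebra M.
Hypothesis hphi : fns_weight M phi.
Hypothesis hGNS : is_gns M phi Lambda pi.
Hypothesis hJ : antiunitary J.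
Hypothesis hG : pos_selfadjoint_graph G.
Hypothesis hS : tomita_graph M phi Lambda = [set (p.1, J p.2) | p in G].
Implicit Types (x y z : H -> H) (k l a b v w : K).

Local Notation nphi := (nphi M phi).
Local Notation Fg := (Fg M phi Lambda).
Local Notation Sg := (Sg M phi Lambda).
Local Notation Rt := (Rt J G).

(* The vectors [Delta (1 + Delta)^-1 Lambda x] with [x] self-adjoint. *)
Definition rb a := exists x, [/\ nphi x, sa x & a = Rt (Lambda x)].

Lemma rb_FS x : nphi x -> sa x ->
  Fg (Rt (Lambda x)) (Rt (Lambda x)) /\ Sg (Rt (Lambda x)) (Lambda x - Rt (Lambda x)).
Proof. by move=> nx sx; apply: (Rt_real hM hJ hG hS); exact: (Sg_sa hM). Qed.

Lemma rb_Fg a : rb a -> Fg a a.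
Proof. by move=> [x [nx sx ->]]; case: (rb_FS nx sx). Qed.

(** [R] is self-adjoint and injective, so the two conditions make [R v] orthogonal to all
    [Lambda x]; the one with [i] accounts for the imaginary part of [x]. *)
Lemma rb_orth v : (forall a, rb a -> rd v a = 0 /\ rd v ('i%C *: a) = 0) -> v = 0.
Proof.
move=> h; have [hR sR _] := Rt_psa hJ hG.
apply: (Rt_inj hJ hG); apply: (tot_orth (tot_n2 hJ hG hS)) => _ [x nx <-].
have [x1 [x2 [[n1 s1] [n2' s2] -> _]]] := n2_re hM hphi nx.
have ni := n_scale hM hphi 'i%C n2'.
rewrite (LamD hGNS n1 ni) (LamZ hM hphi hGNS _ n2') -sR (boD hR) (boZ hR) rdC rdDr.
have [-> _] := h _ (ex_intro _ x1 (And3 n1 s1 erefl)).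
by have [_ ->] := h _ (ex_intro _ x2 (And3 n2' s2 erefl)); rewrite addr0.
Qed.

(* The right multiplication [Lambda y |-> pi y a]; it exists for [a] in [rb], by [half_bound]. *)
Definition ra a : K -> K := xget 0 [set T | bo T /\ forall y, nphi y -> T (Lambda y) = pi y a].

Lemma raE a (T : K -> K) : bo T -> (forall y, nphi y -> T (Lambda y) = pi y a) -> ra a = T.
Proof.
move=> hT TL; rewrite /ra; case: xgetP => [T' -> [hT' TL']|/(_ T)[]//].
by apply: (bo_eq_tot (totL hGNS)) => // _ [y ny <-]; rewrite TL // TL'.
Qed.

Lemma raP x (C : R) : nphi x -> sa x -> 0 <= C -> bnd C x ->
  [/\ bo (ra (Rt (Lambda x))), sa (ra (Rt (Lambda x))), bnd (C / 2) (ra (Rt (Lambda x))),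
     forall y, nphi y -> ra (Rt (Lambda x)) (Lambda y) = pi y (Rt (Lambda x)) &
     forall y, M y -> forall k, ra (Rt (Lambda x)) (pi y k) = pi y (ra (Rt (Lambda x)) k)].
Proof.
move=> nx sx C0 bx; have [Fe Se] := rb_FS nx sx; set a := Rt (Lambda x) in Fe Se *.
have C2 : 0 <= C / 2 by rewrite divr_ge0.
have Mn z : nphi z -> M z by exact: n_M.
have [|||T [hT bT TP]] := @graph_ext _ _ [set p | exists2 y, nphi y & p = (Lambda y, pi y a)] (C / 2) C2.
- move=> k _ _ _ _ [z nz [-> ->]] [z' nz' [-> ->]].
  have nkz := n_scale hM hphi k nz.
  exists (k *: z + z'); first exact: (n_add hM hphi).
  rewrite (LamD hGNS nkz nz') (LamZ hM hphi hGNS _ nz) (pi_add hM hphi hGNS (Mn _ nkz) (Mn _ nz')).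
  by rewrite (pi_scale hM hphi hGNS _ (Mn _ nz)) !opE.
- move=> _ _ [y ny [-> ->]]; apply: (half_bound hM hphi hGNS nx) => //.
  by move=> t b c; exact: (Sg_Z hJ hG hS).
- move=> k e e0; have [_ [y ny <-] h] := totL hGNS k e0.
  by exists (Lambda y) => //; exists (Lambda y, pi y a) => //; exists y.
have TL y : nphi y -> T (Lambda y) = pi y a by move=> ny; apply: TP; exists y.
rewrite (raE hT TL); split=> //.
- move=> k l.
  have E y z : nphi y -> nphi z -> rd (T (Lambda y)) (Lambda z) = rd (Lambda y) (T (Lambda z)).
    move=> ny nz; rewrite !TL // (adj_mul_rd hM hphi hGNS) // [RHS]rdC (adj_mul_rd hM hphi hGNS) //.
    have e : adj (adj z \o y) = adj y \o z.
      have hy := M_bo hM (Mn _ ny); have hz := M_bo hM (Mn _ nz).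
      by rewrite adjM ?adjK //; exact: bo_adj.
    by have := Fe _ _ (Sg_Lam (n2_mul hM hphi nz ny)); rewrite e rdC => ->.
  have ea : adj T = T.
    apply: (bo_eq_tot (totL hGNS)) => //; first exact: bo_adj.
    move=> _ [y ny <-]; apply: subr0_eq; apply: (tot_orth (totL hGNS)) => _ [z nz <-].
    by rewrite rdBr -(rd_adj hT) E // subrr.
  by rewrite (rd_adj hT) ea.
- move=> y My k.
  have -> : T (pi y k) = (T \o pi y) k by [].
  have -> // : T \o pi y = pi y \o T.
  apply: (bo_eq_tot (totL hGNS)).
  + by apply: bo_comp => //; exact: (pi_bo hGNS).
  + by apply: bo_comp => //; exact: (pi_bo hGNS).
  + move=> _ [z nz <-] /=; rewrite (pi_L hGNS My nz) !TL //; last exact: (n_comp hM hphi).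
    by rewrite (pi_comp hM hphi hGNS My (Mn _ nz)).
Qed.

Lemma rb_ra a : rb a -> [/\ bo (ra a), sa (ra a), forall y, nphi y -> ra a (Lambda y) = pi y a &
  forall y, M y -> forall k, ra a (pi y k) = pi y (ra a k)].
Proof.
move=> [x [nx sx ->]]; have [C C0 bx] := bo_bnd (M_bo hM (n_M nx)).
by have [? ? _ ? ?] := raP nx sx C0 bx; split.
Qed.

(** Since [A] commutes with [pi M], right multiplication by [A a] is [A \o ra a]; the last
    hypothesis says that it is adjoint to [B \o ra b]. Passing to adjoints of right multiplications
    is what [F] does. *)
Lemma Fg_ra a b (A B : K -> K) : rb a -> rb b ->
  (forall y, M y -> forall k, A (pi y k) = pi y (A k)) ->
  (forall y, M y -> forall k, B (pi y k) = pi y (B k)) ->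
  (forall k l, rd k (A (ra a l)) = rd (B (ra b k)) l) -> Fg (A a) (B b).
Proof.
move=> ha hb cA cB h; have [_ _ aL _] := rb_ra ha; have [_ _ bL _] := rb_ra hb.
apply: (Fg_core2 hM hphi hGNS) => y z ny nz.
by rewrite -(cA _ (n_M ny)) -(cB _ (n_M nz)) -aL // -bL //; exact: h.
Qed.

Lemma sub_i_inv (A : K -> K) : bo A -> sa A -> exists C : K -> K,
  [/\ bo C, forall k, A (C k) - 'i%C *: C k = k & forall k, C (A k - 'i%C *: k) = k].
Proof.
move=> hA sA; have p := psa_sqs hA sA; have [hr _ r1 r2] := resP p.
exists (fun k => A (res (A \o A) k) + 'i%C *: res (A \o A) k); split.
- have -> : (fun k => A (res (A \o A) k) + 'i%C *: res (A \o A) k) =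
     (A \o res (A \o A)) + 'i%C *: res (A \o A) by apply: funext => k; rewrite !opE.
  by apply: bo_add; [exact: bo_comp|exact: bo_scale].
- move=> k; rewrite (boD hA) (boZ hA) scalerDr scalerA.
  rewrite mulii.
  rewrite scaleN1r -[RHS](r1 k) /=; hring.
- move=> k; rewrite (boB hr) (boZ hr) (boB hA) (boZ hA) scalerBr scalerA.
  rewrite mulii.
  have cm b : A (res (A \o A) b) = res (A \o A) (A b) by exact: res_comm.
  by rewrite scaleN1r -!cm -[RHS](r2 k) (boD hr) /= -!cm; hring.
Qed.

(* [A] is affiliated through its resolvent: if [A] agrees with left multiplication
   by [chi] on the right bounded vectors, the resolvents of elements of [M]
   approximating [chi] converge to the resolvent of [A]. *)
Lemma recover (A : K -> K) chi : bo A -> sa A -> Sg chi chi ->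
  (forall a, rb a -> ra a chi = A a) ->
  exists z, [/\ nphi z, sa z, pi z = A & Lambda z = chi].
Proof.
move=> hA sA Sc hAc; have [z nz zchi] := Sg_approx hM hphi hGNS Sc.
have Mz n : M (z n) by exact: (n_M (nz n).1).
have hz n := M_bo hM (Mz n); have sz n : sa (z n) by case: (nz n).
have [C [hC C1 C2]] := sub_i_inv hA sA.
have pzz n : psa (z n \o z n) by exact: psa_sqs.
(* [c n] is [(z n - i)^-1]; the resolvents are bounded independently of [z n], and the bound [2] is
   crude but sufficient. *)
pose r n := res (z n \o z n); pose c n : H -> H := (z n \o r n) + 'i%C *: r n.
have Mr n : M (r n) by apply: (M_res hM) => //; exact: (M_comp hM).
have Mc n : M (c n) by apply: (M_add hM); [exact: (M_comp hM)|exact: (M_scale hM)].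
have cz n (a : H) : c n (z n a) = a + 'i%C *: c n a.
  have [hr _ _ r2] := resP (pzz n).
  have cm (b : H) : z n (r n b) = r n (z n b) by exact: res_comm.
  rewrite /c !opE /= scalerDr scalerA mulii scaleN1r.
  have := r2 a; rewrite (boD hr) /= -/(r n) -!cm => e.
  by rewrite -[X in _ = X + _]e; hring.
have bc n : bnd 2 (c n).
  move=> a; rewrite /c !opE; apply: le_trans (nrD _ _) _; rewrite nri /=.
  have rb1 := res_bnd (pzz n) a; have cb1 := cut_bnd (pzz n) a.
  have : nr (z n (r n a)) <= nr a.
    apply: nr_le; first exact: nr_ge0.
    rewrite -sz -[z n (z n _)]/((z n \o z n) (r n a)) -(cut_x (pzz n)).
    apply: le_trans (rd_le _ _) _; rewrite expr2; move: rb1 cb1; rewrite !mul1r -/(r n) => rb1 cb1.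
    by apply: ler_pM => //; exact: nr_ge0.
  move: rb1; rewrite mul1r -/(r n); lra.
have hpc n := pi_bo hGNS (Mc n).
have bpc n : bnd 2 (pi (c n)) by apply: (pi_bnd hM hphi hGNS).
pose V := [set k | scvg \oo (fun n => pi (c n) k) (C k)].
have Vi k : V k -> V ('i%C *: k).
  rewrite /V /= => h; rewrite (boZ hC).
  have -> : (fun n => pi (c n) ('i%C *: k)) = fun n => 'i%C *: pi (c n) k.
    by apply: funext => n; rewrite (boZ (hpc n)).
  exact: scvgi.
(* On [(A - i) a] the error is [- pi (c n)] applied to [pi (z n) a - A a], and
   [pi (z n) a = ra a (Lambda (z n))] converges to [ra a chi = A a]. *)
have Va a : rb a -> V (A a - 'i%C *: a).
  move=> ha; rewrite /V /= C2; have [hT sT TL _] := rb_ra ha.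
  apply: (scvg_le (v := fun n => 2 * nr (ra a (Lambda (z n)) - ra a chi))).
    move=> n; rewrite TL ?(hAc _ ha); last by case: (nz n).
    have e : pi (c n) (A a - 'i%C *: a) - a = - pi (c n) (pi (z n) a - A a).
      have czE : c n \o z n = idfun + 'i%C *: c n by apply: funext => b /=; rewrite cz !opE.
      have := congr1 (fun f => pi f a) czE.
      rewrite /= (pi_comp hM hphi hGNS (Mc n) (Mz n)) (pi_add hM hphi hGNS (M_id hM) (M_scale hM _ (Mc n))).
      rewrite (pi_scale hM hphi hGNS _ (Mc n)) (pi_id hM hGNS) !opE /= => e.
      rewrite !(boB (hpc n)) (boZ (hpc n)) e.
      move: (pi (c n) (A a)) (pi (c n) a) => s t; hring.
    by rewrite e nrN; exact: bpc.
  by apply: cvg0M; exact: (bo_scvg hT zchi).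
have tV : tot V.
  apply: orth_tot.
  - rewrite /V /= (bo0 hC); have -> : (fun n => pi (c n) 0) = fun=> 0.
      by apply: funext => n; rewrite (bo0 (hpc n)).
    exact: scvg_cst.
  - move=> k l hk hl; rewrite /V /= (boD hC).
    have -> : (fun n => pi (c n) (k + l)) = fun n => pi (c n) k + pi (c n) l.
      by apply: funext => n; rewrite (boD (hpc n)).
    exact: scvgD.
  - move=> t k hk; rewrite /V /= (boZ hC).
    have -> : (fun n => pi (c n) (t%:C *: k)) = fun n => t%:C *: pi (c n) k.
      by apply: funext => n; rewrite (boZ (hpc n)).
    exact: scvgZ.
  - move=> w hw; have v0 : A w + 'i%C *: w = 0.
      apply: rb_orth => a ha; split.
        by have := hw _ (Va _ ha); rewrite rdBr rdDl rdiC sA.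
      have := hw _ (Vi _ (Va _ ha)); rewrite scalerBr rdBr rdDl rdiC -(boZ hA) sA.
      by rewrite scalerA.
    have := congr1 (fun u => rd u ('i%C *: w)) v0.
    by rewrite rdDl sa_i0 // rdi rd0l add0r => /rd_eq0.
have piC k : scvg \oo (fun n => pi (c n) k) (C k).
  have two : (0 : R) <= 2 by [].
  exact: (scvg_tot tV two (fun n => bo_lin (hpc n)) bpc hC (fun d h => h)).
have [||y [My by' cy piy]] := @pi_closed _ _ _ _ _ _ _ hM hphi hGNS c 2 _ (fun n => conj (Mc n) (bc n)).
- by [].
- by move=> k; exists (C k); exact: piC.
have pyC : pi y = C by apply: funext => k; exact: (scvg_uniq (F := \oo) (piy k) (piC k)).
have hy := M_bo hM My.
have [L L0 bA] := bo_bnd hA.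
(* [C] is bounded below because [A - i] is bounded. By [pos_reflect] this holds for [y] too, and
   [(y^* y)^-1 y^*] is a left inverse of [y] in [M]. *)
pose m := ((L + 1) ^+ 2)^-1.
have L1 : 0 < L + 1 by rewrite ltr_wpDl.
have m0 : 0 < m by rewrite invr_gt0 exprn_gt0.
have Ck k : m * rd k k <= rd (C k) (C k).
  rewrite /m ler_pdivrMl ?exprn_gt0 // -!nr2 -exprMn (@ler_pXn2r _ 2) ?nnegrE ?mulr_ge0 ?nr_ge0 ?(ltW L1) //.
  rewrite -{1}(C1 k); apply: le_trans (nrD _ _) _; rewrite nrN nri mulrDl mul1r lerD2r; exact: bA.
have Msy := M_sq hM My; have psy := sq_psa hM My; have [hsy ssy _] := psy.
have Mm : M (m%:C *: idfun) by apply: (M_scale hM); exact: (M_id hM).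
have pos_m : psa (sq y - m%:C *: idfun).
  apply: (pos_reflect hM hphi hGNS); first exact: (M_sub hM).
  rewrite (pi_sub hM hphi hGNS Msy Mm) (pi_scale hM hphi hGNS _ (M_id hM)) (pi_id hM hGNS).
  apply: psaB; first by apply: psaZ; [exact: ltW|exact: psa_id].
    by apply: (pi_psa hM hphi hGNS).
  move=> k; rewrite opE rdZl /= /sq (pi_comp hM hphi hGNS (M_adj hM My) My) /= (pi_adj hM hphi hGNS My).
  by rewrite rdC (rd_adjr (bo_adj (pi_bo hGNS My))) (adjK (pi_bo hGNS My)) pyC.
have [|N [hN sN N1 N2]] := pos_inv hsy ssy m0.
  move=> a; have [_ _ /(_ a)] := pos_m; rewrite opE opNE opZE rdBl rdZl /=.
  by rewrite subr_ge0.
have MN := M_inv hM Msy hN N1 N2.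
pose z' := N \o adj y; have Mz' : M z' by apply: (M_comp hM) => //; exact: (M_adj hM).
have z'y : z' \o y = idfun by apply: funext => a; exact: N2.
pose x : H -> H := z' + 'i%C *: idfun.
have Mi := M_id hM.
have Mx : M x by apply: (M_add hM) => //; exact: (M_scale hM).
have pz' k : pi z' (C k) = k.
  have := congr1 (fun f => pi f k) z'y; rewrite /= (pi_comp hM hphi hGNS Mz' My) (pi_id hM hGNS) /=.
  by rewrite pyC.
have px : pi x = A.
  apply: funext => k; rewrite (pi_add hM hphi hGNS Mz' (M_scale hM _ Mi)) (pi_scale hM hphi hGNS _ Mi).
  rewrite (pi_id hM hGNS) !opE /= -{1}(C2 k) pz'.
  by rewrite subrK.
have sx : sa x by apply: (sa_reflect hM hphi hGNS) => //; rewrite px.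
(* The products [c n \o z n = 1 + i c n] are bounded, so [Lam_closed] applies to them: [1 + i y] has
   the GNS vector [C chi]. Multiplying by [z'] on the left removes [C]. *)
pose kk n : H -> H := c n \o z n; pose kl : H -> H := idfun + 'i%C *: y.
have kkE n : kk n = idfun + 'i%C *: c n by apply: funext => a; rewrite /kk /= cz !opE.
have [|||||nk Lk] := @Lam_closed _ _ _ _ _ _ _ hM hphi hGNS kk kl (C chi) 3.
- by [].
- by apply: (M_add hM) => //; exact: (M_scale hM).
- move=> n; split; first by apply: (n_comp hM hphi) => //; case: (nz n).
  move=> a; rewrite kkE !opE /=; apply: le_trans (nrD _ _) _; rewrite nri.
  by have := bc n a; lra.
- move=> a; rewrite /kl !opE /=.
  have -> : (fun n => kk n a) = fun n => a + 'i%C *: c n a by apply: funext => n; rewrite kkE !opE.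
  by apply: scvgD; [exact: scvg_cst|exact: scvgi].
- have -> : (fun n => Lambda (kk n)) = fun n => pi (c n) (Lambda (z n)).
    by apply: funext => n; rewrite (pi_L hGNS (Mc n)) //; case: (nz n).
  apply: (@scvg_bnd _ _ _ _ _ (fun n => pi (c n)) C _ _ 2) => //.
  by move=> n; exact: bo_lin.
have xE : x = z' \o kl.
  apply: funext => a; have hz' := M_bo hM Mz'.
  rewrite /kl /x !opE /= (boD hz') (boZ hz').
  by have -> : z' (y a) = a by exact: (congr1 (fun f => f a) z'y).
exists x; split=> //; first by rewrite xE; exact: (n_comp hM hphi).
by rewrite xE -(pi_L hGNS Mz' nk) Lk pz'.
Qed.

End RightAction.

(** * Weak limits along an ultrafilter and powers of positive contractions *)

Section WeakLimits.
Context {R : realType} {K : hilbert R}.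
Implicit Types (a b c k l : K).

Lemma ultra_real {T} (F : set_system T) {FU : UltraFilter F} (f : T -> R) (C : R) :
  (forall n, `|f n| <= C) -> exists l : R, f @ F --> l.
Proof.
move=> fC; have PF := @ultra_proper _ F FU.
have [|l [_ cl]] := @segment_compact R (- C) C (f @ F) _.
  have h n : - C <= f n <= C by rewrite -ler_norml.
  suff : F (f @^-1` `[- C, C]%classic) by [].
  by apply: filterE => n; rewrite /= in_itv /=; exact: h.
exists l => B nB; have [//|h] := in_ultra_setVsetC (f @^-1` B) FU.
by have [y []] := cl (~` B) B h nB.
Qed.

Definition wcvg {T} (F : set_system T) (x : T -> K) l :=
  forall c, rd (x n) c @[n --> F] --> rd l c.

Lemma wcvg_uniq {T} (F : set_system T) {FF : ProperFilter F} (x : T -> K) l l' :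
  wcvg F x l -> wcvg F x l' -> l = l'.
Proof.
move=> h h'; apply: rd_inj => c.
exact: (limR_uniq (h c) (h' c)).
Qed.

(** Along one ultrafilter all bounded sequences of vectors have weak limits at once, and the limits
    depend linearly on the sequences. *)
Lemma wlim {T} (F : set_system T) {FU : UltraFilter F} (x : T -> K) (C : R) :
  (forall n, nr (x n) <= C) -> exists2 l, nr l <= C & wcvg F x l.
Proof.
move=> xC; have PF := @ultra_proper _ F FU.
have [[n0 _]|noT] := pselect (exists n : T, True); last first.
  have := @filter_not_empty _ F PF; rewrite (_ : set0 = setT); first by move=> /(_ filterT).
  by rewrite predeqE => t; split=> // _; apply: noT; exists t.
have C0 : 0 <= C by apply: le_trans (xC n0); exact: nr_ge0.
have ex c : exists l : R, rd (x n) c @[n --> F] --> l.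
  apply: (@ultra_real _ F FU _ (C * nr c)) => n; apply: le_trans (rd_cs _ _) _.
  by rewrite ler_wpM2r ?nr_ge0.
have /choice[f fP] := ex.
have [|||v vP] := @riesz_rd _ K f (C ^+ 2).
- move=> a b; apply: (limR_uniq (fP _)).
  rewrite (_ : (fun n => rd (x n) (a + b)) = (fun n => rd (x n) a + rd (x n) b)).
    by apply: cvgD; exact: fP.
  by apply: funext => n; rewrite rdDr.
- move=> k a; apply: (limR_uniq (fP _)).
  rewrite (_ : (fun n => rd (x n) (k%:C *: a)) = (fun n => k * rd (x n) a)).
    by apply: cvgMr; exact: fP.
  by apply: funext => n; rewrite rdZr.
- move=> a; have h : f a <= C * nr a /\ - (C * nr a) <= f a.
    have b n : `|rd (x n) a| <= C * nr a.
      by apply: le_trans (rd_cs _ _) _; rewrite ler_wpM2r ?nr_ge0.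
    split; [apply: (cvg_ub _ (fP a))|apply: (cvg_lb _ (fP a))] => n;
      by have := b n; rewrite ler_norml => /andP[].
  rewrite -nr2 -exprMn -[f a ^+ 2]real_normK ?num_real //.
  rewrite (@ler_pXn2r _ 2) ?nnegrE ?mulr_ge0 ?nr_ge0 //.
  by rewrite ler_norml; case: h => -> ->.
have wl : wcvg F x v by move=> c; rewrite rdC -vP.
exists v => //; apply: nr_le => //.
have h : rd v v <= C * nr v.
  apply: (cvg_ub _ (wl v)) => n; apply: le_trans (rd_le _ _) _.
  by rewrite ler_wpM2r ?nr_ge0.
rewrite -nr2 in h *; have := nr_ge0 v; rewrite le0r => /orP[/eqP ->|v0].
  by rewrite expr0n sqr_ge0.
move: h; rewrite expr2 ler_pM2r // => h; by rewrite -expr2 (@ler_pXn2r _ 2) ?nnegrE ?nr_ge0.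
Qed.

Lemma wcvg_bo {T} (F : set_system T) {FF : Filter F} (A : K -> K) (x : T -> K) l :
  bo A -> wcvg F x l -> wcvg F (fun n => A (x n)) (A l).
Proof.
move=> hA h c; rewrite (rd_adj hA).
by rewrite (_ : (fun n => rd (A (x n)) c) = fun n => rd (x n) (adj A c)) //; apply: funext => n; rewrite (rd_adj hA).
Qed.

Lemma wlim_op {T} (F : set_system T) {FU : UltraFilter F} (x : T -> K -> K) (C : R) : 0 <= C ->
  (forall n, linear (x n)) -> (forall n, bnd C (x n)) ->
  exists y : K -> K, [/\ bo y, bnd C y & forall a, wcvg F (fun n => x n a) (y a)].
Proof.
move=> C0 lx bx; have PF := @ultra_proper _ F FU.
have /choice[y yP] a : exists l, nr l <= C * nr a /\ wcvg F (fun n => x n a) l.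
  by have [l ? ?] := @wlim _ F FU (fun n => x n a) (C * nr a) (fun n => bx n a); exists l.
have by_ : bnd C y by move=> a; case: (yP a).
have wy a : wcvg F (fun n => x n a) (y a) by case: (yP a).
exists y; split=> //; apply: (bo_mk _ C0 by_) => k a b; apply: (wcvg_uniq (wy _)) => c.
rewrite (_ : (fun n => rd (x n (k *: a + b)) c) = fun n => rd (k *: x n a) c + rd (x n b) c); last first.
  by apply: funext => n; rewrite (lx n) rdDl.
rewrite rdDl; apply: cvgD; last exact: wy.
by apply: (wcvg_bo (A := fun v => k *: v)); [exact: (bo_scale k bo_id)|exact: wy].
Qed.

(** The powers of [W] decrease, so they converge strongly, and the limit vectors are fixed by
    [W]. *)
Lemma power_lim (W : K -> K) : psa W -> ole W idfun -> (forall k, W k = k -> k = 0) ->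
  forall k, scvg \oo (fun n => iter n W k) 0.
Proof.
move=> [hW sW pW] W1 ker.
have bW : bnd 1 W.
  by apply: ole_bnd => // a; rewrite mul1r; exact: W1.
have hi n : bo (iter n W) by exact: bo_iter.
have si n : sa (iter n W) by exact: sa_iter.
(* Splitting the exponent in two halves reduces odd and even [n] to [W^2 <= W] and [W <= 1]. *)
have half n a : rd (iter n.+1 W a) a <= rd (iter n W a) a /\ 0 <= rd (iter n W a) a.
  have e0 m : rd (iter (m + m) W a) a = rd (iter m W a) (iter m W a) by rewrite iterD si.
  have e1 m : rd (iter (m + m).+1 W a) a = rd (W (iter m W a)) (iter m W a).
    by rewrite -addnS iterD si.
  have W2 b : rd (W b) (W b) <= rd (W b) b.
    by have := pos_le hW sW pW (C := 1) _ b; rewrite mul1r; apply=> c; rewrite mul1r; exact: W1.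
  have := odd_double_half n; rewrite -addnn; case: (odd n) => <-; rewrite ?add1n ?add0n.
    rewrite e1 -addnS -addSn e0; split; [exact: W2|exact: pW].
  by rewrite e1 e0; split; [exact: W1|exact: rd_ge0].
pose x n := (idfun : K -> K) - iter n W.
have le1 n a : rd (iter n W a) a <= rd a a.
  elim: n => [|n IH]; first by [].
  by have [h _] := half n a; exact: le_trans h IH.
have px n : [/\ bo (x n), sa (x n) & pos (x n)].
  split; [exact: bo_sub bo_id (hi n)|exact: saB sa_id (si n)|].
  by move=> a; rewrite /x opE opNE rdBl subr_ge0; exact: le1.
have xm n : ole (x n) (x n.+1).
  move=> a; rewrite /x !opE !rdBl lerD2l lerN2.
  by have [h _] := half n a.
have x1 n a : rd (x n a) a <= 1 * rd a a.
  rewrite /x opE opNE rdBl mul1r lerBlDr lerDl.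
  by have [_ h] := half n a.
have [y [hy _ _ xy _]] := mono_lim ler01 px xm x1.
move=> k; have Wk : scvg \oo (fun n => iter n W k) (k - y k).
  have -> : (fun n => iter n W k) = fun n => k - x n k.
    by apply: funext => n; rewrite /x opE opNE subKr.
  by apply: scvgB; [exact: scvg_cst|exact: xy].
suff e : k - y k = 0 by rewrite -e.
apply: ker; apply: (scvg_uniq (F := \oo) (u := fun n => iter n.+1 W k)).
  exact: (bo_scvg hW Wk).
apply/scvgP => e e0; have /scvgP/(_ e e0)[N _ hN] := Wk.
by exists N => // n /= Nn; apply: (hN n.+1); rewrite /= leqW.
Qed.

End WeakLimits.

(** * The weight recovered from the vectors [R Lambda e_n] *)

Section HalfTrace.
Context {R : realType} {H K : hilbert R} (M : set (op H)) (phi : op H -> \bar R).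
Context (Lambda : op H -> K) (pi : op H -> op K) (J : op K) (G : set (K * K)).
Hypothesis hM : von_neumann_algebra M.
Hypothesis hphi : fns_weight M phi.
Hypothesis hGNS : is_gns M phi Lambda pi.
Hypothesis hJ : antiunitary J.
Hypothesis hG : pos_selfadjoint_graph G.
Hypothesis hS : tomita_graph M phi Lambda = [set (p.1, J p.2) | p in G].
Implicit Types (x y z : H -> H) (k l a b v w : K).

Local Notation nphi := (nphi M phi).
Local Notation Fg := (Fg M phi Lambda).
Local Notation Sg := (Sg M phi Lambda).
Local Notation Rt := (Rt J G).
Local Notation rb := (rb M phi Lambda J G).
Local Notation ra := (ra M phi Lambda pi).
Let RP := rb_ra hM hphi hGNS hJ hG hS.
Let FR := Fg_ra hM hphi hGNS hJ hG hS.

Lemma rbD a b : rb a -> rb b -> rb (a + b).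
Proof.
move=> [x [nx sx ->]] [y [ny sy ->]]; exists (x + y); split.
- exact: (n_add hM hphi).
- exact: saD.
- by rewrite (LamD hGNS nx ny) (boD (Rt_bo hJ hG)).
Qed.
Lemma rbZ (t : R) a : rb a -> rb (t%:C *: a).
Proof.
move=> [x [nx sx ->]]; exists (t%:C *: x); split.
- exact: (n_scale hM hphi).
- exact: saZ.
- by rewrite (LamZ hM hphi hGNS _ nx) (boZ (Rt_bo hJ hG)).
Qed.

Lemma n2_orth v : (forall x, nphi x -> sa x -> rd v (Lambda x) = 0 /\ rd v ('i%C *: Lambda x) = 0) -> v = 0.
Proof.
move=> h; apply: (tot_orth (tot_n2 hJ hG hS)) => _ [x nx <-].
have [x1 [x2 [[n1 s1] [n2' s2] -> _]]] := n2_re hM hphi nx.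
have ni := n_scale hM hphi 'i%C n2'.
rewrite (LamD hGNS n1 ni) (LamZ hM hphi hGNS _ n2') rdC rdDr.
have [-> _] := h _ n1 s1; have [_ ->] := h _ n2' s2; exact: addr0.
Qed.

(* [rb] is dense in the real space of vectors fixed by [F], and [F^* = S]. *)
Lemma Sg_of_rb chi : (forall a, rb a -> rd chi ('i%C *: a) = 0) -> Sg chi chi.
Proof.
move=> h.
have rb0 : rb 0.
  exists 0; split; [exact: (n_0 hM hphi)|exact: sa0|].
  by rewrite (Lam0 hM hphi hGNS) (bo0 (Rt_bo hJ hG)).
pose V := closure rb.
have Vseq w : V w -> exists2 u : nat -> K, (forall n, rb (u n)) & scvg \oo u w.
  move=> /closure_nr hw; have [eps [e0 eN]] := eps_seq R.
  have /choice[u uP] (n : nat) : exists p, rb p /\ nr (w - p) <= eps n.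
    by have [p ? ?] := hw _ (e0 n); exists p.
  exists u; first by move=> n; case: (uP n).
  apply/scvgP => e /eN[N hN]; exists N => // n /= Nn; rewrite nrB.
  by case: (uP n) => _ /le_trans; apply; exact: hN.
have VF w : V w -> Fg w w.
  move=> /Vseq[u ru uw] a b Sab.
  have L1 : rd b (u n) @[n --> \oo] --> rd b w by apply: rd_cvg => //; exact: scvg_cst.
  have L2 : rd (u n) a @[n --> \oo] --> rd w a by apply: rd_cvg => //; exact: scvg_cst.
  apply: (limR_uniq L1); rewrite (_ : (fun n => rd b (u n)) = fun n => rd (u n) a) //.
  by apply: funext => n; exact: (rb_Fg hM hJ hG hS (ru n)).
have Vchi w : V w -> rd chi ('i%C *: w) = 0.
  move=> /Vseq[u ru uw].
  have L1 : rd chi ('i%C *: u n) @[n --> \oo] --> rd chi ('i%C *: w).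
    by apply: rd_cvg; [exact: scvg_cst|exact: scvgi].
  apply: (limR_uniq L1); rewrite (_ : (fun n => rd chi ('i%C *: u n)) = fun=> 0); first exact: cvg_cst.
  by apply: funext => n; exact: h.
(* [q = w - p] is fixed by [F] and orthogonal to [rb]. Paired with [S a = Lambda x - a] and with
   [S (i Lambda x) = - i Lambda x], it is orthogonal to every [Lambda x] and [i Lambda x]. *)
have key w : Fg w w -> rd chi ('i%C *: w) = 0.
  move=> Fw; have [p Vp hp] := proj_closure rb0 rbD rbZ w.
  suff q0 : w - p = 0 by rewrite (subr0_eq q0); exact: Vchi.
  have Fq : Fg (w - p) (w - p) by apply: (Fg_B Fw); exact: VF.
  apply: n2_orth => x nx sx; have [Fa Sa] := rb_FS hM hJ hG hS nx sx.
  have rx : rb (Rt (Lambda x)) by exists x.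
  have e0 : rd (w - p) (Rt (Lambda x)) = 0 by apply: hp.
  have := Fq _ _ Sa; rewrite e0 rdC rdBr e0 subr0 => e1.
  have := Fq _ _ (Sg_i hJ hG hS (Sg_sa hM nx sx)); rewrite scaleNr rdNl => e2.
  by split=> //; move: e2; rewrite rdC; lra.
apply: (Sg_dual hJ hG hS) => a b Fab.
have Fba := Fg_swap hM Fab.
have F1 := Fg_D Fab Fba; rewrite [b + a]addrC in F1; have k1 := key _ F1.
have Fi : Fg ('i%C *: (a - b)) ('i%C *: (a - b)).
  have := Fg_i hJ hG hS (Fg_B Fab Fba).
  by rewrite scaleNr -scalerN opprB.
have := key _ Fi; rewrite scalerA.
rewrite mulii.
rewrite scaleN1r rdNr rdBr (rdC b); lra.
Qed.

(** [R k = k] means [S F k = 0], and both operators are injective. *)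
Lemma Rt_fix k : Rt k = k -> k = 0.
Proof.
move=> e; have [v h1 h2] := RtP hJ hG hS k; rewrite e subrr in h1 h2.
have S0 : Sg 0 0.
  have := Sg_sa (Lambda := Lambda) hM (n_0 hM hphi) (@sa0 _ _).
  by rewrite (Lam0 hM hphi hGNS).
have v0 : v = 0 by apply: (Sg_fun hJ hG hS (Sg_swap hM h2)).
rewrite v0 in h1; have := G_ker0 hM hJ hG hS ((Fg_G hJ hG hS k 0).1 h1) => k0.
by rewrite -(JinvK hJ k) k0; apply: (@addrI _ (J 0)); rewrite -(JD hJ) !addr0.
Qed.

Section Approx.
Variables (U : set_system nat) (e : nat -> H -> H).
Hypothesis UU : UltraFilter U.
Hypothesis subU : \oo `<=` U.
Hypothesis ne : forall n, nphi (e n).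
Hypothesis se : forall n, sa (e n).
Hypothesis be : forall n, bnd 1 (e n).
Hypothesis pe : forall k, scvg \oo (fun n => pi (e n) k) k.

Let eta n := Rt (Lambda (e n)).
Let T n := ra (eta n).

Let PU : ProperFilter U := @ultra_proper _ U UU.
Local Existing Instance PU.

Let rbe n : rb (eta n). Proof. by exists (e n). Qed.
Let TP n : [/\ bo (T n), sa (T n), bnd (1 / 2) (T n) &
  (forall y, nphi y -> T n (Lambda y) = pi y (eta n)) /\
  forall y, M y -> forall k, T n (pi y k) = pi y (T n k)].
Proof.
by have [? ? ? ? ?] := raP hM hphi hGNS hJ hG hS (ne n) (se n) ler01 (be n); split.
Qed.
Let Fe n : Fg (eta n) (eta n) /\ Sg (eta n) (Lambda (e n) - eta n).
Proof. exact: (rb_FS hM hJ hG hS (ne n) (se n)). Qed.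
Let Fe1 n a : rb a -> Fg (ra a (eta n)) (T n a).
Proof.
move=> ra_; have [h1 h2 _ h4] := RP ra_; have [k1 k2 _ [_ k4]] := TP n.
by apply: (@FR (eta n) a (ra a) (T n)) => // k l; rewrite -/(T n) k2 h2.
Qed.
Let peU k : scvg U (fun n => pi (e n) k) k. Proof. exact: scvg_sub subU (pe k). Qed.

(** [F (ra a (eta n)) = T n a], paired with [S a' = Lambda x' - a'] and with its multiple by [i]. *)
Let rel a x' n : rb a -> nphi x' -> sa x' ->
  rd (Rt (Lambda x')) (ra a (eta n)) = rd (T n a) (Lambda x' - Rt (Lambda x')) /\
  rd (Rt (Lambda x')) ('i%C *: ra a (eta n)) = rd (T n a) ('i%C *: (Lambda x' - Rt (Lambda x'))).
Proof.
move=> rba nx' sx'; have [Fa' Sa'] := rb_FS hM hJ hG hS nx' sx'.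
set a' := Rt (Lambda x') in Fa' Sa' *.
have [hA sA AL cA] := RP rba; have [hT sT _ [TL cT]] := TP n.
have hx' := pi_bo hGNS (n_M nx'); have spx := pi_sa hM hphi hGNS (n_M nx') sx'.
have F1 := Fe1 n rba; split.
  have := F1 _ _ Sa'; rewrite rdBl -sA AL // spx -TL // -sT rdBr; lra.
have := F1 _ _ (Sg_i hJ hG hS Sa'); rewrite scaleNr rdNl rdiC opprK rdBl -(boZ hA) -sA AL //.
have -> : rd (pi x' a) ('i%C *: eta n) = rd (T n a) ('i%C *: Lambda x').
  by rewrite spx (boZ hx') -TL // -(boZ hT) -sT.
rewrite scalerBr rdBr; lra.
Qed.

(** [F (ra a b) = ra b a], paired with [S (eta n) = Lambda (e n) - eta n] and with its multiple by
    [i]. *)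
Let rel2 a b n : rb a -> rb b ->
  rd (pi (e n) a) b = rd (ra a (eta n)) b + rd (ra b (eta n)) a /\
  rd (pi (e n) a) ('i%C *: b) = - rd ('i%C *: ra a (eta n)) b + rd a ('i%C *: ra b (eta n)).
Proof.
move=> rba rbb; have [hA sA AL cA] := RP rba; have [hB sB BL cB] := RP rbb.
have [_ Se] := Fe n.
have F1 : Fg (ra a b) (ra b a) by apply: (@FR b a (ra a) (ra b)) => // k l; rewrite sB sA.
split.
  have := F1 _ _ Se; rewrite rdBl -sA AL // -(sA (eta n)) (rdC (ra b a)) -sB; lra.
have E := F1 _ _ (Sg_i hJ hG hS Se).
rewrite scaleNr rdNl rdiC opprK rdBl in E.
have E1 : rd (Lambda (e n)) ('i%C *: ra a b) = rd (pi (e n) a) ('i%C *: b).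
  by rewrite -(boZ hA) -sA AL.
have E2 : rd (eta n) ('i%C *: ra a b) = - rd ('i%C *: ra a (eta n)) b.
  by rewrite -(boZ hA) -sA rdiC opprK.
have E3 : rd (ra b a) ('i%C *: eta n) = rd a ('i%C *: ra b (eta n)) by rewrite sB (boZ hB).
move: E; rewrite E1 E2 E3; lra.
Qed.

(* [s = 1/2 - lim T_n] satisfies [R s D + D s R = 0] with [D = 1 - R], so [s = R s R + D s D];
   iterating, the form of [s] is dominated by that of [(R^2 + D^2)^n], which tends to [0]. *)
Lemma T_half a : wcvg U (fun n => T n a) (2^-1%:C *: a).
Proof.
have h2 : (0 : R) <= 1 / 2 by rewrite divr_ge0.
have lT n : linear (T n) by have [/bo_lin] := TP n.
have bT n : bnd (1 / 2) (T n) by have [] := TP n.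
have [T0 [hT0 bT0 wT]] := @wlim_op _ _ _ U UU T _ h2 lT bT.
suff E : T0 = 2^-1%:C *: idfun by move: (wT a); rewrite E.
have sT0 : sa T0.
  move=> k l; have L := wT k l; have L2 := wT l k; apply: (limR_uniq L).
  rewrite rdC (_ : (fun n => rd (T n k) l) = fun n => rd (T n l) k) //.
  by apply: funext => n; have [_ sT _ _] := TP n; rewrite sT rdC.
have [hR sR pR] := Rt_psa hJ hG.
pose D := (idfun : K -> K) - Rt.
have hD : bo D by apply: bo_sub => //; exact: bo_id.
have sD : sa D by apply: saB => //; exact: sa_id.
have DE k : D k = k - Rt k by rewrite /D opE opNE.
pose s := 2^-1%:C *: (idfun : K -> K) - T0.
have hs : bo s by apply: bo_sub => //; apply: bo_scale; exact: bo_id.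
have ss : sa s by apply: saB => //; apply: saZ; exact: sa_id.
have sE k : s k = 2^-1%:C *: k - T0 k by rewrite /s opE opNE opZE.
(* Eliminating [ra a (eta n)] between [rel] and [rel2] and passing to the limit gives a linear
   equation for [T0]. By [F a0 = a0] and [S a' = d'] the operator [1/2] solves it as well, so the
   difference [s] solves the homogeneous equation [Q = 0]. *)
pose Q := (D \o s \o Rt) + (Rt \o s \o D).
have hQ : bo Q by apply: bo_add; apply: bo_comp => //; exact: bo_comp.
have Q0 x : nphi x -> sa x -> Q (Lambda x) = 0.
  move=> nx sx; apply: n2_orth => x' nx' sx'.
  have rx : rb (Rt (Lambda x)) by exists x.
  have rx' : rb (Rt (Lambda x')) by exists x'.
  have [Fa Sa] := rb_FS hM hJ hG hS nx sx; have [Fa' Sa'] := rb_FS hM hJ hG hS nx' sx'.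
  have c1 := Fa _ _ Sa'; have c2 := Fa _ _ (Sg_i hJ hG hS Sa').
  have c3 := Fa' _ _ Sa; have c4 := Fa' _ _ (Sg_i hJ hG hS Sa).
  have q1 b : rd (Q (Lambda x)) b = rd (s (Rt (Lambda x))) (D b) + rd (D (Lambda x)) (s (Rt b)).
    by rewrite /Q opE rdDl /= sD (sR _ b) (ss (D _)).
  rewrite !q1 (boZ hD) (boZ hR) !DE.
  move: c1 c2 c3 c4; rewrite -!DE.
  set a0 := Rt (Lambda x) in rx *; set a' := Rt (Lambda x') in rx' *.
  set d := D (Lambda x); set d' := D (Lambda x') => c1 c2 c3 c4.
  have L1 : rd (pi (e n) a0) a' @[n --> U] --> rd a0 a' by apply: rd_cvg; [exact: peU|exact: scvg_cst].
  have L2 : rd (pi (e n) a0) ('i%C *: a') @[n --> U] --> rd a0 ('i%C *: a').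
    by apply: rd_cvg; [exact: peU|exact: scvg_cst].
  have f1 : rd a0 a' = rd (T0 a0) d' + rd (T0 a') d.
    apply: (limR_uniq L1); rewrite (_ : (fun n => _) = fun n => rd (T n a0) d' + rd (T n a') d).
      by apply: cvgD; exact: wT.
    apply: funext => n; have [-> _] := rel2 n rx rx'.
    have [r1 _] := rel n rx nx' sx'; have [r2 _] := rel n rx' nx sx.
    by rewrite rdC r1 (rdC (ra a' _)) r2 /d' /d !DE.
  have f2 : rd a0 ('i%C *: a') = - rd (T0 a0) ('i%C *: d') + rd (T0 a') ('i%C *: d).
    apply: (limR_uniq L2); rewrite (_ : (fun n => _) = fun n => - rd (T n a0) ('i%C *: d') + rd (T n a') ('i%C *: d)).
      by apply: cvgD; [apply: cvgN; exact: wT|exact: wT].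
    apply: funext => n; have [_ ->] := rel2 n rx rx'.
    have [_ r1] := rel n rx nx' sx'; have [_ r2] := rel n rx' nx sx.
    by rewrite rdC r1 r2 /d' /d !DE.
  move: c2 c4; rewrite !scaleNr !rdNl !rdiC !opprK => c2 c4.
  have S1 b w : rd (s b) w = 2^-1 * rd b w - rd (T0 b) w by rewrite sE rdBl rdZl.
  have I b w : rd b ('i%C *: w) = - rd w ('i%C *: b) by rewrite (rdC b) rdiC.
  split; first by rewrite S1 (rdC d) S1 (rdC a0 d') c1 (rdC a' d) c3 (rdC a' a0); move: f1; lra.
  rewrite (boZ hs) (I d (s a')) !S1 (I a0 d') c2 (I a' d) c4 (I a' a0); move: f2; lra.
have Qz : Q = 0.
  apply: (bo_eq_tot (tot_n2 hJ hG hS)) => //; first exact: bo_zero.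
  move=> _ [x nx <-]; have [x1 [x2 [[n1 s1] [n2' s2] -> _]]] := n2_re hM hphi nx.
  have ni := n_scale hM hphi 'i%C n2'.
  by rewrite (LamD hGNS n1 ni) (LamZ hM hphi hGNS _ n2') (boD hQ) (boZ hQ) !Q0 // scaler0 addr0.
have sq k : s k = Rt (s (Rt k)) + D (s (D k)).
  have q : D (s (Rt k)) + Rt (s (D k)) = 0.
    by have := congr1 (fun f => f k) Qz; rewrite /Q !opE.
  have e0 : s k = s (Rt k) + s (D k) by rewrite -(boD hs) DE addrC subrK.
  have e1 b : b = Rt b + D b by rewrite DE addrC subrK.
  rewrite {1}e0 {1}(e1 (s (Rt k))) {1}(e1 (s (D k))).
  by rewrite -[RHS]addr0 -q; hring.
pose W := (Rt \o Rt) + (D \o D).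
have WE k : W k = Rt (Rt k) + D (D k) by rewrite /W opE.
have pW : psa W by apply: psaD; exact: psa_sqs.
have bR : bnd 1 Rt.
  move=> k; rewrite -[Rt k]/(J (resg G (Jinv J k))) (nrJ hJ) -(nrJinv hJ k); have [_ _ b1 _] := resg_bo hG; exact: b1.
have R1 : ole Rt idfun.
  move=> k; apply: le_trans (rd_le _ _) _; rewrite /= -nr2 expr2 ler_wpM2r ?nr_ge0 //.
  by have := bR k; rewrite mul1r.
have R2 k : rd (Rt k) (Rt k) <= rd (Rt k) k.
  have := pos_le hR sR pR (C := 1) _ k; rewrite mul1r; apply=> l; rewrite mul1r; exact: R1.
have W1 : ole W idfun.
  move=> k; rewrite WE rdDl sR sD !DE !rdBl !rdBr (rdC k (Rt k)) /=; have := R2 k; lra.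
have kW k : W k = k -> k = 0.
  rewrite WE !DE (boB hR) => h; apply: Rt_fix.
  have h0 : Rt (Rt k) - Rt k + (Rt (Rt k) - Rt k) = 0.
    apply: (@addrI _ k); rewrite addr0 -[RHS]h; hring.
  have h1 : Rt (Rt k - k) = 0.
    rewrite (boB hR); apply: rd_inj => c; have := congr1 (fun v => rd v c) h0.
    by rewrite rdDl rd0l => ?; lra.
  by apply: subr0_eq; exact: (Rt_inj hJ hG h1).
have [C C0 bs] := bo_bnd hs.
have RD k : Rt (D k) = D (Rt k) by rewrite !DE (boB hR).
have WR k : W (Rt k) = Rt (W k) by rewrite !WE (boD hR) !RD.
have WD k : W (D k) = D (W k).
  have [hW _ _] := pW; rewrite !(DE _) (boB hW) WR; congr (_ - _).
have key n k l : `|rd (s k) l| <= C * (rd (iter n W k) k + rd (iter n W l) l).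
  elim: n k l => [|n IH] k l.
    apply: le_trans (rd_cs _ _) _; rewrite /= -!nr2.
    apply: (@le_trans _ _ (C * nr k * nr l)); first by rewrite ler_wpM2r ?nr_ge0.
    rewrite -mulrA ler_wpM2l //; move: (nr_ge0 k) (nr_ge0 l); move: (nr k) (nr l) => p q; nra.
  have split_W b : rd (iter n.+1 W b) b = rd (iter n W (Rt b)) (Rt b) + rd (iter n W (D b)) (D b).
    rewrite iterSr WE (boD (bo_iter n (let: And3 h _ _ := pW in h))) rdDl.
    rewrite -(iter_commute n (fun k => esym (WR k))) -(iter_commute n (fun k => esym (WD k))).
    by rewrite sR sD.
  rewrite sq rdDl sR sD; apply: le_trans (ler_normD _ _) _.
  apply: le_trans (lerD (IH _ _) (IH _ _)) _; rewrite !split_W.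
  by rewrite -mulrDr ler_wpM2l //; lra.
have s0 k : s k = 0.
  apply: rd_eq0; apply/eqP; rewrite -normr_le0.
  have L l : rd (iter n W l) l @[n --> \oo] --> (0 : R).
    rewrite -(rd0l l); apply: rd_cvg; last exact: scvg_cst.
    exact: power_lim.
  have L2 : C * (rd (iter n W k) k + rd (iter n W (s k)) (s k)) @[n --> \oo] --> (0 : R).
    by apply: cvg0M; exact: cvg0D.
  exact: (cvg_lb (fun n => key n k (s k)) L2).
by apply: funext => k; have := s0 k; rewrite sE opZE => /eqP; rewrite subr_eq0 => /eqP.
Qed.

(** With [N = |ra a (eta n)|], two instances of [Fg_ra] share a term. Eliminating it leaves [N^2 =
    <pi (e n) a, ra a (eta n)> - <d, T n (T n a)>], at most [|a| N + |d| |a|] in real parts. *)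
Lemma ra_eta_bnd a : rb a -> exists C : R, forall n, nr (ra a (eta n)) <= C.
Proof.
move=> rba; have [x [nx sx ea]] := rba; have [Fa Sa] := rb_FS hM hJ hG hS nx sx.
rewrite -ea in Fa Sa; set d := Lambda x - a in Sa.
have [hA sA AL cA] := RP rba.
exists (nr a + nr d * nr a + 1) => n; have [hT sT bT [TL cT]] := TP n; have [_ Se] := Fe n.
set N := nr _.
have F1 : Fg (ra a (ra a (eta n))) (T n (ra a a)).
  apply: (@FR (eta n) a (ra a \o ra a) (T n \o ra a)) => // [y My k|y My k|k l] /=.
  - by rewrite !cA.
  - by rewrite cA // cT.
  - by rewrite -/(T n) sT !sA.
have F2 : Fg (T n (T n a)) (ra a (T n (eta n))).
  apply: (@FR a (eta n) (T n \o T n) (ra a \o T n)) => // [y My k|y My k|k l] /=.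
  - by rewrite !cT.
  - by rewrite cT // cA.
  - by rewrite -/(T n) sA !sT.
have E1 := F1 _ _ Se; rewrite rdBl in E1.
have E2 := F2 _ _ Sa.
have E3 : rd (Lambda (e n)) (ra a (ra a (eta n))) = rd (pi (e n) a) (ra a (eta n)) by rewrite -sA AL.
have E4 : rd (eta n) (ra a (ra a (eta n))) = N ^+ 2 by rewrite -sA nr2.
have E5 : rd (T n (ra a a)) (eta n) = rd (ra a (T n (eta n))) a by rewrite sT sA rdC.
have b1 : rd (pi (e n) a) (ra a (eta n)) <= nr a * N.
  apply: le_trans (rd_le _ _) _; rewrite ler_wpM2r ?nr_ge0 //.
  have := pi_bnd hM hphi hGNS (n_M (ne n)) ler01 (@be n) a; by rewrite mul1r.
have T1 k : nr (T n k) <= nr k.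
  have := bT k; have := nr_ge0 k; lra.
have b2 : - rd d (T n (T n a)) <= nr d * nr a.
  apply: le_trans (_ : _ <= `|rd d (T n (T n a))|) _; first by rewrite ler_normr lexx orbT.
  apply: le_trans (rd_cs _ _) _; rewrite ler_wpM2l ?nr_ge0 //.
  exact: le_trans (T1 _) (T1 _).
rewrite leNgt; apply/negP => h.
have N0 : 0 <= N by exact: nr_ge0.
move: E1 b1 b2 h N0 (nr_ge0 a) (mulr_ge0 (nr_ge0 d) (nr_ge0 a)).
rewrite E3 E4 E5 -E2; clear E2 E3 E4 E5 F1 F2; clearbody N.
move: N (nr a) (nr d * _) (rd _ _) (rd d _) => N p q A B; nra.
Qed.

(** The weak limit [l] satisfies [F l = a / 2] by [T_half]. As [F a = a] and [F] is its own inverse,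
    [l = a / 2]. *)
Lemma ra_eta_half a : rb a -> wcvg U (fun n => ra a (eta n)) (2^-1%:C *: a).
Proof.
move=> rba; have [C hC] := ra_eta_bnd rba.
have [l _ wl] := @wlim _ _ _ U UU _ C hC.
suff -> : 2^-1%:C *: a = l by [].
have Fa := Fg_Z 2^-1 (rb_Fg hM hJ hG hS rba).
have Fl : Fg l (2^-1%:C *: a).
  move=> b c Sbc; have L1 := wl c; have L2 := @T_half a b.
  rewrite rdC; apply: (limR_uniq L1).
  rewrite (_ : (fun n => _) = fun n => rd (T n a) b) //.
  by apply: funext => n; rewrite rdC (Fe1 n rba Sbc).
exact: (Fg_fun hJ hG hS Fa (Fg_swap hM Fl)).
Qed.

(** The weak limit [chi] of [2 pi y (eta n)] satisfies [ra a chi = pi y a] by [ra_eta_half], which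
    also makes it fixed by [S] through [Sg_of_rb]. So [recover] applies to [pi y] and [chi]. *)
Lemma half_nphi y (C : R) : M y -> sa y -> (forall n, nr (pi y (eta n)) <= C) ->
  nphi y /\ wcvg U (fun n => 2%:C *: pi y (eta n)) (Lambda y).
Proof.
move=> My sy hC; have hy := pi_bo hGNS My; have spy := pi_sa hM hphi hGNS My sy.
have hC2 n : nr (2%:C *: pi y (eta n)) <= 2 * C.
  by rewrite nrZ ger0_norm // ler_pM2l.
have [chi _ wchi] := @wlim _ _ _ U UU _ _ hC2.
have two : (2 : R) * 2^-1 = 1 by field.
have lim_a a k : rb a -> 2 * rd (ra a (eta n)) k @[n --> U] --> rd a k.
  move=> rba; have -> : rd a k = 2 * rd (2^-1%:C *: a) k by rewrite rdZl mulrA two mul1r.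
  by apply: cvgMr; exact: ra_eta_half.
have hAc a : rb a -> ra a chi = pi y a.
  move=> rba; have [hA sA AL cA] := RP rba; apply: rd_inj => c.
  rewrite sA; apply: (limR_uniq (wchi (ra a c))).
  rewrite (_ : (fun n => _) = fun n => 2 * rd (ra a (eta n)) (pi y c)); first by rewrite spy; exact: lim_a.
  by apply: funext => n; rewrite rdZl -sA cA // spy.
have Sc : Sg chi chi.
  apply: Sg_of_rb => a rba; have [hA sA AL cA] := RP rba.
  have h : rd chi ('i%C *: a) = rd a ('i%C *: chi).
    apply: (limR_uniq (wchi ('i%C *: a))).
    rewrite (_ : (fun n => _) = fun n => 2 * rd (ra a (eta n)) ('i%C *: chi)); first exact: lim_a.
    by apply: funext => n; rewrite rdZl spy (boZ hy) -hAc // sA (boZ hA).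
  by move: h; rewrite (rdC a) rdiC; lra.
have [z [nz sz pz Lz]] := recover hM hphi hGNS hJ hG hS hy spy Sc hAc.
have <- : z = y by apply: (pi_inj2 hM hphi hGNS) => //; exact: (n_M nz).
by rewrite Lz pz.
Qed.

(** On each square of [sq_sum] the vectors [2 pi (P n) (eta m)] tend weakly to [Lambda (P n)], and
    the norm is weakly lower semicontinuous. *)
Lemma phi_le_half x (C : R) : M x -> psa x -> ole x idfun ->
  (forall n, 4 * rd (pi x (eta n)) (eta n) <= C) -> (phi x <= C%:E)%E.
Proof.
move=> Mx px x1 hx; have [hbx _ _] := px.
have [P [S [MP S0 SS Sx Slim]]] := sq_sum hM Mx px x1.
have MPP n : M (P n \o P n) /\ psa (P n \o P n).
  by have [MPn sPn] := MP n; split; [exact: (M_comp hM)|apply: psa_sqs => //; exact: (M_bo hM)].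
have MS n : M (S n) /\ psa (S n).
  elim: n => [|n [IH1 IH2]]; first by rewrite S0; split; [exact: (M_0 hM)|exact: psa0].
  by have [? ?] := MPP n; rewrite SS; split; [exact: (M_add hM)|exact: psaD].
have pSx n k : rd (pi (S n) k) k <= rd (pi x k) k.
  have [MSn pSn] := MS n.
  have := pi_psa hM hphi hGNS (M_sub hM Mx MSn) (psaB pSn px (Sx n)).
  by move=> [_ _ /(_ k)]; rewrite (pi_sub hM hphi hGNS Mx MSn) opE opNE rdBl subr_ge0.
have pP n k : rd (pi (P n \o P n) k) k = nr (pi (P n) k) ^+ 2.
  have [MPn sPn] := MP n; rewrite (pi_comp hM hphi hGNS MPn MPn) /=.
  by rewrite (pi_sa hM hphi hGNS MPn sPn) nr2.
have bP n m : nr (pi (P n) (eta m)) <= Num.sqrt (C / 4).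
  rewrite -[nr _]ger0_norm ?nr_ge0 // -sqrtr_sqr ler_wsqrtr // -pP.
  have [MSn pSn] := MS n; have [MPn pPn] := MPP n.
  have := pSx n.+1 (eta m); rewrite SS (pi_add hM hphi hGNS MSn MPn) opE rdDl.
  have [_ _ /(_ (eta m))] := pi_psa hM hphi hGNS MSn pSn; have := hx m; lra.
have nP n : nphi (P n) /\ wcvg U (fun m => 2%:C *: pi (P n) (eta m)) (Lambda (P n)).
  by have [MPn sPn] := MP n; exact: (half_nphi MPn sPn (bP n)).
(* Expanding [|2 pi P eta - Lambda P|^2 >= 0] bounds the quadratic term below by [2 t - s], linear
   in [eta], with [t] tending to [s]. *)
have key n : exists (s : R) (t : nat -> R), [/\ phi (S n) = s%:E, t @ U --> s &
    forall m, 2 * t m - s <= 4 * rd (pi (S n) (eta m)) (eta m)].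
  elim: n => [|n [s [t [IH1 IH2 IH3]]]].
    exists 0, (fun=> 0); rewrite S0 (phi_0 hM hphi); split=> //; first exact: cvg_cst.
    by move=> m; rewrite (pi_0 hM hphi hGNS) rd0l !mulr0 subr0.
  have [MSn pSn] := MS n; have [MPn pPn] := MPP n; have [nPn wPn] := nP n.
  have [MP1 sP1] := MP n.
  exists (s + rd (Lambda (P n)) (Lambda (P n))), (fun m => t m + rd (2%:C *: pi (P n) (eta m)) (Lambda (P n))).
  split.
  - rewrite SS (phiD hM hphi MSn pSn MPn pPn) IH1.
    have -> : P n \o P n = sq (P n) by rewrite /sq sa_adj //; exact: (M_bo hM).
    by rewrite (Lam_phi hM hphi hGNS nPn).
  - by apply: cvgD => //; exact: wPn.
  - move=> m; have := IH3 m; rewrite SS (pi_add hM hphi hGNS MSn MPn) opE rdDl pP.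
    have := rd_ge0 (2%:C *: pi (P n) (eta m) - Lambda (P n)).
    rewrite rdBl !rdBr (rdC (Lambda (P n)) (2%:C *: _)) nr2.
    have -> : rd (2%:C *: pi (P n) (eta m)) (2%:C *: pi (P n) (eta m)) = 4 * rd (pi (P n) (eta m)) (pi (P n) (eta m)).
      by rewrite rdZl rdZr; ring.
    lra.
apply: (phi_lim hM hphi (x := S) MS hbx) => // n.
  by move=> a; rewrite SS opE rdDl lerDl; have [_ [_ _ h]] := MPP n; exact: h.
have [s [t [-> ts hs]]] := key n; rewrite lee_fin.
have L : 2 * t m - s @[m --> U] --> 2 * s - s.
  by apply: cvgB; [exact: cvgMr|exact: cvg_cst].
have := cvg_ub (fun m => le_trans (hs m) (le_trans (ler_wpM2l (ler0n _ 4) (pSx n (eta m))) (hx m))) L.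
move=> /(_ PU); lra.
Qed.

(** Valid index by index: [pi P (eta m) = T m (Lambda P)] and [T m] has norm at most [1/2], whence
    the factor [4]. *)
Lemma half_le_phi x (C : R) : M x -> psa x -> ole x idfun -> (phi x <= C%:E)%E ->
  forall n, 4 * rd (pi x (eta n)) (eta n) <= C.
Proof.
move=> Mx px x1 hx m; have [hbx _ _] := px.
have [P [S [MP S0 SS Sx Slim]]] := sq_sum hM Mx px x1.
have MPP n : M (P n \o P n) /\ psa (P n \o P n).
  by have [MPn sPn] := MP n; split; [exact: (M_comp hM)|apply: psa_sqs => //; exact: (M_bo hM)].
have MS n : M (S n) /\ psa (S n).
  elim: n => [|n [IH1 IH2]]; first by rewrite S0; split; [exact: (M_0 hM)|exact: psa0].
  by have [? ?] := MPP n; rewrite SS; split; [exact: (M_add hM)|exact: psaD].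
have Sm n : ole (S n) (S n.+1).
  by move=> a; rewrite SS opE rdDl lerDl; have [_ [_ _ h]] := MPP n; exact: h.
have phiS n : (phi (S n) <= C%:E)%E.
  by have [? ?] := MS n; apply: le_trans hx; apply: (phi_mono hM hphi).
have sqP n : sq (P n) = P n \o P n.
  by have [MPn sPn] := MP n; rewrite /sq sa_adj //; exact: (M_bo hM).
have nP n : nphi (P n).
  have [MPn sPn] := MP n; apply: (n_intro (k := C%:E)) => //; last exact: ltry.
  rewrite sqP; apply: le_trans (phiS n.+1); have [? ?] := MPP n; have [? ?] := MS n.+1.
  apply: (phi_mono hM hphi) => // a; rewrite SS opE rdDl lerDr.
  by have [_ [_ _ h]] := MS n; exact: h.
have [_ _ bT [TL _]] := TP m.
have key n : ((4 * rd (pi (S n) (eta m)) (eta m))%:E <= phi (S n))%E.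
  elim: n => [|n IH].
    by rewrite S0 (pi_0 hM hphi hGNS) rd0l mulr0 (phi_0 hM hphi).
  have [MSn pSn] := MS n; have [MPn pPn] := MPP n; have [MP1 sP1] := MP n.
  rewrite SS (phiD hM hphi MSn pSn MPn pPn) (pi_add hM hphi hGNS MSn MPn) opE rdDl mulrDr EFinD.
  apply: leeD => //; rewrite -sqP (Lam_phi hM hphi hGNS (nP n)) lee_fin sqP.
  rewrite (pi_comp hM hphi hGNS MP1 MP1) /= (pi_sa hM hphi hGNS MP1 sP1) -TL // -!nr2.
  have := bT (Lambda (P n)); have := nr_ge0 (T m (Lambda (P n))); have := nr_ge0 (Lambda (P n)).
  move: (nr (T m _)) (nr (Lambda _)) => p q; nra.
have L : rd (pi (S n) (eta m)) (eta m) @[n --> \oo] --> rd (pi x (eta m)) (eta m).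
  by apply: rd_cvg; [exact: (pi_lim hM hphi hGNS MS hbx Sm Slim)|exact: scvg_cst].
rewrite -ler_pdivlMl //; apply: (cvg_ub _ L) => n; rewrite ler_pdivlMl // -lee_fin.
exact: le_trans (key n) (phiS n).
Qed.

End Approx.
End HalfTrace.

(** * The endomorphism, its isometry and the projection onto the range *)

Section Endomorphism.
Context {R : realType} {H K : hilbert R} (M : set (op H)) (phi : op H -> \bar R).
Context (Lambda : op H -> K) (pi : op H -> op K).
Context (theta : op H -> op H) (u : op K).
Hypothesis hM : von_neumann_algebra M.
Hypothesis hphi : fns_weight M phi.
Hypothesis hGNS : is_gns M phi Lambda pi.
Hypothesis htheta : unital_normal_endomorphism M theta.
Hypothesis hinv : preserves_weight M phi theta.
Hypothesis hu : is_gns_isometry M phi Lambda theta u.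
Implicit Types (x y z : H -> H) (k l a b v w : K).

Local Notation nphi := (nphi M phi).

Lemma th_M x : M x -> M (theta x). Proof. by case: htheta => h _ _ _ _; exact: h. Qed.
Lemma th_lin (c : R[i]) x y : M x -> M y -> theta (c *: x + y) = c *: theta x + theta y.
Proof. by case: htheta => _ h _ _ _; exact: h. Qed.
Lemma th_comp x y : M x -> M y -> theta (x \o y) = theta x \o theta y.
Proof. by case: htheta => _ _ h _ _; exact: h. Qed.
Lemma th_adj x : M x -> theta (adj x) = adj (theta x).
Proof. by case: htheta => _ _ _ h _; exact: h. Qed.
Lemma th_id : theta idfun = idfun. Proof. by case: htheta => _ _ _ _ []. Qed.
Lemma th_sub x y : M x -> M y -> theta (x - y) = theta x - theta y.
Proof.
move=> Mx My; rewrite [x - y]addrC -[- y]scaleN1r th_lin // scaleN1r addrC.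
by [].
Qed.
Lemma th_sa x : M x -> sa x -> sa (theta x).
Proof.
move=> Mx sx; apply: adj_sa; first exact: (M_bo hM (th_M Mx)).
by rewrite -th_adj // sa_adj //; exact: (M_bo hM Mx).
Qed.

(** Normality for the one-element family [[set x]]: [theta x] is a supremum in the positive part of
    [M]. *)
Lemma th_psa x : M x -> psa x -> psa (theta x).
Proof.
move=> Mx px; case: htheta => _ _ _ _ [_ /(_ [set x] x)]; case.
- by move=> _ ->; apply/(pos_partP hM).
- split; first by exists x.
  move=> _ _ -> ->; exists x; have h : op_le x x.
    by move=> a; rewrite opE opNE subrr dotE !rd0l.
  by split.
- split; first by apply/(pos_partP hM).
    by move=> _ -> a; rewrite opE opNE subrr dotE !rd0l.
  by move=> t _; apply.
by move=> /(pos_partP hM)[].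
Qed.

Lemma th_mono x y : M x -> sa x -> M y -> sa y -> ole x y -> ole (theta x) (theta y).
Proof.
move=> Mx sx My sy xy; have p : psa (y - x).
  split; [exact: bo_sub (M_bo hM My) (M_bo hM Mx)|exact: saB|exact/posB].
have [_ _] := th_psa (M_sub hM My Mx) p.
by rewrite th_sub // => /posB.
Qed.

Lemma th_sq x : M x -> sq (theta x) = theta (sq x).
Proof. by move=> Mx; rewrite /sq th_comp ?th_adj //; exact: (M_adj hM). Qed.

Lemma th_n x : M x -> nphi (theta x) <-> nphi x.
Proof.
move=> Mx; have e : phi (sq (theta x)) = phi (sq x).
  rewrite th_sq // hinv //; apply/(pos_partP hM); split; [exact: (M_sq hM)|exact: (sq_psa hM)].
split=> -[h1 h2].
  by split=> //; move: h2; rewrite -[adj _ \o _]/(sq (theta x)) e.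
by split; [exact: th_M|rewrite -[adj _ \o _]/(sq (theta x)) e].
Qed.

Lemma u_bo : bo u.
Proof.
case: hu => -[lu nu] _; apply: (bo_mk lu ler01) => a.
have := nu a; rewrite !norm_nr => /(congr1 (fun z : R[i] => complex.Re z)) /= ->.
by rewrite mul1r.
Qed.
Lemma u_nr a : nr (u a) = nr a.
Proof. by case: hu => -[_ nu] _; have := nu a; rewrite !norm_nr => /(congr1 (fun z : R[i] => complex.Re z)). Qed.
Lemma u_rd a b : rd (u a) (u b) = rd a b.
Proof.
have e c : rd (u c) (u c) = rd c c by rewrite -!nr2 u_nr.
have := e (a + b); rewrite (boD u_bo) !rdDl !rdDr !e (rdC b a) (rdC (u b)); lra.
Qed.
Lemma u_Lam x : nphi x -> u (Lambda x) = Lambda (theta x).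
Proof. by case: hu => _; apply. Qed.

Local Notation us := (adj u).
Lemma us_bo : bo us. Proof. exact: bo_adj u_bo. Qed.
Lemma us_rd a b : rd (us a) b = rd a (u b).
Proof. by rewrite rdC -(rd_adj u_bo) rdC. Qed.
Lemma usu a : us (u a) = a.
Proof. by apply: rd_inj => c; rewrite us_rd u_rd. Qed.
Lemma us_nr a : nr (us a) <= nr a.
Proof.
have b1 : bnd 1 u by move=> c; rewrite u_nr mul1r.
by have := bnd_adj u_bo ler01 b1 a; rewrite mul1r.
Qed.

Lemma u_pi x k : M x -> u (pi x k) = pi (theta x) (u k).
Proof.
move=> Mx; have Mt := th_M Mx.
suff e : u \o pi x = pi (theta x) \o u by exact: (congr1 (fun f => f k) e).
apply: (bo_eq_tot (totL hGNS)).
- exact: bo_comp u_bo (pi_bo hGNS Mx).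
- exact: bo_comp (pi_bo hGNS Mt) u_bo.
move=> _ [y ny <-] /=; have My := n_M ny.
rewrite (pi_L hGNS Mx ny) u_Lam ?u_Lam //; last exact: (n_comp hM hphi).
have nt : nphi (theta y) by apply/th_n.
by rewrite th_comp // (pi_L hGNS Mt nt).
Qed.

Lemma us_pi x k : M x -> us (pi (theta x) k) = pi x (us k).
Proof.
move=> Mx; have Mt := th_M Mx; apply: rd_inj => c.
have Ma := M_adj hM Mx.
rewrite us_rd (rd_adj (pi_bo hGNS Mt)) -(pi_adj hM hphi hGNS Mt) -th_adj // -u_pi //.
by rewrite -us_rd (rd_adj (pi_bo hGNS Mx)) -(pi_adj hM hphi hGNS Mx).
Qed.

Lemma th_lim (x : nat -> H -> H) y : (forall n, M (x n) /\ psa (x n)) -> bo y ->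
  (forall n, ole (x n) (x n.+1)) -> (forall a : H, scvg \oo (fun n => x n a) (y a)) ->
  forall a : H, scvg \oo (fun n => theta (x n) a) (theta y a).
Proof.
move=> hx hy xm xy.
have [My py sub dir sup] := range_sup hM hx hy xm xy.
have leq_xy n : ole (x n) y.
  have [_ h _] := sup; have [_ [bn sn _]] := hx n; have [_ sy _] := py.
  by apply/(op_leP bn hy sn sy); apply: h; exists n.
have htx n : M (theta (x n)) /\ psa (theta (x n)).
  by have [? ?] := hx n; split; [exact: th_M|exact: th_psa].
have tm n : ole (theta (x n)) (theta (x n.+1)).
  by have [? [_ ? _]] := hx n; have [? [_ ? _]] := hx n.+1; apply: th_mono.
have [_ sy _] := py.
have tle n : ole (theta (x n)) (theta y) by have [? [_ ? _]] := hx n; apply: th_mono.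
have [C C0 bC] := bo_bnd (M_bo hM (th_M My)).
have [|z [hz sz pz tz lez]] := @mono_lim _ _ (fun n => theta (x n)) C C0 (fun n => (htx n).2) tm.
  move=> n a; apply: le_trans (tle n a) _; apply: le_trans (rd_le _ _) _.
  by rewrite -nr2 expr2 mulrA ler_wpM2r ?nr_ge0.
have [Mz pz' _ _ supz] := range_sup hM htx hz tm tz.
have [_ supt] : is_op_sup M (theta @` range x) (theta y) /\ True.
  by case: htheta => _ _ _ _ [_ h]; split=> //; exact: h.
have {supt} [p1 ub1 lub1] : is_op_sup M (theta @` range x) (theta y).
  by case: htheta => _ _ _ _ [_ h]; exact: h.
have [p2 ub2 lub2] := supz.
have pty := th_psa My py.
have e : z = theta y.
  apply: psa_anti => //.
    apply/(op_leP hz _ sz _); [by case: pty|by case: pty|].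
    by apply: lub2 => // _ [n _ <-]; apply: ub1; exists (x n) => //; exists n.
  apply/(op_leP _ hz _ sz); [by case: pty|by case: pty|].
  by apply: lub1 => // _ [_ [n _ <-] <-]; apply: ub2; exists n.
by move=> a; rewrite -e.
Qed.

Lemma approx_unit_pi : exists e : nat -> H -> H,
  [/\ forall n, M (e n) /\ psa (e n), forall n, nphi (e n) /\ bnd 1 (e n),
      forall n, ole (e n) idfun, forall n, ole (e n) (e n.+1) &
      (forall a : H, scvg \oo (fun n => e n a) a) /\ forall k, scvg \oo (fun n => pi (e n) k) k].
Proof.
have [e [fe e1 em ee]] := approx_unit hM hphi.
have Mpe n : M (e n) /\ psa (e n) by case: (fe n).
exists e; split=> // [n|].
  have [Me pe fin] := fe n; have [? ? ?] := pe; split; first exact: (n_psa hM hphi Me pe (e1 n) fin).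
  by apply: ole_bnd => // a; rewrite mul1r; exact: e1.
split=> // k; have := pi_lim hM hphi hGNS Mpe bo_id em ee k.
by rewrite (pi_id hM hGNS).
Qed.

(** [theta] preserves finiteness of [phi] in both directions, so the vectors of [theta M] are
    exactly the [u (Lambda y)]; their closure is the range of [u]. *)
Lemma projection_range (e : op K) :
  orth_proj_on (closure (Lambda @` (theta @` M `&` nphi))) e -> e = u \o us.
Proof.
move=> he; set V := closure _ in he.
have Vu c : V (u (us c)).
  apply/closure_nr => eps e0; have [_ [y ny <-] h] := totL hGNS (us c) e0.
  exists (Lambda (theta y)); last by rewrite -u_Lam // -(boB u_bo) u_nr.
  exists (theta y) => //; split; first by exists y => //; exact: n_M ny.
  by apply/th_n => //; exact: n_M ny.
have uV (z : K) : V z -> u (us z) = z.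
  move=> /closure_nr hz; apply: subr0_eq; apply: nr_eq0; apply/eqP.
  rewrite eq_le nr_ge0 andbT; apply/ler_addgt0Pr => eps e0; rewrite add0r.
  have e2 : 0 < eps / 2 by lra.
  have [_ [_ [[y My <-] ny] <-] h] := hz _ e2.
  have ny' : nphi y by apply/(th_n My).
  have -> : u (us z) - z = u (us (z - Lambda (theta y))) - (z - Lambda (theta y)).
    by rewrite (boB us_bo) (boB u_bo) -(u_Lam ny') usu; hring.
  apply: le_trans (nrD _ _) _; rewrite nrN u_nr.
  have := us_nr (z - Lambda (theta y)); move: h; lra.
apply: funext => c /=; have [Vc hc] := he c.
rewrite -(uV _ Vc); congr u; apply: rd_inj => d.
rewrite !us_rd; apply/esym/eqP; rewrite -subr_eq0 -rdBl; apply/eqP.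
have := hc _ (Vu (u d)); rewrite usu => /(congr1 (fun z : R[i] => complex.Re z)) /=.
by [].
Qed.

Section Tomita.
Context (J : op K) (G : set (K * K)).
Hypothesis hJ : antiunitary J.
Hypothesis hG : pos_selfadjoint_graph G.
Hypothesis hS : tomita_graph M phi Lambda = [set (p.1, J p.2) | p in G].
Local Notation Fg := (Fg M phi Lambda).
Local Notation Sg := (Sg M phi Lambda).
Local Notation jinv := (Jinv J).

Lemma th_n2 x : n2 M phi x -> n2 M phi (theta x).
Proof.
move=> hx; have Mx := n2M hx; case: hx => h1 h2; split; first exact/th_n.
by rewrite -th_adj //; apply/th_n => //; exact: (M_adj hM).
Qed.

Lemma u_Sg a b : Sg a b -> Sg (u a) (u b).
Proof.
move=> /Sg_core h; apply/Sg_core => e /h[x nx [h1 h2]].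
exists (theta x); first exact: th_n2.
have Mx := n2M nx; case: nx => n1 n2'.
by rewrite -(th_adj Mx) -(u_Lam n1) -(u_Lam n2') -!(boB u_bo) !u_nr.
Qed.

(** * From commutation with [J] to the conditional expectation *)

Section Commute.
Hypothesis uJ : u \o J = J \o u.

Lemma uJE k : u (J k) = J (u k). Proof. exact: (congr1 (fun f => f k) uJ). Qed.
Lemma u_jinv k : u (jinv k) = jinv (u k).
Proof. by apply: (J_inj hJ); rewrite -uJE !(JinvK hJ). Qed.
Lemma us_jinv k : us (jinv k) = jinv (us k).
Proof.
have e v : us (J v) = J (us v).
  apply: rd_inj => c; rewrite us_rd (rdJinv hJ) -u_jinv -us_rd (rdJinv hJ) //.
by apply: (J_inj hJ); rewrite -e !(JinvK hJ).
Qed.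
Lemma u_G a b : G (a, b) -> G (u a, u b).
Proof. by move=> /(G_Sg hJ hS)/u_Sg/(Sg_G hJ hS); rewrite uJE (JK hJ). Qed.
(** Invariance of a self-adjoint graph under [u] passes to the adjoint of [u]. *)
Lemma us_G a b : G (a, b) -> G (us a, us b).
Proof.
move=> Gab; apply/(G_rdE hG) => c d /u_G Gcd.
by rewrite rdC us_rd rdC [RHS]rdC us_rd [RHS]rdC; exact: (G_rd hG Gab Gcd).
Qed.
Lemma us_Sg a b : Sg a b -> Sg (us a) (us b).
Proof. by move=> /(Sg_G hJ hS)/us_G h; apply/(Sg_G hJ hS); rewrite -us_jinv. Qed.
Lemma Rt_u k : Rt J G (u k) = u (Rt J G k).
Proof.
rewrite /Rt /= -u_jinv uJE; congr J.
have [h1 h2] := resgP hG (jinv k).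
have := u_G h2; rewrite (boB u_bo) => h3.
by have [-> _] := resg_uniq hG (u_G h1) h3.
Qed.

Local Notation rb := (rb M phi Lambda J G).
Local Notation ra := (ra M phi Lambda pi).
Let RP := rb_ra hM hphi hGNS hJ hG hS.

Lemma rb_u a : rb a -> rb (u a).
Proof.
move=> [x [nx sx ->]]; exists (theta x); split.
- by apply/th_n => //; exact: n_M nx.
- by apply: th_sa => //; exact: n_M nx.
- by rewrite -Rt_u u_Lam.
Qed.

Lemma ra_u a k : rb a -> ra (u a) (u k) = u (ra a k).
Proof.
move=> rba; have [hA sA AL cA] := RP rba; have [hB sB BL cB] := RP (rb_u rba).
suff e : ra (u a) \o u = u \o ra a by exact: (congr1 (fun f => f k) e).
apply: (bo_eq_tot (totL hGNS)); [exact: bo_comp hB u_bo|exact: bo_comp u_bo hA|].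
move=> _ [y ny <-] /=; have My := n_M ny.
by rewrite u_Lam // BL ?AL ?u_pi //; apply/th_n.
Qed.

Lemma compress_n x : nphi x -> sa x -> exists z,
  [/\ nphi z, sa z, pi z = us \o pi x \o u & Lambda z = us (Lambda x)].
Proof.
move=> nx sx; have Mx := n_M nx; have hx := pi_bo hGNS Mx; have spx := pi_sa hM hphi hGNS Mx sx.
apply: (recover hM hphi hGNS hJ hG hS).
- by apply: bo_comp u_bo; exact: bo_comp us_bo hx.
- by move=> k l /=; rewrite us_rd spx [RHS]rdC us_rd rdC.
- by apply: us_Sg; exact: (Sg_sa hM nx sx).
move=> a rba; have [hA sA AL cA] := RP rba; have [hB sB BL cB] := RP (rb_u rba).
apply: rd_inj => c.
by rewrite sA !us_rd /= -ra_u // -sB BL // us_rd.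
Qed.

(** For self-adjoint [y] the elements [e n y e n] are self-adjoint and in [nphi], so [compress_n]
    applies. [pi_iso] bounds the resulting [z n] uniformly, and [pi_closed] yields their limit. *)
Lemma compress_ex x : M x -> exists z, M z /\ pi z = us \o pi x \o u.
Proof.
have sa_case y : M y -> sa y -> exists z, M z /\ pi z = us \o pi y \o u.
  move=> My sy; have [e [Mpe nbe e1 em [ee lime]]] := approx_unit_pi.
  have Me n : M (e n) by case: (Mpe n).
  have pe n : psa (e n) by case: (Mpe n).
  have ne n : nphi (e n) by case: (nbe n).
  have be n : bnd 1 (e n) by case: (nbe n).
  have [C C0 bC] := bo_bnd (M_bo hM My).
  pose y' n := (e n \o y) \o e n.
  have My' n : M (y' n) by apply: (M_comp hM) => //; exact: (M_comp hM).
  have by' n : bnd C (y' n).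
    move=> a /=; apply: le_trans (be n _) _; rewrite mul1r; apply: le_trans (bC _) _.
    by rewrite ler_wpM2l //; have := be n a; rewrite mul1r.
  have /choice[z zP] n : exists z, M z /\ pi z = us \o pi (y' n) \o u.
    have [||z [nz _ pz _]] := @compress_n (y' n).
    - by apply: (n_comp hM hphi) => //; exact: (M_comp hM).
    - by have [_ s _] := pe n; move=> a b /=; rewrite s sy s.
    by exists z; split=> //; exact: n_M nz.
  have bz n : bnd C (z n).
    have [Mz pz] := zP n; apply: (pi_iso hM hphi hGNS Mz C0) => k; rewrite pz /=.
    apply: le_trans (us_nr _) _; apply: le_trans (pi_bnd hM hphi hGNS (My' n) C0 (by' n) _) _.
    by rewrite u_nr.
  have pe1 n : bnd 1 (pi (e n)) by exact: (pi_bnd hM hphi hGNS (Me n) ler01 (be n)).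
  have lim k : scvg \oo (fun n => pi (z n) k) (us (pi y (u k))).
    have -> : (fun n => pi (z n) k) = us \o (fun n => pi (e n) (pi y (pi (e n) (u k)))).
      apply: funext => n /=; have [_ ->] := zP n; rewrite /= /y'.
      by rewrite (pi_comp hM hphi hGNS (M_comp hM (Me n) My) (Me n)) (pi_comp hM hphi hGNS (Me n) My).
    apply: (bo_scvg us_bo); apply: (@scvg_bnd _ _ _ _ _ (fun n => pi (e n)) idfun _ _ 1) => //.
    - by move=> n; apply: bo_lin; exact: (pi_bo hGNS).
    - exact: (bo_scvg (pi_bo hGNS My) (lime (u k))).
  have [||w [Mw _ _ pw]] := @pi_closed _ _ _ _ _ _ _ hM hphi hGNS z C C0.
  - by move=> n; case: (zP n).
  - by move=> k; exists (us (pi y (u k))); exact: lim.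
  exists w; split=> //; apply: funext => k; exact: (scvg_uniq (F := \oo) (pw k) (lim k)).
move=> Mx; have [x1 [x2 [M1 M2 s1 s2 ->]]] := M_re hM Mx.
have [z1 [Mz1 e1]] := sa_case _ M1 s1; have [z2 [Mz2 e2]] := sa_case _ M2 s2.
have Miz := M_scale hM 'i%C Mz2; have Mix := M_scale hM 'i%C M2.
exists (z1 + 'i%C *: z2); split; first exact: (M_add hM).
apply: funext => k; rewrite (pi_add hM hphi hGNS Mz1 Miz) (pi_scale hM hphi hGNS _ Mz2) /=.
rewrite (pi_add hM hphi hGNS M1 Mix) (pi_scale hM hphi hGNS _ M2) !opE e1 e2 /=.
by rewrite (boD us_bo) (boZ us_bo).
Qed.

Definition compress x := xget (0 : H -> H) [set z | M z /\ pi z = us \o pi x \o u].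
Local Notation Phi := compress.

Lemma compressP x : M x -> M (Phi x) /\ pi (Phi x) = us \o pi x \o u.
Proof.
by move=> Mx; rewrite /Phi; case: xgetP => [z -> //|h]; have [z /h] := compress_ex Mx.
Qed.
Lemma compress_uniq x z : M x -> M z -> (forall k, pi z k = us (pi x (u k))) -> Phi x = z.
Proof.
move=> Mx Mz h; have [M1 e] := compressP Mx; apply: (pi_inj2 hM hphi hGNS) => //.
by rewrite e; apply: funext => k; rewrite h.
Qed.
Lemma compress_M x : M x -> M (Phi x). Proof. by case/compressP. Qed.
Lemma compressE x k : M x -> pi (Phi x) k = us (pi x (u k)).
Proof. by move=> /compressP[_ ->]. Qed.

Lemma compress_lin (c : R[i]) x y : M x -> M y -> Phi (c *: x + y) = c *: Phi x + Phi y.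
Proof.
move=> Mx My; have M1 := compress_M Mx; have M2 := compress_M My.
have Mc := M_scale hM c Mx; have Mc1 := M_scale hM c M1.
apply: compress_uniq => [||k]; [exact: (M_add hM)|exact: (M_add hM)|].
rewrite (pi_add hM hphi hGNS Mc My) (pi_add hM hphi hGNS Mc1 M2).
rewrite (pi_scale hM hphi hGNS _ Mx) (pi_scale hM hphi hGNS _ M1) !opE !compressE //.
by rewrite (boD us_bo) (boZ us_bo).
Qed.
Lemma compress_psa x : M x -> psa x -> psa (Phi x).
Proof.
move=> Mx px; apply: (pos_reflect hM hphi hGNS); first exact: compress_M.
have [hx sx ppx] := pi_psa hM hphi hGNS Mx px; have [_ ->] := compressP Mx; split.
- by apply: bo_comp u_bo; exact: bo_comp us_bo hx.
- by move=> k l /=; rewrite us_rd sx [RHS]rdC us_rd rdC.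
- by move=> k /=; rewrite us_rd.
Qed.
Lemma compress_th y : M y -> Phi (theta y) = y.
Proof.
by move=> My; apply: compress_uniq => //; [exact: th_M|move=> k; rewrite -u_pi // usu].
Qed.
Lemma compress_bimod x y z : M x -> M y -> M z ->
  Phi (theta y \o x \o theta z) = y \o Phi x \o z.
Proof.
move=> Mx My Mz; have Mty := th_M My; have Mtz := th_M Mz; have MP := compress_M Mx.
have M1 := M_comp hM Mty Mx; have M2 := M_comp hM My MP.
apply: compress_uniq => [||k]; [exact: (M_comp hM)|exact: (M_comp hM)|].
rewrite (pi_comp hM hphi hGNS M1 Mtz) (pi_comp hM hphi hGNS Mty Mx).
rewrite (pi_comp hM hphi hGNS M2 Mz) (pi_comp hM hphi hGNS My MP) /=.
by rewrite compressE // us_pi // u_pi.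
Qed.

Lemma compress_phi_le x (C : R) : M x -> psa x -> ole x idfun ->
  (phi (Phi x) <= C%:E)%E <-> (phi x <= C%:E)%E.
Proof.
move=> Mx px x1; have MP := compress_M Mx; have pP := compress_psa Mx px.
have P1 : ole (Phi x) idfun.
  have Mi := M_id hM; have pix : psa (idfun - x) by apply: psaB => //; exact: psa_id.
  have := compress_psa (M_sub hM Mi Mx) pix.
  have -> : Phi (idfun - x) = idfun - Phi x.
    have := compress_lin (-1) Mx Mi; rewrite !scaleN1r addrC => ->.
    have -> : Phi idfun = idfun by have := compress_th Mi; rewrite th_id.
    by rewrite addrC.
  by move=> [_ _ /posB].
have [e [Mpe nbe e1 em [ee lime]]] := approx_unit_pi.
have Me n : M (e n) by case: (Mpe n).
have pe n : psa (e n) by case: (Mpe n).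
have se n : sa (e n) by case: (pe n).
have ne n : nphi (e n) by case: (nbe n).
have be n : bnd 1 (e n) by case: (nbe n).
pose e' n := theta (e n).
have Me' n : M (e' n) by exact: th_M.
have pe' n : psa (e' n) by exact: th_psa.
have se' n : sa (e' n) by case: (pe' n).
have ne' n : nphi (e' n) by apply/th_n.
have be' n : bnd 1 (e' n).
  have h : ole (e' n) (theta idfun) := th_mono (Me n) (se n) (M_id hM) (@sa_id _ _) (e1 n).
  by have [? ? ?] := pe' n; apply: ole_bnd => // a; rewrite mul1r; have := h a; rewrite th_id.
have em' n : ole (e' n) (e' n.+1) by apply: th_mono.
have ee' (a : H) : scvg \oo (fun n => e' n a) a.
  have := th_lim (fun n => conj (Me n) (pe n)) bo_id em ee a.
  by rewrite th_id.
have lime' c : scvg \oo (fun n => pi (e' n) c) c.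
  have := pi_lim hM hphi hGNS (fun n => conj (Me' n) (pe' n)) bo_id em' ee' c.
  by rewrite (pi_id hM hGNS).
have [U [UU subU]] := @ultraFilterLemma nat \oo _.
have E n : rd (pi (Phi x) (Rt J G (Lambda (e n)))) (Rt J G (Lambda (e n))) =
    rd (pi x (Rt J G (Lambda (e' n)))) (Rt J G (Lambda (e' n))).
  by rewrite compressE // us_rd -!Rt_u u_Lam.
split=> h.
  apply: (phi_le_half hM hphi hGNS hJ hG hS UU subU ne' se' be' lime') => // n.
  by rewrite -E; exact: (half_le_phi hM hphi hGNS hJ hG hS ne se be).
apply: (phi_le_half hM hphi hGNS hJ hG hS UU subU ne se be lime) => // n.
by rewrite E; exact: (half_le_phi hM hphi hGNS hJ hG hS ne' se' be').
Qed.

Lemma scale_le1 x : psa x -> exists2 t : R, 0 < t & ole (t%:C *: x) idfun.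
Proof.
move=> [hx _ _]; have [C C0 bC] := bo_bnd hx; have C1 : 0 < C + 1 by rewrite ltr_wpDl.
exists (C + 1)^-1; first by rewrite invr_gt0.
move=> a; rewrite opE rdZl ler_pdivrMl //; apply: le_trans (rd_le _ _) _.
rewrite /= -nr2 expr2 mulrA ler_wpM2r ?nr_ge0 //; apply: le_trans (bC a) _.
by rewrite mulrDl mul1r lerDl nr_ge0.
Qed.

Lemma compress_phi x : M x -> psa x -> phi (Phi x) = phi x.
Proof.
move=> Mx px; have [t t0 tx] := scale_le1 px.
have MP := compress_M Mx; have pP := compress_psa Mx px.
have Mtx := M_scale hM t%:C Mx; have ptx := psaZ (ltW t0) px.
have eP : Phi (t%:C *: x) = t%:C *: Phi x.
  have := compress_lin t%:C Mx (M_0 hM); rewrite addr0 => ->.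
  have -> : Phi 0 = 0; last by rewrite addr0.
  apply: compress_uniq; [exact: (M_0 hM)|exact: (M_0 hM)|move=> k].
  by rewrite (pi_0 hM hphi hGNS) (bo0 us_bo).
have key (C : R) : (phi (Phi x) <= C%:E)%E <-> (phi x <= C%:E)%E.
  have := compress_phi_le (t * C) Mtx ptx tx; rewrite eP !(phiZ hM hphi (ltW t0)) //.
  by rewrite EFinM !lee_pmul2l.
have g1 := phi_ge0 hM hphi MP pP; have g2 := phi_ge0 hM hphi Mx px.
apply/eqP; rewrite eq_le; apply/andP; split.
  case E : (phi x) g2 => [r| |] // _; last by rewrite leey.
  by apply/key; rewrite E.
case E : (phi (Phi x)) g1 => [r| |] // _; last by rewrite leey.
by apply/key; rewrite E.
Qed.

Lemma expectation_exists : fn_preserving_expectation M phi (theta @` M) (theta \o Phi).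
Proof.
have PM := compress_M.
have lin : linear_on M (theta \o Phi).
  by move=> c x y Mx My /=; rewrite compress_lin // th_lin //; exact: PM.
have ppos x : pos_part M x -> M (theta (Phi x)) /\ psa (theta (Phi x)).
  move=> /(pos_partP hM)[Mx px]; split; first by apply: th_M; exact: PM.
  by apply: th_psa; [exact: PM|exact: compress_psa].
have pres : preserves_weight M phi (theta \o Phi).
  move=> x /(pos_partP hM)[Mx px] /=; rewrite hinv ?compress_phi //.
  by apply/(pos_partP hM); split; [exact: PM|exact: compress_psa].
split=> //.
- split=> //.
  + by move=> x Mx /=; exists (Phi x) => //; exact: PM.
  + by move=> x /ppos[M1 p1]; have [] := (pos_partP hM _).2 (conj M1 p1).
  + by move=> _ [y My <-] /=; rewrite compress_th.
  + move=> _ x _ [y My <-] Mx [z Mz <-] /=; rewrite compress_bimod //.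
    by rewrite (th_comp (M_comp hM My (PM _ Mx)) Mz) (th_comp My (PM _ Mx)).
- move=> x px e0; apply: (phi_eq0 hM hphi); [by case/(pos_partP hM): px|by case/(pos_partP hM): px|].
  by rewrite -(pres x px) /= -[theta (Phi x)]/((theta \o Phi) x) e0 (phi_0 hM hphi).
move=> D s sub dir sup; have [d [Dd dm ds]] := sup_seq hM sub dir sup.
have [/(pos_partP hM)[Ms ps] ub lub] := sup.
have Pd n : M (d n) /\ psa (d n) by apply/(pos_partP hM); exact: sub.
have [hs ss _] := ps.
have pilim k := pi_lim hM hphi hGNS Pd hs dm ds k.
have op_le_psa x y : M x -> M y -> psa (y - x) -> op_le x y.
  by move=> Mx My p; have [] := (pos_partP hM _).2 (conj (M_sub hM My Mx) p).
have th_subP x y : M x -> M y -> psa (y - x) -> op_le (theta x) (theta y).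
  move=> Mx My p; apply: op_le_psa; [exact: th_M|exact: th_M|].
  by rewrite -th_sub //; apply: th_psa => //; exact: (M_sub hM).
have Psub x y : M x -> M y -> Phi (y - x) = Phi y - Phi x.
  move=> Mx My; have := compress_lin (-1) Mx My.
  by rewrite !scaleN1r addrC => ->; rewrite addrC.
split.
- have [M1 p1] := ppos s ((pos_partP hM s).2 (conj Ms ps)); split.
    by exists (Phi s) => //; exact: PM.
  by have [] := (pos_partP hM _).2 (conj M1 p1).
- move=> _ [x Dx <-] /=; have /(pos_partP hM)[Mx px] := sub _ Dx.
  apply: th_subP; [exact: PM|exact: PM|rewrite -Psub //].
  apply: compress_psa; first exact: (M_sub hM).
  have [_ sx _] := px; apply: psaB => //.
  by apply/(op_leP (M_bo hM Mx) hs sx ss); exact: ub.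
(* An upper bound in [theta M] has the form [theta t]; applying [Phi] shows that [t] dominates the
   [Phi (d n)]. The limit is then taken on [K], where the [pi (d n)] converge strongly, and
   [pos_reflect] brings it back. *)
- move=> _ [[t Mt <-] post] htub.
  have pth : psa (theta t).
    by have /(pos_partP hM)[] : pos_part M (theta t) by split=> //; exact: th_M.
  have pt : psa t by rewrite -(compress_th Mt); apply: compress_psa => //; exact: th_M.
  apply: th_subP => //; first exact: PM.
  have [ht st _] := pt.
  have Pn n k : rd (pi (Phi (d n)) k) k <= rd (pi t k) k.
    have [Mn pn] := Pd n; have MPn := PM _ Mn.
    have pPn := th_psa MPn (compress_psa Mn pn).
    have h : psa (theta t - theta (Phi (d n))).
      apply: psaB => //; have [b1 s1 _] := pPn; have [b2 s2 _] := pth.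
      by apply/(op_leP b1 b2 s1 s2); apply: htub; exists (d n).
    have Mtd := M_sub hM Mt MPn.
    rewrite -th_sub // in h; have := compress_psa (th_M Mtd) h.
    rewrite compress_th // => /(pi_psa hM hphi hGNS Mtd)[_ _ /(_ k)].
    by rewrite (pi_sub hM hphi hGNS Mt MPn) opE opNE rdBl subr_ge0.
  have MPs := PM _ Ms.
  have [hps sps _] := pi_psa hM hphi hGNS MPs (compress_psa Ms ps).
  apply: (pos_reflect hM hphi hGNS); first exact: (M_sub hM).
  rewrite (pi_sub hM hphi hGNS Mt MPs); apply: psaB.
  - by apply: (pi_psa hM hphi hGNS) => //; exact: compress_psa.
  - exact: (pi_psa hM hphi hGNS).
  - move=> k; have L : rd (pi (Phi (d n)) k) k @[n --> \oo] --> rd (pi (Phi s) k) k.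
      apply: rd_cvg; last exact: scvg_cst.
      rewrite compressE //.
      rewrite (_ : (fun n => pi (Phi (d n)) k) = us \o (fun n => pi (d n) (u k))).
        exact: (bo_scvg us_bo (pilim (u k))).
      by apply: funext => n /=; rewrite compressE //; case: (Pd n).
    by apply: (cvg_ub _ L) => n; exact: Pn.
Qed.

End Commute.

(** * From a conditional expectation to commutation with [J] *)

Section Converse.
Variable E : op H -> op H.
Hypothesis hE : fn_preserving_expectation M phi (theta @` M) E.

Lemma E_rng x : M x -> exists2 y, M y & theta y = E x.
Proof. by case: hE => -[h _ _ _ _] _ _ _ /h [y]; exists y. Qed.
Lemma E_M x : M x -> M (E x).
Proof. by move=> /E_rng[y My <-]; exact: th_M. Qed.
Lemma E_lin (c : R[i]) x y : M x -> M y -> E (c *: x + y) = c *: E x + E y.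
Proof. by case: hE => -[_ h _ _ _] _ _ _; exact: h. Qed.
Lemma E_th y : M y -> E (theta y) = theta y.
Proof. by case: hE => -[_ _ _ h _] _ _ _ My; apply: h; exists y. Qed.
Lemma E_bimod x y z : M x -> M y -> M z -> E (theta y \o x \o theta z) = theta y \o E x \o theta z.
Proof. by case: hE => -[_ _ _ _ h] _ _ _ Mx My Mz; apply: h => //. Qed.
Lemma E_psa x : M x -> psa x -> psa (E x).
Proof.
move=> Mx px; have : pos_part M (E x); last by case/(pos_partP hM).
split; first exact: E_M.
by case: hE => -[_ _ h _ _] _ _ _; apply: h; apply/(pos_partP hM).
Qed.
Lemma E_id : E idfun = idfun.
Proof. by rewrite -[X in E X]th_id E_th ?th_id //; exact: (M_id hM). Qed.
Lemma E_phi x : M x -> psa x -> phi (E x) = phi x.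
Proof. by move=> Mx px; case: hE => _ _ _; apply; apply/(pos_partP hM). Qed.
Lemma E_D x y : M x -> M y -> E (x + y) = E x + E y.
Proof. by move=> Mx My; have := E_lin 1 Mx My; rewrite !scale1r. Qed.
Lemma E_0 : E 0 = 0.
Proof. by apply: (@addrI _ (E 0)); rewrite -E_D ?addr0 //; exact: (M_0 hM). Qed.
Lemma E_Z (c : R[i]) x : M x -> E (c *: x) = c *: E x.
Proof. by move=> Mx; have := E_lin c Mx (M_0 hM); rewrite !addr0 E_0 addr0. Qed.
Lemma E_sub x y : M x -> M y -> E (x - y) = E x - E y.
Proof.
move=> Mx My; rewrite (E_D Mx (M_opp hM My)); congr (_ + _).
by have := E_Z (-1) My; rewrite !scaleN1r.
Qed.

(** Adding [C] times the identity makes [x] positive, and [E] fixes the identity. *)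
Lemma E_sa x : M x -> sa x -> sa (E x).
Proof.
move=> Mx sx; have [C C0 bC] := bo_bnd (M_bo hM Mx); have Mi := M_id hM.
have MC := M_scale hM C%:C Mi.
have p : psa (x + C%:C *: idfun).
  split; [exact: (M_bo hM (M_add hM Mx MC))|by apply: saD => //; apply: saZ; exact: sa_id|].
  move=> a; rewrite !opE rdDl rdZl /=; have := rd_cs (x a) a; rewrite ler_norml => /andP[h _].
  have := bC a; have := nr_ge0 a; move: h; rewrite -nr2; move: (nr (x a)) (nr a) (rd _ _) => p q r; nra.
have [_ s _] := E_psa (M_add hM Mx MC) p.
have -> : E x = E (x + C%:C *: idfun) - C%:C *: idfun by rewrite E_D // E_Z // E_id addrK.
by apply: saB => //; apply: saZ; exact: sa_id.
Qed.

Lemma E_adj x : M x -> E (adj x) = adj (E x).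
Proof.
move=> Mx; have [x1 [x2 [M1 M2 s1 s2 ->]]] := M_re hM Mx.
have h1 := M_bo hM M1; have h2 := M_bo hM M2; have MI := M_scale hM 'i%C M2.
have k1 := M_bo hM (E_M M1); have k2 := M_bo hM (E_M M2).
rewrite (adjD h1 (bo_scale _ h2)) (adji h2) (sa_adj h1 s1) (sa_adj h2 s2) scaleNr.
rewrite (E_sub M1 MI) (E_D M1 MI) (E_Z _ M2) (adjD k1 (bo_scale _ k2)) (adji k2).
by rewrite (sa_adj k1 (E_sa M1 s1)) (sa_adj k2 (E_sa M2 s2)) scaleNr.
Qed.

(** Expand the positive element [E ((x - E x)^* (x - E x))] by the bimodule property. *)
Lemma E_kadison_schwarz x : M x -> ole (sq (E x)) (E (sq x)).
Proof.
move=> Mx; have [y My yE] := E_rng Mx; have Mty := th_M My.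
have Mxa := M_adj hM Mx; have Mya := M_adj hM My; have Mtya := M_adj hM Mty.
have hx := M_bo hM Mx; have hty := M_bo hM Mty.
have Md := M_sub hM Mx Mty.
have p := E_psa (M_sq hM Md) (sq_psa hM Md).
have e1 : sq (x - theta y) = sq x - (adj x \o theta y) - (adj (theta y) \o x) + sq (theta y).
  apply: funext => a; have hxa := bo_adj hx; have hya := bo_adj hty.
  rewrite /sq adjD ?bo_opp //; last exact: bo_opp.
  have -> : adj (- theta y) = - adj (theta y).
    by have := adjZ (-1) hty; rewrite rmorphN1 !scaleN1r.
  rewrite !opE /= !opE !(boB hxa) !(boB hya); hring.
have e2 : E (adj x \o theta y) = sq (theta y).
  have := E_bimod Mxa (M_id hM) My; rewrite th_id => h.
  by rewrite -[adj x \o theta y]/(idfun \o adj x \o theta y) h E_adj // -yE.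
have e3 : E (adj (theta y) \o x) = sq (theta y).
  have := E_bimod Mx Mya (M_id hM); rewrite th_id th_adj // => h.
  by rewrite -[adj (theta y) \o x]/(adj (theta y) \o x \o idfun) h -yE.
have M1 := M_sq hM Mx; have M2 := M_comp hM Mxa Mty; have M3 := M_comp hM Mtya Mx; have M4 := M_sq hM Mty.
have e4 : E (sq (theta y)) = sq (theta y) by rewrite th_sq // E_th //; exact: (M_sq hM).
move: p; rewrite e1 (E_D (M_sub hM (M_sub hM M1 M2) M3) M4) (E_sub (M_sub hM M1 M2) M3) (E_sub M1 M2).
rewrite e2 e3 e4 yE subrK => -[_ _ h] a.
by have := h a; rewrite opE opNE rdBl subr_ge0.
Qed.

Lemma E_n x : nphi x -> nphi (E x) /\ nr (Lambda (E x)) <= nr (Lambda x).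
Proof.
move=> nx; have Mx := n_M nx; have ME := E_M Mx.
have le : (phi (sq (E x)) <= phi (sq x))%E.
  rewrite -(E_phi (M_sq hM Mx) (sq_psa hM Mx)).
  apply: (phi_mono hM hphi) (E_kadison_schwarz Mx) => //.
  - exact: (M_sq hM).
  - exact: (sq_psa hM).
  - by apply: E_M; exact: (M_sq hM).
  - by apply: E_psa; [exact: (M_sq hM)|exact: (sq_psa hM)].
have nE : nphi (E x) by apply: (n_intro ME le); exact: n_fin nx.
split=> //; move: le; rewrite (Lam_phi hM hphi hGNS nE) (Lam_phi hM hphi hGNS nx) lee_fin -!nr2.
by rewrite (@ler_pXn2r _ 2) ?nnegrE ?nr_ge0.
Qed.

(** [Lambda x |-> Lambda (E x)] is a contraction fixing the range vectors [Lambda (theta w)].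
    Perturbing [x] by [t theta w] forces [Lambda x - Lambda (E x)] to be orthogonal to them, so the
    map is the orthogonal projection onto the range of [u]. *)
Lemma us_Lam x y : nphi x -> M y -> theta y = E x -> nphi y /\ us (Lambda x) = Lambda y.
Proof.
move=> nx My yE; have [nE _] := E_n nx; have Mx := n_M nx.
have ny : nphi y by apply/(th_n My); rewrite yE.
split=> //; apply: subr0_eq; apply: (tot_orth (totL hGNS)) => _ [w nw <-].
have Mw := n_M nw; have ntw : nphi (theta w) by apply/(th_n Mw).
rewrite rdC rdBl us_rd -(u_rd (Lambda y)) !u_Lam // yE -rdBl.
set B := rd _ _; apply/eqP; apply/negPn/negP => B0.
have key (t : R) : rd (Lambda (E x)) (Lambda (E x)) <= rd (Lambda x) (Lambda x) + 2 * t * B.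
  have nt := n_scale hM hphi t%:C ntw; have nxt := n_add hM hphi nx nt.
  have [_ h] := E_n nxt; move: h.
  have -> : E (x + t%:C *: theta w) = E x + t%:C *: theta w.
    by rewrite E_D ?E_Z ?E_th //; [exact: th_M|apply: (M_scale hM); exact: th_M].
  rewrite (LamD hGNS nE nt) (LamD hGNS nx nt) (LamZ hM hphi hGNS _ ntw) => h.
  have : nr (Lambda (E x) + t%:C *: Lambda (theta w)) ^+ 2 <= nr (Lambda x + t%:C *: Lambda (theta w)) ^+ 2.
    by rewrite (@ler_pXn2r _ 2) ?nnegrE ?nr_ge0.
  rewrite !nr2 /B !rdDl !rdDr !rdZl !rdZr rdNl (rdC (Lambda (theta w))) (rdC (Lambda (theta w)) (Lambda x)); lra.
(* This [t] makes the right-hand side equal to [-1]. *)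
have := key (- (rd (Lambda x) (Lambda x) + 1) / (2 * B)).
have -> : 2 * (- (rd (Lambda x) (Lambda x) + 1) / (2 * B)) * B = - (rd (Lambda x) (Lambda x) + 1).
  by field.
have := rd_ge0 (Lambda (E x)); lra.
Qed.

Lemma expectation_formula (x : op H) k : M x -> pi (E x) (u (us k)) = u (us (pi x (u (us k)))).
Proof.
move=> Mx; have ME := E_M Mx.
suff e : pi (E x) \o u = u \o us \o pi x \o u by exact: (congr1 (fun f => f (us k)) e).
apply: (bo_eq_tot (totL hGNS)).
- exact: bo_comp (pi_bo hGNS ME) u_bo.
- by apply: bo_comp u_bo; apply: bo_comp (pi_bo hGNS Mx); exact: bo_comp u_bo us_bo.
move=> _ [w nw <-] /=; have Mw := n_M nw; have ntw : nphi (theta w) by apply/(th_n Mw).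
have nxw := n_comp hM hphi Mx ntw.
rewrite u_Lam // (pi_L hGNS ME ntw) (pi_L hGNS Mx ntw).
have [y My yE] := E_rng (n_M nxw); have [ny ->] := us_Lam nxw My yE.
rewrite u_Lam // yE; congr Lambda.
have := E_bimod Mx (M_id hM) Mw; rewrite th_id => h.
by rewrite -[x \o theta w]/(idfun \o x \o theta w) h.
Qed.

Lemma usE_Sg a b : Sg a b -> Sg (us a) (us b).
Proof.
move=> /Sg_core h; apply/Sg_core => e /h[x nx [h1 h2]].
have Mx := n2M nx; have [y My yE] := E_rng Mx; case: nx => n1 n2'.
have [ny uy] := us_Lam n1 My yE.
have [|nya uya] := us_Lam n2' (M_adj hM My); first by rewrite th_adj // yE E_adj.
exists y; first by split.
rewrite -uy -uya -!(boB us_bo); split; first exact: le_trans (us_nr _) h1.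
exact: le_trans (us_nr _) h2.
Qed.

Lemma commute_J : u \o J = J \o u.
Proof.
have FuE a b : Fg a b -> Fg (u a) (u b).
  by move=> Fab c d Scd; rewrite -us_rd (Fab _ _ (usE_Sg Scd)) rdC us_rd rdC.
have [hB hC _ _] := resg_bo hG; have pB := resg_psa hG; have pC := resh_psa hG.
set B := resg G in hB pB *; set C := resh G in hC pC *.
(* As [u] commutes with [S] and [F], it sends the equations that determine [B b] and [J (C b)] to
   those for [u b]. *)
have uBC b : B (u b) = u (B b) /\ C (u b) = jinv (u (J (C b))).
  have [h1 h2] := resgP hG b.
  have S1 := u_Sg (G_Sg hJ hS h1).
  have F1 : Fg (J (C b)) (b - B b) by apply/(Fg_G hJ hG hS); rewrite (JK hJ).
  apply: (resg_uniq hG); first exact/(Sg_G hJ hS).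
  by have /(Fg_G hJ hG hS) := FuE _ _ F1; rewrite (boB u_bo).
have CC a : C (C a) = B (a - B a) by exact: resh_sq.
have uCC a : u (C (C a)) = C (C (u a)).
  by rewrite !CC -[RHS]/(B _); have [e _] := uBC a; rewrite e -(boB u_bo); have [-> _] := uBC (a - B a).
(* [X] is the commutator of [u] and [C]; since [u] commutes with [C^2], it anticommutes with [C]. As
   [C >= 0], [|X a| <= |(1 + C) X a| = |X (1 - C) a|]. Iterating, the powers of [1 - C] tend to [0]
   because [C] is injective, so [X = 0]. *)
pose X a := u (C a) - C (u a).
have hX : bo X.
  have -> : X = (u \o C) - (C \o u) by apply: funext => a; rewrite opE opNE.
  by apply: bo_sub; [exact: bo_comp u_bo hC|exact: bo_comp hC u_bo].
have CX a : C (X a) = - X (C a).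
  by rewrite /X (boB hC) -uCC opprB.
have [_ sC posC] := pC.
pose W := (idfun : K -> K) - C.
have WE a : W a = a - C a by rewrite /W opE opNE.
have step a : nr (X a) <= nr (X (W a)).
  rewrite WE (boB hX) -[- X (C a)]CX.
  apply: nr_le; first exact: nr_ge0.
  rewrite nr2; move: (X a) => v; rewrite rdDl !rdDr (rdC v (C v)).
  have := posC v; have := rd_ge0 (C v); lra.
have bC1 : bnd 1 C by have [_ _ _ ] := resg_bo hG.
have C1 : ole C idfun.
  move=> k; apply: le_trans (rd_le _ _) _; rewrite /= -nr2 expr2 ler_wpM2r ?nr_ge0 //.
  by have := bC1 k; rewrite mul1r.
have pW : psa W by apply: psaB => //; exact: psa_id.
have W1 : ole W idfun.
  by move=> k; rewrite WE rdBl /= lerBlDr lerDl; exact: posC.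
have ker0 := @G_ker0 _ _ _ _ _ _ _ _ hM hJ hG hS.
have kW k : W k = k -> k = 0.
  rewrite WE => h; apply: (resh_inj hG ker0); rewrite -/C -(subKr k (C k)) h; exact: subrr.
have X0 a : X a = 0.
  have it n : nr (X a) <= nr (X (iter n W a)).
    by elim: n => //= n IH; exact: le_trans IH (step _).
  have L := bo_scvg hX (power_lim pW W1 kW a).
  apply: nr_eq0; apply/eqP; rewrite eq_le nr_ge0 andbT; rewrite (bo0 hX) in L.
  have L2 : nr ((X \o (fun n => iter n W a)) n - 0) @[n --> \oo] --> (0 : R) by exact: L.
  by apply: (cvg_lb _ L2) => n; rewrite subr0; exact: it.
pose A := jinv \o u \o J.
have nA a : nr (A a) = nr a by rewrite /A /= (nrJinv hJ) u_nr (nrJ hJ).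
have bA : bnd 1 A by move=> a; rewrite nA mul1r.
have hA : bo A.
  apply: (bo_mk _ ler01 bA) => k a b; rewrite /A /=.
  by rewrite (JD hJ) (JZ hJ) (boD u_bo) (boZ u_bo) (JinvD hJ) (JinvZ hJ) conjCK.
have tC : tot (range C).
  apply: orth_tot.
  - by exists 0 => //; rewrite (bo0 hC).
  - by move=> _ _ [a _ <-] [b _ <-]; exists (a + b) => //; rewrite (boD hC).
  - by move=> k _ [a _ <-]; exists (k%:C *: a) => //; rewrite (boZ hC).
  - move=> w h; apply: (resh_inj hG ker0); apply: rd_inj => c.
    by rewrite rd0l -/C sC h //; exists c.
(* [J^-1 u J C = C u = u C], and the range of [C] is dense. *)
have Au : A = u.
  apply: (bo_eq_tot tC hA u_bo) => _ [b _ <-].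
  have [_ e] := uBC b; rewrite /A /= -e; apply/esym/eqP; rewrite -subr_eq0; apply/eqP; exact: X0.
by apply: funext => a /=; rewrite -{2}Au /A /= (JinvK hJ).
Qed.

End Converse.
End Tomita.
End Endomorphism.

Theorem theorem3p4 (R : realType) (H K : hilbert R)
    (M : set (op H)) (phi : op H -> \bar R)
    (Lambda : op H -> K) (pi : op H -> op K) (J : op K)
    (theta : op H -> op H) (u e : op K)
    (hM : von_neumann_algebra M)
    (hphi : fns_weight M phi)
    (hGNS : is_gns M phi Lambda pi)
    (hJ : is_modular_conjugation M phi Lambda J)
    (htheta : unital_normal_endomorphism M theta)
    (hinv : preserves_weight M phi theta)
    (hu : is_gns_isometry M phi Lambda theta u)
    (he : orth_proj_on (closure (Lambda @` (theta @` M `&` nphi M phi))) e) :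
  [/\ equimodular M phi J theta u <->
        exists E, fn_preserving_expectation M phi (theta @` M) E,
      forall E E', fn_preserving_expectation M phi (theta @` M) E ->
        fn_preserving_expectation M phi (theta @` M) E' ->
        forall x, M x -> E x = E' x,
      forall E, fn_preserving_expectation M phi (theta @` M) E ->
        forall x, M x -> pi (E x) \o e = e \o pi x \o e &
      e = u \o adj u].
Proof.
have [aJ [G hG hS]] := hJ.
have eE := projection_range hM hGNS htheta hinv hu he.
have formula E : fn_preserving_expectation M phi (theta @` M) E ->
    forall x, M x -> pi (E x) \o e = e \o pi x \o e.
  move=> hE x Mx; rewrite eE; apply: funext => k /=.
  exact: (expectation_formula hM hphi hGNS htheta hinv hu hE).
split=> //.
- split=> [[_ uJ]|[E hE]].
    exists (theta \o compress M pi u).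
    exact: (expectation_exists hM hphi hGNS htheta hinv hu aJ hG hS uJ).
  split=> //; exact: (commute_J hM hphi hGNS htheta hinv hu aJ hG hS hE).
- move=> E E' hE hE' x Mx.
  (* Both values lie in [theta M]. On the range of [u] the formula and the intertwining [u_pi] give
     [u (pi y k) = u (pi z k)], and [u] and [pi] are injective. *)
  have [y My yE] := E_rng hE Mx; have [z Mz zE] := E_rng hE' Mx.
  rewrite -yE -zE; congr theta; apply: (pi_inj2 hM hphi hGNS) => //; apply: funext => k.
  have := congr1 (fun f => f (u k)) (etrans (formula E hE x Mx) (esym (formula E' hE' x Mx))).
  rewrite /= eE /= (usu hu) -yE -zE -!(u_pi hM hphi hGNS htheta hinv hu) // => h.
  by rewrite -(usu hu (pi y k)) h (usu hu).
Qed.
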